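(* Assume that $X$ is affine linear. Let $a:[0,\infty)\to\mathfrak a$ be a solution to the relaxed control system (C) and let $b_0\in\mathfrak a$ be such that $a(0)=a_0\preceq b_0$. Then there exists a solution $b:[0,\infty)\to\mathfrak a$ to (C) with $b(0)=b_0$ such that $a(t)\preceq b(t)$ for all $t\in[0,\infty)$.
   Context: Setting. $\mathfrak g$ is a finite-dimensional real semisimple Lie algebra with an involutive automorphism $s$, and $\mathfrak g=\mathfrak k\oplus\mathfrak p$ is the decomposition into the $+1$ and $-1$ eigenspaces of $s$. The symmetric Lie algebra $(\mathfrak g,s)$ is orthogonal, i.e. $\mathfrak k$ is compactly embedded in $\mathfrak g$; fix an inner product on $\mathfrak g$ invariant under $s$ and $\mathrm{ad}_{\mathfrak k}$. $\mathbf G$ is a Lie group with Lie algebra $\mathfrak g$ such that the analytic subgroup $\mathbf K\subseteq\mathbf G$ generated by $\mathfrak k$ is compact (and connected). $\mathbf K$ acts on $\mathfrak p$ by the adjoint action $\mathrm{Ad}$. $\mathfrak a\subseteq\mathfrak p$ is a maximal Abelian subspace and $\mathbf W=N_{\mathbf K}(\mathfrak a)/Z_{\mathbf K}(\mathfrak a)$ is the Weyl group acting on $\mathfrak a$. $\Pi_{\mathfrak a}:\mathfrak p\to\mathfrak a$ is the orthogonal projection. $X$ is a vector field on $\mathfrak p$ (a map $\mathfrak p\to\mathfrak p$). For $K\in\mathbf K$ the induced vector field on $\mathfrak a$ is $X_K(a)=\Pi_{\mathfrak a}\big(\mathrm{Ad}_K^{-1}(X(\mathrm{Ad}_K(a)))\big)$,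 and $\mathsf{derv}(a)=\{X_K(a):K\in\mathbf K\}$. Relaxed control system (C): $a'(t)\in\mathrm{conv}(\mathsf{derv}(a(t)))$, with $\mathrm{conv}$ the convex hull; a solution is a (locally) absolutely continuous function $a:[0,\infty)\to\mathfrak a$ satisfying this almost everywhere. Majorization: for $a,b\in\mathfrak a$, $a\preceq b$ means $a\in\mathrm{conv}(\mathbf Wb)$, the convex hull of the Weyl group orbit of $b$. *)

(* Defs.v *)
From HB Require Import structures.
From mathcomp Require Import all_boot all_order all_algebra.
From mathcomp Require Import all_classical all_reals all_analysis.
Set Implicit Arguments.
Unset Strict Implicit.
Unset Printing Implicit Defensive.
Import Order.TTheory GRing.Theory Num.Theory.
Import numFieldNormedType.Exports.
Local Open Scope classical_set_scope.
Local Open Scope ring_scope.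

(* A finite-dimensional real Lie algebra has carrier 'rV[R]_n (a choice of
   basis), with its canonical topology, and bracket [br]. *)
Section LieAlgebra.
Variables (R : realType) (n : nat).
Local Notation V := 'rV[R]_n.
Implicit Types (br : V -> V -> V) (s : 'End(V)) (U h : {vspace V}).

Definition is_lie_bracket (br : {bilinear V -> V -> V}) : Prop :=
  (forall x, br x x = 0) /\
  (forall x y z, br x (br y z) + br y (br z x) + br z (br x y) = 0).

Definition derived br U : {vspace V} :=
  <<[seq br x y | x <- vbasis U, y <- vbasis U]>>%VS.

Definition is_solvable br U : Prop := exists m, iter m (derived br) U = 0%VS.

Definition is_ideal br U : Prop := forall x y, y \in U -> br x y \in U.

Definition is_semisimple br : Prop :=
  forall U, is_ideal br U -> is_solvable br U -> U = 0%VS.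

Definition is_involutive_automorphism br s : Prop :=
  (forall x, s (s x) = x) /\ (forall x y, s (br x y) = br (s x) (s y)).

Definition kpart s : {vspace V} := fixedSpace s.
Definition ppart s : {vspace V} := passmx.leigenspace s (-1).

Definition expmx (M : 'M[R]_n) : 'M[R]_n :=
  limn (series (fun m => (m`!%:R)^-1 *: M ^+ m)).

(* Matrices act on row vectors from the right: x *m ad_mx br z = [z, x]. *)
Definition ad_mx br (z : V) : 'M[R]_n := lin1_mx (br z).

Definition is_matrix_group (S : set 'M[R]_n) : Prop :=
  [/\ S 1%:M, forall M N, S M -> S N -> S (M *m N)
    & forall M, S M -> S (invmx M)].

(* The analytic subgroup of Int(g) generated by ad(h): the group generated by
   the exponentials. *)
Definition Int_subgroup br h : set 'M[R]_n :=
  smallest is_matrix_group [set expmx (ad_mx br z) | z in [set` h]].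

Definition compactly_embedded br h : Prop := compact (Int_subgroup br h).

Definition is_invariant_dot (ip : {dot V for idfun}) br s : Prop :=
  (forall x y, ip (s x) (s y) = ip x y) /\
  (forall z x y, z \in kpart s -> ip (br z x) y + ip x (br z y) = 0).

Definition is_abelian br U : Prop := {in U &, forall x y, br x y = 0}.

Definition is_maximal_abelian_in br (P U : {vspace V}) : Prop :=
  [/\ (U <= P)%VS, is_abelian br U
    & forall U', (U <= U' <= P)%VS -> is_abelian br U' -> U' = U].

Definition orth_proj (ip : V -> V -> R) U (x : V) : V :=
  get [set y | y \in U /\ {in U, forall z, ip (x - y) z = 0}].

Definition convex_hull (A : set V) : set V := smallest (@convex_set R V) A.

Definition is_affine_vector_field (P : {vspace V}) (X : V -> V) : Prop :=
  exists (L : 'End(V)) (c : V), {in P, forall x, X x = L x + c}.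

End LieAlgebra.

#[short(type="topGroupType")]
HB.structure Definition TopGroup := {G of Topological G & Group G}.

Section Smooth.
Variables (R : realType) (V W : normedModType R).

(* C^k on an open set U, for V finite-dimensional. *)
Fixpoint Ck_on (k : nat) (U : set V) (f : V -> W) : Prop :=
  if k is k'.+1 then
    (forall x, U x -> differentiable f x) /\ (forall v, Ck_on k' U ('D_v f))
  else forall x, U x -> {for x, continuous f}.

Definition smooth_on (U : set V) (f : V -> W) : Prop := forall k, Ck_on k U f.

End Smooth.

(* [cmap] is only meaningful on [cdom], and [cinv] on [cmap @` cdom]. *)
Record chart (R : realType) (n : nat) (G : Type) := Chart {
  cdom : set G;
  cmap :> G -> 'rV[R]_n;
  cinv : 'rV[R]_n -> G }.

Section LieGroup.
Variables (R : realType) (n : nat) (G : topGroupType).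
Local Notation V := 'rV[R]_n.
Implicit Types (c d e : chart R n G) (A : set (chart R n G)).

Definition cim c : set V := cmap c @` cdom c.

Definition is_chart c : Prop :=
  [/\ open (cdom c), open (cim c),
      forall g, cdom c g -> {for g, continuous c},
      forall v, cim c v -> {for v, continuous (cinv c)}
    & forall g, cdom c g -> cinv c (c g) = g].

Definition is_smooth_atlas A : Prop :=
  [/\ forall c, A c -> is_chart c,
      forall g, exists2 c, A c & cdom c g
    & forall c d, A c -> A d ->
        smooth_on (cmap c @` (cdom c `&` cdom d)) (fun v => d (cinv c v))].

Definition is_lie_group A : Prop :=
  [/\ hausdorff_space G, @second_countable G & is_smooth_atlas A] /\
  [/\ continuous (fun z : G * G => (z.1 * z.2)%g),
      continuous (fun g : G => g^-1%g),
      forall c d e, A c -> A d -> A e ->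
        smooth_on
          [set z : V * V | [/\ cim c z.1, cim d z.2
                             & cdom e (cinv c z.1 * cinv d z.2)%g]]
          (fun z : V * V => e (cinv c z.1 * cinv d z.2)%g)
    & forall c d, A c -> A d ->
        smooth_on [set v | cim c v /\ cdom d (cinv c v)^-1%g]
                  (fun v => d (cinv c v)^-1%g)].

(* The tangent space of G at 1 is identified with 'rV[R]_n through the
   differential at 1 of a fixed chart c around 1. *)
Definition Ad c (g : G) : V -> V := 'd (fun v => c (g * cinv c v * g^-1)%g) (c 1%g).

(* The bracket of Lie(G) is the derivative of Ad at 1. Composing c with a
   linear automorphism of 'rV[R]_n realises any identification of Lie(G) with
   the Lie algebra ('rV[R]_n, br). *)
Definition lie_algebra_is c (br : V -> V -> V) : Prop :=
  forall x y : V,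
    is_derive (0 : R) (1 : R)
      (fun t : R => Ad c (cinv c (c 1%g + t *: x)) y) (br x y).

Definition one_parameter_subgroup c (gam : R -> G) (x : V) : Prop :=
  [/\ forall t u : R, gam (t + u) = (gam t * gam u)%g,
      continuous gam
    & is_derive (0 : R) (1 : R) (fun t => c (gam t)) x].

Definition is_subgroup (S : set G) : Prop :=
  [/\ S 1%g, forall g h, S g -> S h -> S (g * h)%g
    & forall g, S g -> S g^-1%g].

(* The subgroup generated by exp(h). *)
Definition analytic_subgroup c (h : {vspace V}) : set G :=
  smallest is_subgroup
    [set g | exists gam x,
       [/\ x \in h, one_parameter_subgroup c gam x & g = gam 1]].

Section ControlSystem.
Variables (c : chart R n G) (K : set G) (a : {vspace V}).

Definition normalizer_in : set G :=
  [set k | K k /\ Ad c k @` [set` a] = [set` a]].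

(* The orbit of W = N_K(a) / Z_K(a): Z_K(a) fixes a pointwise, so it is the
   orbit of N_K(a). *)
Definition weyl_orbit (b : V) : set V := [set Ad c k b | k in normalizer_in].

Definition majorized (x b : V) : Prop := convex_hull (weyl_orbit b) x.

Definition induced_field (ip : V -> V -> R) (X : V -> V) (k : G) (x : V) : V :=
  orth_proj ip a (Ad c k^-1%g (X (Ad c k x))).

Definition derv (ip : V -> V -> R) (X : V -> V) (x : V) : set V :=
  [set induced_field ip X k x | k in K].

End ControlSystem.
End LieGroup.

Section RelaxedSolution.
Variables (R : realType) (n : nat).
Local Notation V := 'rV[R]_n.

Definition absolutely_continuous_upto (T : R) (f : R -> V) : Prop :=
  forall eps : R, 0 < eps -> exists2 delta : R, 0 < delta &
    forall (m : nat) (u v : 'I_m -> R),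
      (forall i, [/\ 0 <= u i, u i <= v i & v i <= T]) ->
      (forall i j, i != j -> v i <= u j \/ v j <= u i) ->
      \sum_i (v i - u i) < delta ->
      \sum_i `|f (v i) - f (u i)| < eps.

Definition relaxed_solution (a : {vspace V}) (F : V -> set V) (x : R -> V)
    : Prop :=
  [/\ forall t : R, 0 <= t -> x t \in a,
      forall T, absolutely_continuous_upto T x
    & {ae @lebesgue_measure R, forall t : R, 0 <= t ->
         derivable x t 1 /\ convex_hull (F (x t)) ('D_1 x t)}].

End RelaxedSolution.

(* Main.v *)
(* A step of the differential inclusion can be transported along majorization:
   if [a] lies in the hull of the orbit of [b] and [v] in conv(derv a), then some
   [u] near conv(derv b) keeps [a + h v] below [b + h u]. For this, write [a] and
   [v] as convex combinations of Weyl translates; by affinity of X, a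
   combination of induced fields at the translates is a value over [b], and the
   remaining points are compared through the inequality
   <z, w b> <= <z, b> for [z], [b] in one closed Weyl chamber. The solution [y]
   is the pointwise ultrafilter limit of the Euler polygons built this way.

   Every element of [a] is moved into the chamber by maximizing
   k |-> <Ad_k z, r> over K: the first-order condition puts Ad_k z in [a], the
   second-order condition puts it in the chamber of [r]. The chamber inequality is
   Kostant's: in the d-th exterior power of the noncompact dual algebra, the
   vector of the span of the top eigenspaces of ad z is a highest weight vector,
   so its K-translates stay in the stable subspace generated by it, all of whose
   weights at [b] are at most the top one; summing over the thresholds for [z]
   gives the trace inequality. *)
Require Import Defs.
From HB Require Import structures.
From mathcomp Require Import all_boot all_order all_algebra.
From mathcomp Require Import all_classical all_reals all_analysis.
From mathcomp Require Import perm ring lra.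
Import Order.TTheory GRing.Theory Num.Theory.
Import numFieldNormedType.Exports.
Local Open Scope classical_set_scope.
Local Open Scope ring_scope.
Set Implicit Arguments.
Unset Strict Implicit.
Unset Printing Implicit Defensive.

(** The chamber inequality compares two points of the same closed chamber, but an Euler step from
    [b] may leave the chamber of [b]. Each candidate [b + h v_i] is therefore brought back by a Weyl
    element. This element moves [b] itself by at most a constant times [h], so the corrected
    velocity misses conv(derv b) by O(h), a defect that vanishes in the limit. All this is done for
    abstract data on [a], where compactness of the normalizer does the work of finiteness of the
    Weyl group.

    The Lie algebra may mix compact and noncompact factors and [ip] is any invariant product, so
    [ad z] may have imaginary eigenvalues and [ip] need not be the form of the chamber inequality.
    The operator comparing [ip] with the Killing form corrects the bracket on [p] and so treats all
    factors at once; orbits are separated with the trace form of the corrected bracket.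

    Variations over [K] need a one-parameter subgroup in every direction of [k]; it is built in a
    chart, as a limit of powers of elements close to 1. *)

Lemma cvg_sumr (T : Type) (F : set_system T) (FF : Filter F) (K : numFieldType)
  (E : normedModType K) (I : Type) (r : seq I) (f : I -> T -> E) (l : I -> E) :
  (forall i, f i @ F --> l i) ->
  (fun x => \sum_(i <- r) f i x) @ F --> \sum_(i <- r) l i.
Proof.
move=> fl; elim: r => [|i r IH].
  by rewrite big_nil; under eq_fun do rewrite big_nil; exact: cvg_cst.
by rewrite big_cons; under eq_fun do rewrite big_cons; exact: cvgD.
Qed.

Lemma ultra_fmap (T U : Type) (F : set_system T) (f : T -> U) :
  UltraFilter F -> UltraFilter (f @ F).
Proof.
move=> FU; split; first exact: fmap_proper_filter.
move=> G GF FG; rewrite predeqE => A; split; last exact: FG.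
move=> GA; have [//|nA] := in_ultra_setVsetC (f @^-1` A) FU.
by have /filter_ex[? []] : G (A `&` ~` A) by apply: filterI => //; exact: FG.
Qed.

(** Stands in for convergent subsequences: one ultrafilter serves uncountably many sequences at
    once, without diagonal extraction. *)
Lemma ultra_compact_cvg (T : Type) (U : topologicalType) (F : set_system T)
  (f : T -> U) (A : set U) : UltraFilter F -> compact A ->
  (\forall x \near F, A (f x)) -> exists2 p, A p & f @ F --> p.
Proof.
move=> FU; rewrite compact_ultra => /(_ (f @ F)) cA FA.
by case: cA => [|//|p [Ap Fp]]; [exact: ultra_fmap|exists p].
Qed.

(** * Convex hulls in finite dimension: Carathéodory and compactness *)

Section ConvexHull.
Variables (R : realType) (n : nat).
Local Notation V := 'rV[R]_n.
Implicit Types (A C : set V).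

Lemma convex_set_comb C (x y : V) (t : R) : convex_set (C : set (convex_lmodType V)) ->
  0 <= t -> t <= 1 -> C x -> C y -> C (t *: x + (1 - t) *: y).
Proof.
move=> cC t0 t1 Cx Cy; have := cC x y (Itv01 t0 t1).
by rewrite !inE; apply.
Qed.

Lemma convex_setI C : (forall (x y : V) (t : R), 0 <= t -> t <= 1 -> C x -> C y ->
    C (t *: x + (1 - t) *: y)) -> convex_set (C : set (convex_lmodType V)).
Proof.
move=> H x y l; rewrite !inE => Cx Cy; apply: H => //.
Qed.

Lemma convex_set_sum C (I : Type) (r : seq I) (l : I -> R) (u : I -> V) :
  convex_set (C : set (convex_lmodType V)) ->
  (forall i, 0 <= l i) -> (forall i, C (u i)) ->
  0 < \sum_(i <- r) l i ->
  C ((\sum_(i <- r) l i)^-1 *: \sum_(i <- r) l i *: u i).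
Proof.
move=> cC l0 Cu; elim: r => [|i r IH]; first by rewrite big_nil ltxx.
rewrite !big_cons; set S := \sum_(j <- r) l j => Sp.
have S0 : 0 <= S by apply: sumr_ge0.
have [Sz|Snz] := eqVneq S 0.
  have -> : \sum_(j <- r) l j *: u j = 0.
    have : forall r', \sum_(j <- r') l j = 0 -> \sum_(j <- r') l j *: u j = 0.
      elim=> [|j r' IH']; first by rewrite !big_nil.
      rewrite !big_cons => /eqP; rewrite paddr_eq0 ?sumr_ge0// => /andP[/eqP -> /eqP /IH' ->].
      by rewrite scale0r addr0.
    exact.
  rewrite Sz !addr0 scalerA mulVf ?scale1r//.
  by apply/eqP => liz; move: Sp; rewrite Sz liz addr0 ltxx.
have {}Snz : 0 < S by rewrite lt_neqAle eq_sym Snz.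
have {}IH := IH Snz.
have -> : (l i + S)^-1 *: (l i *: u i + \sum_(j <- r) l j *: u j) =
   (l i / (l i + S)) *: u i + (1 - l i / (l i + S)) *: (S^-1 *: \sum_(j <- r) l j *: u j).
  rewrite scalerDr scalerA [_^-1 * _]mulrC; congr (_ + _).
  rewrite scalerA; congr (_ *: _).
  by field; rewrite !lt0r_neq0.
apply: convex_set_comb => //; first by rewrite divr_ge0// ltW.
by rewrite ler_pdivrMr// mul1r lerDl.
Qed.

Lemma convex_hullP A (x : V) : convex_hull A x <->
  exists (I : finType) (l : I -> R) (u : I -> V),
    [/\ forall i, 0 <= l i, \sum_i l i = 1, forall i, A (u i) & x = \sum_i l i *: u i].
Proof.
split=> [|[I [l [u [l0 l1 Au ->]]]]]; last first.
  move=> C [cC AC]; have := @convex_set_sum C I (index_enum I) l u cC l0 (fun i => AC _ (Au i)).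
  by rewrite l1 invr1 scale1r; apply.
move=> hx; apply: (hx [set x | exists (I : finType) (l : I -> R) (u : I -> V),
    [/\ forall i, 0 <= l i, \sum_i l i = 1, forall i, A (u i) & x = \sum_i l i *: u i]]).
split.
  apply: convex_setI => y z t t0 t1 [I [l [u [l0 l1 Au ->]]]] [J [m [v [m0 m1 Av ->]]]].
  exists (I + J)%type, (fun k => match k with inl i => t * l i | inr j => (1 - t) * m j end),
    (fun k => match k with inl i => u i | inr j => v j end); split.
  - by case=> i; rewrite mulr_ge0// subr_ge0.
  - by rewrite big_sumType/= -!mulr_sumr l1 m1 !mulr1 addrC subrK.
  - by case.
  - rewrite big_sumType/= !scaler_sumr; congr (_ + _); apply: eq_bigr => i _; rewrite scalerA//.
move=> y Ay; exists 'I_1, (fun=> 1), (fun=> y); split=> //.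
- by rewrite big_ord1.
- by rewrite big_ord1 scale1r.
Qed.

Lemma sub_convex_hull A : A `<=` convex_hull A.
Proof. by move=> x Ax C [_]; apply. Qed.

Lemma convex_hull_convex A : convex_set (convex_hull A : set (convex_lmodType V)).
Proof.
apply: convex_setI => x y t t0 t1 hx hy C [cC AC].
by apply: convex_set_comb => //; [apply: hx|apply: hy].
Qed.

Lemma convex_hull_comb A (I : finType) (l : I -> R) (u : I -> V) :
  (forall i, 0 <= l i) -> \sum_i l i = 1 -> (forall i, convex_hull A (u i)) ->
  convex_hull A (\sum_i l i *: u i).
Proof.
move=> l0 l1 Au.
have := @convex_set_sum _ _ (index_enum I) l u (@convex_hull_convex A) l0 Au.
by rewrite l1 invr1 scale1r; apply.
Qed.

(** The rows [(1, u i)] live in dimension [n + 1], so more than [n + 1] of them admit a nonzero left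
    kernel vector; the column of ones gives the condition on the sum. Coefficients of sum zero that
    are not all zero include a positive one. *)
Lemma affine_dependence (I : finType) (J : {set I}) (u : I -> V) : (n.+1 < #|J|)%N ->
  exists m : I -> R, [/\ forall i, i \notin J -> m i = 0, exists i, 0 < m i,
    \sum_i m i = 0 & \sum_i m i *: u i = 0].
Proof.
move=> cJ.
pose M : 'M[R]_(#|J|, 1 + n) := \matrix_(i, j) (row_mx 1%:M (u (enum_val i))) 0 j.
have : kermx M != 0.
  rewrite -mxrank_eq0 mxrank_ker subn_eq0 -ltnNge.
  exact: (leq_ltn_trans (rank_leq_col M)).
move=> /matrix0Pn[i0 [j0 nz]].
have [w [wM nzw]] : exists w : 'rV[R]_#|J|, w *m M = 0 /\ w 0 j0 != 0.
  by exists (row i0 (kermx M)); rewrite -row_mul mulmx_ker row0 mxE.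
(* The kernel vector is indexed by positions in [J]; summing over the fibres of [enum_val] moves it
   to [I], with value 0 outside [J]. *)
pose m0 (i : I) : R := \sum_(k < #|J| | enum_val k == i) w 0 k.
have sumE (E : lmodType R) (f : I -> E) : \sum_i m0 i *: f i = \sum_k w 0 k *: f (enum_val k).
  rewrite [RHS](partition_big (fun k => enum_val k) predT)//=.
  by apply: eq_bigr => i _; rewrite scaler_suml; apply: eq_bigr => k /eqP ->.
have m0J i : i \notin J -> m0 i = 0.
  move=> iJ; rewrite /m0 big1// => k /eqP kE; move: iJ; rewrite -kE.
  by rewrite enum_valP.
have m0s : \sum_i m0 i = 0.
  have := sumE R^o (fun=> 1); under eq_bigr do rewrite /GRing.scale/= mulr1.
  move=> ->; transitivity ((w *m M) 0 (lshift n 0)); last by rewrite wM !mxE.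
  rewrite [RHS]mxE; apply: eq_bigr => k _.
  by rewrite [M _ _]mxE row_mxEl mxE eqxx.
have m0v : \sum_i m0 i *: u i = 0.
  rewrite sumE; apply/rowP => j.
  transitivity ((w *m M) 0 (rshift 1 j)); last by rewrite wM !mxE.
  rewrite summxE [RHS]mxE; apply: eq_bigr => k _.
  by rewrite [M _ _]mxE row_mxEr [LHS]mxE.
have m0nz : exists i, m0 i != 0.
  exists (enum_val j0); rewrite /m0 (bigD1 j0)//= big1 ?addr0.
    by [].
  by move=> k /andP[/eqP/enum_val_inj ->]; rewrite eqxx.
suff [i mi] : exists i, 0 < m0 i by exists m0; split=> //; exists i.
case: m0nz => i mi; apply: contrapT => /forallNP H.
have H' k : 0 <= - m0 k by rewrite oppr_ge0 leNgt; apply/negP; exact: H.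
have : \sum_i - m0 i = 0 by rewrite sumrN m0s oppr0.
move=> /eqP; rewrite psumr_eq0// => /allP/(_ i (mem_index_enum _))/=.
by rewrite oppr_eq0 (negPf mi).
Qed.

(** Moving [l] along an affine dependence keeps the total weight and the barycentre. The largest
    admissible step, the smallest ratio [l i / m i] over [m i > 0], keeps all weights nonnegative
    and kills one of them. *)
Lemma caratheodory_step (I : finType) (l : I -> R) (u : I -> V) :
  (forall i, 0 <= l i) -> (n.+1 < #|[set i | l i != 0%R]%SET|)%N ->
  exists l' : I -> R, [/\ forall i, 0 <= l' i, \sum_i l' i = \sum_i l i,
    \sum_i l' i *: u i = \sum_i l i *: u i &
    (#|[set i | l' i != 0%R]%SET| < #|[set i | l i != 0%R]%SET|)%N].
Proof.
move=> l0 cl; have [m [mJ [i0 mi0] ms mv]] := affine_dependence u cl.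
pose i1 := [arg min_(i < i0 | 0 < m i) (l i / m i)]%O.
have [mi1 imin] : 0 < m i1 /\ forall j, 0 < m j -> l i1 / m i1 <= l j / m j.
  by rewrite /i1; case: arg_minP => // i mi H; split.
pose t := l i1 / m i1.
have t0 : 0 <= t by rewrite divr_ge0// ltW.
exists (fun i => l i - t * m i); split.
- move=> i; rewrite subr_ge0; have [mi|mi] := ltP 0 (m i).
    by rewrite -ler_pdivlMr// imin.
  by apply: le_trans (l0 i); rewrite mulr_ge0_le0.
- by rewrite sumrB -mulr_sumr ms mulr0 subr0.
- under eq_bigr do rewrite scalerBl -scalerA.
  by rewrite sumrB -scaler_sumr mv scaler0 subr0.
- apply: proper_card; apply/properP; split.
    apply/fintype.subsetP => i; rewrite !inE; apply: contra => /eqP li.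
    have /mJ -> : i \notin [set i | l i != 0%R]%SET by rewrite inE li eqxx.
    by rewrite li mulr0 subr0.
  exists i1; rewrite !inE.
    by apply: contraTneq mi1 => li; rewrite (mJ i1) ?ltxx// inE li eqxx.
  by rewrite /t divfK ?subrr ?eqxx// gt_eqF.
Qed.

(** The index type does not depend on the point, which is what compactness of the hull needs. Short
    combinations are padded with zero weights at the point [u i0]. *)
Lemma caratheodory A (x : V) : convex_hull A x ->
  exists (l : 'I_n.+1 -> R) (u : 'I_n.+1 -> V),
    [/\ forall i, 0 <= l i, \sum_i l i = 1, forall i, A (u i) & x = \sum_i l i *: u i].
Proof.
move=> /convex_hullP[I [l [u [l0 l1 Au ->]]]].
have [N] := ubnP #|[set i | l i != 0%R]%SET|; elim: N l l0 l1 => // N IH l l0 l1 cN.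
have [cl|cl] := leqP #|[set i | l i != 0%R]%SET| n.+1; last first.
  have [l' [l'0 l's l'v l'c]] := caratheodory_step u l0 cl.
  rewrite -l'v; apply: IH => //; first by rewrite l's.
  exact: leq_trans l'c _.
set J := [set i | l i != 0%R]%SET in cl.
have [i0 _] : exists i, l i != 0.
  apply: contrapT => /forallNP H; have /eqP := l1; rewrite big1 ?(eq_sym 0) ?oner_eq0//.
  by move=> i _; apply/eqP/negPn/negP; exact: H.
have sumE (E : lmodType R) (f : I -> E) : \sum_i l i *: f i =
    \sum_(k < n.+1) (if (k < #|J|)%N then l (nth i0 (enum J) k) else 0) *: f (nth i0 (enum J) k).
  rewrite (bigID (mem J))/= [X in _ + X]big1 ?addr0; last first.
    by move=> i; rewrite inE negbK => /eqP ->; rewrite scale0r.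
  rewrite -big_enum/= (big_nth i0) -cardE -(big_mkord predT
    (fun k => (if (k < #|J|)%N then l (nth i0 (enum J) k) else 0) *: f (nth i0 (enum J) k))).
  rewrite [RHS](big_cat_nat (n := #|J|))//= [X in _ = _ + X]big_nat_cond [X in _ = _ + X]big1 ?addr0.
    by rewrite [RHS]big_nat_cond [LHS]big_nat_cond; apply: eq_bigr => k; rewrite andbT => /andP[_ ->].
  by move=> k /andP[/andP[Jk _] _]; rewrite ltnNge Jk scale0r.
exists (fun k => if (k < #|J|)%N then l (nth i0 (enum J) k) else 0), (fun k => u (nth i0 (enum J) k)).
split=> //; first by move=> i; case: ifP.
  have := sumE R^o (fun=> 1); under eq_bigr do rewrite /GRing.scale/= mulr1.
  by rewrite l1 => ->; apply: eq_bigr => k _; rewrite /GRing.scale/= mulr1.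
exact: sumE.
Qed.

(** With combinations of fixed length, weights and points converge separately along the ultrafilter,
    in [[0, 1]] and in [A]. *)
Lemma convex_hull_compact A : compact A -> compact (convex_hull A).
Proof.
move=> cA; rewrite compact_ultra => F FU FA.
have /choice[f fP] : forall x, exists y : ('I_n.+1 -> R) * ('I_n.+1 -> V), convex_hull A x ->
   [/\ forall i, 0 <= y.1 i, \sum_i y.1 i = 1, forall i, A (y.2 i) &
    x = \sum_i y.1 i *: y.2 i].
  move=> x; have [hx|hx] := pselect (convex_hull A x); last first.
    by exists (fun=> 0, fun=> 0).
  by have [l [u lu]] := caratheodory hx; exists (l, u).
have lcv i : exists l0, [set` `[0, 1]] l0 /\ (fun x => (f x).1 i) @ F --> (l0 : R).
  have [|l0 ? ?] := @ultra_compact_cvg _ _ F (fun x => (f x).1 i) _ FU (@segment_compact R 0 1).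
    apply: filterS FA => x /fP [l0 l1 _ _] /=; rewrite in_itv/= l0/=.
    by rewrite -l1 (bigD1 i)//= lerDl sumr_ge0.
  by exists l0.
have ucv i : exists u0, A u0 /\ (fun x => (f x).2 i) @ F --> (u0 : V).
  have [|u0 ? ?] := @ultra_compact_cvg _ _ F (fun x => (f x).2 i) _ FU cA.
    by apply: filterS FA => x /fP [].
  by exists u0.
have [l lP] := choice lcv; have [u uP] := choice ucv.
exists (\sum_i l i *: u i); split.
  apply/convex_hullP; exists 'I_n.+1, l, u; split=> //.
  - by move=> i; have [+ _] := lP i; rewrite /= in_itv/= => /andP[].
  - have : (fun x => \sum_i (f x).1 i) @ F --> \sum_i l i.
      by apply: cvg_sumr => i; have [] := lP i.
    have h : (fun x => \sum_i (f x).1 i) @ F --> (1 : R).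
      apply: cvg_near_cst; apply: filterS FA => x /fP[]//.
    by move=> h1; exact: (cvg_unique _ h1 h).
  - by move=> i; have [] := uP i.
have h : (fun x => \sum_i (f x).1 i *: (f x).2 i) @ F --> \sum_i l i *: u i.
  apply: cvg_sumr => i; apply: cvgZ; [by have [] := lP i|by have [] := uP i].
have : (fun x : V => x) @ F --> \sum_i l i *: u i.
  apply: cvg_trans h; apply: near_eq_cvg; apply: filterS FA => x /fP[]//.
by [].
Qed.

End ConvexHull.

(** * Almost everywhere differentiability of Lipschitz functions *)

Lemma derivable_affine (R : realType) (c L t : R) : derivable (fun x : R => c - L * x) t 1.
Proof. by []. Qed.

Section LipschitzDerivable.
Variable R : realType.
Local Notation mu := (@lebesgue_measure R).
Local Open Scope ereal_scope.

(** On half-open intervals the Stieltjes measure is at most [M] times the length, so a cover of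
    small total length has small Stieltjes mass. *)
Lemma stieltjes_lipschitz_dominates (G : cumulative R R) (M : R) :
  (forall x y, (x <= y)%R -> (G y - G x <= M * (y - x))%R) ->
  forall A : set (measurableTypeR R), measurable A -> mu A = 0 ->
    lebesgue_stieltjes_measure G A = 0.
Proof.
move=> GM A mA A0; apply/eqP; rewrite eq_le measure_ge0 andbT.
have M0 : (0 <= M)%R.
  have := GM 0%R 1%R ler01; rewrite subr0 mulr1; apply: le_trans.
  by rewrite subr_ge0 (cumulative_is_nondecreasing G).
apply/lee_addgt0Pr => e e0; rewrite add0e.
have d0 : (0 < e / (M + 1))%R by rewrite divr_gt0// ltr_pwDr.
have : mu A < (e / (M + 1))%:E by rewrite A0 lte_fin.
move=> /ereal_inf_lt[_ [F [mF AF] <-]] Fd.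
apply: (@le_trans _ _ (\sum_(k <oo) wlength G (F k))).
  by apply: ereal_inf_lbound; exists F.
apply: (@le_trans _ _ (\sum_(k <oo) M%:E * wlength idfun (F k))).
  apply: lee_nneseries => k *; first exact: wlength_ge0.
  have [[a b] _ <-] := mF k; rewrite /= !wlength_itv/=.
  case: ifPn => [|_]; last by rewrite mule0.
  rewrite lte_fin => ab.
  by rewrite -!EFinB -EFinM lee_fin GM// ltW.
rewrite nneseriesZl//.
apply: (@le_trans _ _ (M%:E * (e / (M + 1))%:E)).
  by apply: lee_wpmul2l => //; rewrite ltW.
rewrite -EFinM lee_fin mulrCA ger_pMr// ler_pdivrMr ?mul1r ?lerDl//.
by rewrite ltr_pwDr.
Qed.

(** Adding [L t] makes [g] nondecreasing. The Stieltjes measure of the sum [G] is absolutely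
    continuous, so [G] is, up to a constant, the integral of a Radon-Nikodym density, and the
    fundamental theorem of calculus differentiates it almost everywhere. Bounded intervals keep the
    measure finite. *)
Lemma lipschitz_ae_derivable (g : R -> R) (L : R) :
  (forall x y, (`|g x - g y| <= L * `|x - y|)%R) ->
  {ae mu, forall t, derivable g t 1%R}.
Proof.
move=> gL.
have L0 : (0 <= L)%R by have := le_trans (normr_ge0 _) (gL 1%R 0%R); rewrite subr0 normr1 mulr1.
pose G t := (g t + L * t)%R.
have Gnd : nondecreasing G.
  move=> x y xy; rewrite /G -subr_ge0.
  have := gL x y; rewrite (ler0_norm (x := (x - y)%R)) ?subr_le0// => h.
  have := le_trans (ler_norm _) h; lra.
have GL x y : (x <= y)%R -> (G y - G x <= (2 * L) * (y - x))%R.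
  move=> xy; rewrite /G; have := gL y x; rewrite (ger0_norm (x := (y - x)%R)) ?subr_ge0//.
  move=> h; have := le_trans (ler_norm _) h; lra.
have Gc : continuous G.
  move=> x; apply: cvgD; last by apply: cvgMr; exact: cvg_id.
  apply/cvgrPdist_le => e e0.
  have [Lz|Ln0] := eqVneq L 0%R.
    by apply: nearW => y; apply: le_trans (gL _ _) _; rewrite Lz mul0r ltW.
  near=> y; apply: le_trans (gL _ _) _.
  rewrite -ler_pdivlMl ?lt_neqAle ?(eq_sym 0%R) ?Ln0//.
  near: y; apply: cvgr_dist_le; [exact: cvg_id|].
  by rewrite mulr_gt0// invr_gt0 lt_neqAle (eq_sym 0%R) Ln0.
pose Gcu : cumulative R R := HB.pack G (isCumulative.Build R _ R G Gnd (right_continuousW Gc)).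
pose nu := lebesgue_stieltjes_measure Gcu.
have nuE (a b : R) : (a <= b)%R -> nu `]a, b]%classic = (G b - G a)%:E.
  move=> ab; rewrite /nu/= /lebesgue_stieltjes_measure /measure_extension measurable_mu_extE//=; last exact: is_ocitv.
  by rewrite wlength_itv_bnd.
have H (N : nat) : {ae mu, forall t, (- N.+1%:R < t < N.+1%:R)%R -> derivable g t 1%R}.
  pose a : R := (- N.+1%:R)%R; pose b : R := N.+1%:R.
  have ab : (a <= b)%R by rewrite /a /b; apply: (@le_trans _ _ 0%R); rewrite ?oppr_le0.
  have mD : measurable (`]a, b]%classic : set (measurableTypeR R)) by exact: measurable_itv.
  have Doo : nu `]a, b]%classic < +oo by rewrite nuE// ltry.
  pose nuN := mfrestr mD Doo.
  have dom : nuN `<< mu.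
    move=> A nA C mC CA; rewrite /nuN /mfrestr /mrestr.
    apply: (@stieltjes_lipschitz_dominates Gcu _ GL); first exact: measurableI.
    apply/eqP; rewrite -measure_le0; apply: (@le_trans _ _ (mu C)); last by rewrite (nA C).
    by apply: le_measure; rewrite ?inE//; exact: measurableI.
  have [f [f0 ffin fint fE]] := radon_nikodym_sigma_finite dom.
  have fine_fE : EFin \o (fine \o f) = f by apply/funext => x /=; rewrite fineK.
  have intf : mu.-integrable setT (EFin \o (fine \o f)) by rewrite fine_fE.
  have locf : locally_integrable setT (fine \o f).
    by apply: open_integrable_locally => //; exact: openT.
  have := @FTC1 R (fine \o f) (BRight a) _ locf.
  have intS y : mu.-integrable [set` Interval (BRight a) (BRight y)] (EFin \o (fine \o f)).
    by apply: (integrableS measurableT) => //; exact: measurable_itv.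
  move=> /(_ intS); apply: filterS; first exact: (ae_filter_ringOfSetsType mu).
  move=> t /= Ht /andP[at_ tb].
  have /Ht[+ _] : (BRight a < BRight t)%O by rewrite bnd_simp.
  have FE x : (a < x < b)%R ->
      (\int[mu]_(s in `]a, x]) (fine \o f) s)%R = (G x - G a)%R.
    move=> /andP[ax xb]; rewrite /Rintegral.
    under eq_integral do rewrite /= fineK//.
    rewrite -fE; last exact: measurable_itv.
    have nuNE : nuN `]a, x]%classic = nu `]a, x]%classic.
      rewrite /nuN /mfrestr /mrestr; congr (nu _).
      apply/seteqP; split=> z /=; rewrite !in_itv/=; first by move=> [].
      by move=> /andP[-> zx]; split=> //; exact: le_trans zx (ltW xb).
    by rewrite -[LHS]/(fine (nuN _)) nuNE nuE// ltW.
  move=> dF.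
  have nt : \forall x \near t, (\int[mu]_(s in `]a, x]) (fine \o f) s)%R = (G x - G a)%R.
    near=> x; apply: FE; apply/andP; split; near: x.
      exact: lt_nbhsr.
    exact: lt_nbhsl.
  have dG : derivable (fun x => G x - G a)%R t 1%R by apply: near_eq_derivable dF.
  rewrite (_ : g = (fun x => (G x - G a) + (G a - L * x))%R); last first.
    by apply/funext => x; rewrite /G; ring.
  have dl := @derivable_affine R (G a) L t.
  exact: (derivableD dG dl).
have := ae_foralln H; apply: filterS => t Ht.
apply: (Ht (Num.bound `|t|%R)); rewrite -ltr_norml.
by rewrite (lt_trans (archi_boundP (normr_ge0 t)))// ltr_nat.
Unshelve. all: by end_near. Qed.
End LipschitzDerivable.

(** * Real induction and increments of absolutely continuous functions *)

Section RealInduction.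
Variable R : realType.

(** A supremum argument. The step leads from some [a] left of [t] to any [b] right of it, so that a
    property of the single point [t], such as differentiability or membership in an open set,
    suffices to cross it. *)
Lemma real_induction (P : R -> Prop) (s u : R) : s <= u -> P s ->
  (forall t, s <= t <= u -> exists2 eta : R, 0 < eta & forall a b,
     s <= a -> a <= t -> t <= b -> b <= u -> t - eta < a -> b < t + eta -> P a -> P b) ->
  P u.
Proof.
move=> su Ps H; pose E := [set t | s <= t <= u /\ P t].
have hsE : has_sup E.
  by split; [exists s; split=> //; rewrite lexx|exists u => x [/andP[]]].
have sE : s <= sup E by apply: ub_le_sup; [by case: hsE|split=> //; rewrite lexx].
have Eu : sup E <= u by apply: ge_sup; [by case: hsE|move=> x [/andP[]]].
have [|eta eta0 step] := H (sup E); first by rewrite sE.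
have [a [/andP[sa au] Pa] aE] := sup_adherent eta0 hsE.
have aS : a <= sup E by apply: ub_le_sup; [by case: hsE|split=> //; rewrite sa au].
pose b := Num.min u (sup E + eta / 2).
have bS : sup E <= b by rewrite /b le_min Eu lerDl divr_ge0// ltW.
have Pb : P b.
  apply: (step a b) => //; first by rewrite ge_min lexx.
  by rewrite /b gt_min; apply/orP; right; lra.
have bE : b <= sup E.
  by apply: ub_le_sup; [by case: hsE|split=> //; rewrite (le_trans sE bS)/= ge_min lexx].
have [h|h] := leP u (sup E + eta / 2); first by rewrite /b min_l in Pb.
by move: bE; rewrite /b min_r ?(ltW h)// => h'; exfalso; lra.
Qed.

Lemma derivable_approx (V : normedModType R) (f : R -> V) (t e : R) : derivable f t 1 -> 0 < e ->
  exists2 eta : R, 0 < eta & forall h, `|h| < eta -> `|f (t + h) - f t - h *: 'D_1 f t| <= e * `|h|.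
Proof.
move=> df e0; have := df; rewrite /derivable => /cvg_ex[l lP].
have lE : 'D_1 f t = l by apply/cvg_lim.
move/cvgrPdist_le: lP => /(_ e e0); move=> -[eta /= eta0 H].
exists eta => // h hh; have [->|h0] := eqVneq h 0.
  by rewrite addr0 scale0r subrr subr0 !normr0 mulr0.
have := H h; rewrite /= /ball_/= sub0r normrN => /(_ hh h0).
rewrite scaler1 addrC lE [h + t]addrC => {}H.
rewrite -normrN opprB.
have -> : h *: l - (f (t + h) - f t) = h *: (l - h^-1 *: (f (t + h) - f t)).
  by rewrite scalerBr scalerA mulfV// scale1r.
by rewrite normrZ mulrC ler_wpM2r// addrC.
Qed.

(** Composition with this clamp extends a Lipschitz function on [[0, N]] to the line with the same
    constant. *)
Lemma clamp_lipschitz (N p q : R) : 0 <= N ->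
  `|Num.min (Num.max p 0) N - Num.min (Num.max q 0) N| <= `|p - q|.
Proof.
move=> N0; wlog pq : p q / p <= q.
  by move=> H; have [|/ltW] := leP p q; move=> /H// h; rewrite distrC (distrC p).
rewrite distrC (distrC p) [leRHS]ger0_norm ?subr_ge0//.
have mx (z : R) : (Num.max z 0 = z /\ 0 <= z) \/ (Num.max z 0 = 0 /\ z <= 0).
  by have [h|h] := leP z 0; [right|left]; split=> //; exact: ltW.
have mn (z : R) : (Num.min z N = z /\ z <= N) \/ (Num.min z N = N /\ N <= z).
  by have [h|h] := leP z N; [left|right]; split=> //; exact: ltW.
rewrite ler_norml.
have [] := mx p => -[-> ?]; have [] := mx q => -[-> ?];
  do ?[have [] := mn p => -[-> ?]]; do ?[have [] := mn q => -[-> ?]];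
  do ?[have [] := mn 0 => -[-> ?]]; apply/andP; split; lra.
Qed.

End RealInduction.


Section AbsolutelyContinuous.
Variables (R : realType) (n : nat).
Local Notation V := 'rV[R]_n.
Local Notation mu := (@lebesgue_measure R).

Lemma closed_approx (C : set V) (d : V) : compact C ->
  (forall e : R, 0 < e -> exists2 z, C z & `|d - z| <= e) -> C d.
Proof.
move=> cC H; have clC : closed C by apply: compact_closed => //; exact: norm_hausdorff.
apply: clC => U /nbhs_ballP[e /= e0 eU].
have [|z Cz dw] := H (e / 2); first by rewrite divr_gt0.
exists z; split=> //; apply: eU; rewrite -ball_normE/=; apply: le_lt_trans dw _.
by rewrite ltr_pdivrMr// ltr_pMr// ltr1n.
Qed.

(** A mean value theorem with values in a convex set, without vector integration. The exceptional
    null set is enclosed in an open [U] of small measure. Real induction crosses a point of [U] by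
    recording the interval in a list, whose total increment is small by absolute continuity. It
    crosses any other point by differentiability, and convexity merges the new velocity with the
    previous average. *)
Lemma ac_increment (f : R -> V) (s u e M : R) (S : set V) :
  absolutely_continuous_upto u f -> 0 <= s -> s < u -> 0 < e ->
  convex_set (S : set (convex_lmodType V)) -> (forall w, S w -> `|w| <= M) ->
  {ae mu, forall t, s <= t <= u -> derivable f t 1 /\ S ('D_1 f t)} ->
  exists2 w, S w & `|f u - f s - (u - s) *: w| <= e.
Proof.
move=> fac s0 su e0 cS SM aeS.
(* The tolerance [e] is spent in thirds: linearization at good points, increments over the bad
   intervals, and the replacement of the good length [c] by [u - s]. *)
pose e1 := e / (3 * (u - s + 1)).
have e10 : 0 < e1 by rewrite divr_gt0// mulr_gt0// ltr_pwDr// subr_ge0 ltW.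
have [d d0 dP] := fac (e / 3) ltac:(by rewrite divr_gt0).
have M0 : 0 <= Num.max M 0 by rewrite le_max lexx orbT.
(* The bound [d' < u - s] keeps the good length positive at the end, so that an element of [S] is
   available. *)
have [d' [d'0 d'd d'M d'u]] : exists d' : R, [/\ 0 < d', d' < d, d' * Num.max M 0 <= e / 3 & d' < u - s].
  pose d1 := e / 3 / (Num.max M 0 + 1).
  have d10 : 0 < d1 by rewrite !divr_gt0// ltr_pwDr.
  exists (Num.min (Num.min d d1) (u - s) / 2); split.
  - by rewrite divr_gt0// !lt_min d0 d10 subr_gt0.
  - have : Num.min (Num.min d d1) (u - s) <= d by rewrite !ge_min lexx.
    lra.
  - apply: (@le_trans _ _ (d1 * Num.max M 0)).
      apply: ler_wpM2r => //.
      have : Num.min (Num.min d d1) (u - s) <= d1 by rewrite !ge_min lexx orbT.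
      lra.
    by rewrite -mulrA ger_pMr ?divr_gt0// mulrC ler_pdivrMr ?mul1r ?lerDl// ltr_pwDr.
  - have : Num.min (Num.min d d1) (u - s) <= u - s by rewrite !ge_min lexx orbT.
    lra.
have [U [oU NU muU]] := outer_measure_open_le (~` [set t | s <= t <= u -> derivable f t 1 /\ S ('D_1 f t)]) d'0.
have mU : measurable (U : set (measurableTypeR R)) by exact: measurable_realfun.open_measurable.
rewrite (_ : (_^*)%mu _ = 0%E) ?add0e in muU; last exact/negligible_outer_measure.
pose bad (t : R) (l : seq (R * R)) := [/\ all (fun p => (s <= p.1 <= p.2) && (p.2 <= t)) l,
  pairwise (fun p q => q.2 <= p.1) l &
  ((\sum_(p <- l) (p.2 - p.1))%:E <= mu (U `&` [set` `]s, t]]))%E].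
(* [c] is the length crossed at good points and [G] the displacement accounted for there. Before the
   first good point no element of [S] is at hand, whence the case [c = 0]. *)
pose Inv (t : R) := exists (l : seq (R * R)) (c : R) (G : V),
  [/\ 0 <= c, c + \sum_(p <- l) (p.2 - p.1) = t - s,
    (c = 0 /\ G = 0) \/ (exists2 w, S w & G = c *: w),
    `|f t - f s - G| <= e1 * c + \sum_(p <- l) `|f p.2 - f p.1| & bad t l].
have badS a b l : a <= b -> bad a l -> bad b l.
  move=> ab [l1 l2 l3]; split=> //.
    by apply: sub_all l1 => p /andP[-> h]/=; exact: le_trans h ab.
  apply: (le_trans l3); apply: le_measure; rewrite ?inE; try by apply: measurableI => //; exact: measurable_itv.
  by move=> x [Ux]; rewrite /= !in_itv/= => /andP[sx xa]; split=> //; rewrite sx (le_trans xa).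
have [l [c [G [c0 cE GE Gd [l1 l2 l3]]]]] : Inv u.
  apply: (real_induction (s := s)); first exact: ltW.
    exists [::], 0, 0; split=> //.
    - by rewrite big_nil addr0 subrr.
    - by left.
    - by rewrite big_nil mulr0 addr0 subrr subr0 normr0.
    - by split=> //; rewrite big_nil.
  move=> t tsu.
  have [Ut|Ut] := pselect (U t).
    have /nbhs_ballP[eta /= eta0 Ueta] : nbhs t U by apply: open_nbhs_nbhs.
    exists eta => // a b sa a_t tb bu ta tb' [l [c [G [c0 cE GE Gd [l1 l2 l3]]]]].
    exists ((a, b) :: l), c, G; rewrite !big_cons/=; split=> //.
    - by rewrite addrCA cE; ring.
    - rewrite addrCA; have -> : f b - f s - G = (f b - f a) + (f a - f s - G).
        by rewrite !addrA subrK.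
      by apply: le_trans (ler_normD _ _) _; rewrite lerD2l.
    - split; rewrite /= ?big_cons/=.
      + rewrite sa (le_trans a_t tb) lexx/=.
        by apply: sub_all l1 => p /andP[-> h]/=; exact: le_trans h (le_trans a_t tb).
      + by rewrite l2 andbT; apply: sub_all l1 => p /andP[].
      + apply: (@le_trans _ _ (mu ([set` `]a, b]] `|` (U `&` [set` `]s, a]])))).
          rewrite measureU//=; last 2 first.
            by apply: measurableI => //; exact: measurable_itv.
            apply/seteqP; split=> // x [/=]; rewrite in_itv/= => /andP[ax _] [_]; rewrite in_itv/= => /andP[_ xa].
            by move: (lt_le_trans ax xa); rewrite ltxx.
          rewrite EFinD; apply: leeD => //.
          rewrite lebesgue_measure_itv/= lte_fin; case: ltP => [_|ba]; first by rewrite EFinB.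
          by rewrite lee_fin subr_le0.
        apply: le_measure; rewrite ?inE.
        - by apply: measurableU; [exact: measurable_itv|apply: measurableI => //; exact: measurable_itv].
        - by apply: measurableI => //; exact: measurable_itv.
        move=> x [|[Ux]] /=; rewrite !in_itv/= => /andP[h1 h2]; split=> //=.
        * apply: Ueta; rewrite /ball/= ltr_distlC; apply/andP; split.
            exact: lt_trans ta h1.
          exact: le_lt_trans h2 tb'.
        * by rewrite (le_lt_trans sa h1).
        * by rewrite h1 (le_trans h2)// (le_trans a_t).
  have [df SD] : derivable f t 1 /\ S ('D_1 f t).
    have : ~ (~` [set t | s <= t <= u -> derivable f t 1 /\ S ('D_1 f t)]) t by move=> /NU.
    by move=> /contrapT; apply.
  have [eta eta0 Heta] := derivable_approx df e10.
  exists eta => // a b sa a_t tb bu ta tb' [l [c [G [c0 cE GE Gd Bd]]]].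
  have ab : a <= b by exact: le_trans a_t tb.
  exists l, (c + (b - a)), (G + (b - a) *: 'D_1 f t); split.
  - by rewrite addr_ge0// subr_ge0.
  - by rewrite addrAC cE; ring.
  - case: GE => [[cz Gz]|[w Sw GE]]; first by right; exists ('D_1 f t); rewrite // cz Gz !add0r.
    have [cb0|cb0] := eqVneq (c + (b - a)) 0.
      left; split=> //; have ba0 : b - a = 0 by apply/eqP; rewrite eq_le subr_ge0 ab andbT; lra.
      by rewrite GE ba0 scale0r addr0 (_ : c = 0) ?scale0r//; lra.
    right; have cb : 0 < c + (b - a) by rewrite lt_neqAle eq_sym cb0 addr_ge0// subr_ge0.
    exists ((c / (c + (b - a))) *: w + (1 - c / (c + (b - a))) *: 'D_1 f t).
      apply: convex_set_comb => //; first by rewrite divr_ge0// ltW.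
      by rewrite ler_pdivrMr// mul1r lerDl subr_ge0.
    rewrite scalerDr !scalerA GE; congr (_ *: _ + _ *: _); field; exact: lt0r_neq0.
  - have -> : f b - f s - (G + (b - a) *: 'D_1 f t) = (f a - f s - G) +
       ((f (t + (b - t)) - f t - (b - t) *: 'D_1 f t) - (f (t + (a - t)) - f t - (a - t) *: 'D_1 f t)).
      rewrite !(addrCA t) !subrr !addr0.
      have -> : (b - a) *: 'D_1 f t = (b - t) *: 'D_1 f t - (a - t) *: 'D_1 f t.
        by rewrite -scalerBl; congr (_ *: _); ring.
      move: (f b) (f s) (f a) (f t) ((b - t) *: 'D_1 f t) ((a - t) *: 'D_1 f t) => x1 x2 x3 x4 x5 x6.
      by apply/rowP => j; rewrite !mxE; ring.
    apply: le_trans (ler_normD _ _) _.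
    have h1 := Heta (b - t); have h2 := Heta (a - t).
    have hb : `|b - t| = b - t by rewrite ger0_norm// subr_ge0.
    have ha : `|a - t| = t - a by rewrite ler0_norm ?opprB// subr_le0.
    rewrite hb ha in h1 h2.
    have {}h1 := h1 ltac:(lra); have {}h2 := h2 ltac:(lra).
    apply: (le_trans (lerD Gd (ler_normB _ _))).
    lra.
  - exact: badS Bd.
have sumd : \sum_(p <- l) (p.2 - p.1) <= d'.
  rewrite -lee_fin; apply: (le_trans l3); apply: le_trans muU; apply: le_measure; rewrite ?inE//.
  by apply: measurableI => //; exact: measurable_itv.
have sumf : \sum_(p <- l) `|f p.2 - f p.1| < e / 3.
  have := dP (size l) (fun i => (nth (0, 0) l i).1) (fun i => (nth (0, 0) l i).2).
  rewrite (big_nth (0, 0)) big_mkord; apply.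
  - move=> i; have /allP/(_ _ (mem_nth (0, 0) (ltn_ord i)))/andP[/andP[h1 h2] h3] := l1.
    by split=> //; exact: le_trans h1.
  - have H (i j : 'I_(size l)) : (i < j)%N -> (nth (0, 0) l j).2 <= (nth (0, 0) l i).1.
      by move=> ij; have /(pairwiseP (0, 0)) := l2; apply; rewrite ?inE.
    move=> i j; rewrite -val_eqE/= neq_ltn => /orP[|] /H; by [left|right].
  - have := sumd; rewrite (big_nth (0, 0)) big_mkord => h; exact: le_lt_trans h d'd.
have cpos : 0 < c by move: cE sumd d'u; lra.
case: GE => [[cz]|[w Sw GE]]; first by rewrite cz ltxx in cpos.
exists w => //; have -> : f u - f s - (u - s) *: w = (f u - f s - G) - (u - s - c) *: w.
  by rewrite GE [in RHS]scalerBl opprB addrA subrK.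
apply: le_trans (ler_normB _ _) _; rewrite normrZ.
have sum0 : 0 <= \sum_(p <- l) (p.2 - p.1).
  rewrite big_seq; apply: sumr_ge0 => p /(allP l1)/andP[/andP[_ h] _].
  by rewrite subr_ge0.
have h1 : `|u - s - c| <= d' by rewrite -cE addrC addKr ger0_norm.
have h2 : `|w| <= Num.max M 0 by rewrite le_max SM.
have h3 : `|u - s - c| * `|w| <= d' * Num.max M 0 by apply: ler_pM.
have h4 : e1 * c <= e / 3.
  have -> : e1 * c = e / 3 * (c / (u - s + 1)).
    by rewrite /e1; field; lra.
  apply: ler_piMr; first by rewrite divr_ge0// ltW.
  by rewrite ler_pdivrMr ?mul1r; lra.
lra.
Qed.
End AbsolutelyContinuous.

(** * Bilinear forms on row vectors *)

Section FiniteDimension.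
Variables (R : realType) (n : nat).
Local Notation V := 'rV[R]_n.

Lemma rV_lin_continuous (E : normedModType R) (f : V -> E) :
  linear f -> continuous f.
Proof.
move=> lf x.
pose fl : {linear V -> E} := HB.pack f (GRing.isLinear.Build _ _ _ _ f lf).
have -> : f = (fun x : V => \sum_i x 0 i *: f (delta_mx 0 i)).
  apply/funext => y; rewrite {1}(row_sum_delta y) -[f]/(fl : V -> E) linear_sum.
  by apply: eq_bigr => i _; rewrite linearZ.
by apply: (@cvg_sumr V (nbhs x) (nbhs_filter x)) => i; apply: cvgZ; [exact: coord_continuous|exact: cvg_cst].
Qed.

Lemma rV_coord_le_norm (x : V) k : `|x 0 k| <= `|x|.
Proof.
rewrite -[X in _ <= X]/(mx_norm x) mx_normrE.
exact: (le_bigmax _ (fun i : 'I_1 * 'I_n => `|x i.1 i.2|) (0, k)).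
Qed.

Lemma vspace_closed (a : {vspace V}) : closed [set x : V | x \in a].
Proof.
have -> : [set x : V | x \in a] = (fun x => x - projv a x) @^-1` [set 0].
  apply/seteqP; split=> x /=; first by move=> xa; rewrite projv_id ?subrr.
  by move=> /eqP; rewrite subr_eq0 => /eqP ->; exact: memv_proj.
apply: closed_comp => [x _|]; last first.
  by apply: accessible_closed_set1; apply: hausdorff_accessible; exact: norm_hausdorff.
by apply: rV_lin_continuous => c x1 y1; rewrite linearP scalerBr opprD addrACA.
Qed.

Lemma vspace_sphere_compact (a : {vspace V}) : compact [set x : V | x \in a /\ `|x| = 1].
Proof.
apply: bounded_closed_compact.
  exists 1; split; first exact: real1.
  by move=> M M1 x [_ x1] /=; rewrite x1 ltW.
rewrite (_ : [set x | _] = [set x | x \in a] `&` (fun x : V => `|x|) @^-1` [set x | x = 1]); last by [].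
apply: closedI; first exact: vspace_closed.
by apply: closed_comp => [x _|]; [exact: norm_continuous|exact: closed_eq].
Qed.

Section Form.
Variables (B : V -> V -> R).
Hypothesis BDl : forall x y z, B (x + y) z = B x z + B y z.
Hypothesis BZl : forall c x z, B (c *: x) z = c * B x z.
Hypothesis BC : forall x y, B x y = B y x.

Lemma form_lin z : linear (B^~ z : V -> R^o).
Proof. by move=> c x y; rewrite BDl BZl. Qed.

Lemma form_suml (I : finType) (l : I -> R) (u : I -> V) z :
  B (\sum_i l i *: u i) z = \sum_i l i * B (u i) z.
Proof.
pose fl : {linear V -> R^o} := HB.pack (B^~ z) (GRing.isLinear.Build _ _ _ _ (B^~ z) (form_lin z)).
rewrite -[B _ z]/(fl _) linear_sum; apply: eq_bigr => i _.
by rewrite linearZ.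
Qed.

Lemma form_sumr (I : finType) (l : I -> R) (u : I -> V) z :
  B z (\sum_i l i *: u i) = \sum_i l i * B z (u i).
Proof. by rewrite BC form_suml; apply: eq_bigr => i _; rewrite BC. Qed.

Lemma formDr x y z : B z (x + y) = B z x + B z y.
Proof. by rewrite ![B z _]BC BDl. Qed.

Lemma formZr c x z : B z (c *: x) = c * B z x.
Proof. by rewrite ![B z _]BC BZl. Qed.

Lemma form0l z : B 0 z = 0.
Proof. by rewrite -(scale0r (0 : V)) BZl mul0r. Qed.

Lemma formNl x z : B (- x) z = - B x z.
Proof. by rewrite -scaleN1r BZl mulN1r. Qed.

Lemma formNr x z : B z (- x) = - B z x.
Proof. by rewrite BC formNl BC. Qed.

Lemma formBl x y z : B (x - y) z = B x z - B y z.
Proof. by rewrite BDl formNl. Qed.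

Lemma formBr x y z : B z (x - y) = B z x - B z y.
Proof. by rewrite formDr formNr. Qed.

Lemma form_continuous : continuous (fun x : V => B x x).
Proof.
move=> x.
have -> : (fun x => B x x) = (fun x : V => \sum_i x 0 i * B (delta_mx 0 i) x).
  by apply/funext => y; rewrite {1}(row_sum_delta y) form_suml.
apply: (@cvg_sumr V (nbhs x) (nbhs_filter x)) => i; apply: cvgM; first exact: coord_continuous.
apply: (rV_lin_continuous (E := R^o)) => c y z.
by rewrite formDr formZr.
Qed.

Lemma form_shift_continuous p : continuous (fun x : V => B (x - p) (x - p)).
Proof.
move=> x.
have -> : (fun x : V => B (x - p) (x - p)) = (fun x : V => B x x - 2 * B x p + B p p).
  by apply/funext => y; rewrite formBl !formBr (BC p y); ring.
apply: (cvgD (F := nbhs x)); last exact: cvg_cst.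
apply: (cvgB (F := nbhs x)); first exact: form_continuous.
by apply: (cvgMr (F := nbhs x)); apply: (rV_lin_continuous (E := R^o)) => c y z; rewrite BDl BZl.
Qed.

(** The constant is the minimum of the form on the unit sphere of [a], which is compact; the form is
    assumed positive on [a] only. *)
Lemma form_coercive (a : {vspace V}) :
  (forall x, x \in a -> x != 0 -> 0 < B x x) ->
  exists2 c : R, 0 < c & forall x, x \in a -> c * `|x| ^+ 2 <= B x x.
Proof.
move=> Bpos; pose S := [set x : V | x \in a /\ `|x| = 1].
have cS : compact S by exact: vspace_sphere_compact.
have [[x0 Sx0]|S0] := pselect (S !=set0); last first.
  exists 1 => // x xa; have [->|x0] := eqVneq x 0.
    by rewrite normr0 expr0n mulr0 form0l.
  exfalso; apply: S0; exists (`|x|^-1 *: x); split; first exact: memvZ.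
  by rewrite normrZ normfV normr_id mulVf// normr_eq0.
have [||x1 /= Sx1 xmin] := @compact_EVT_min V R (fun x => B x x) S _ cS.
- by exists x0.
- by apply: continuous_subspaceT; exact: form_continuous.
have {}Sx1 : S x1 by move: Sx1; rewrite inE.
exists (B x1 x1); first by apply: Bpos; [by case: Sx1|case: Sx1 => _ h; rewrite -normr_eq0 h oner_eq0].
move=> x xa; have [->|xn0] := eqVneq x 0.
  by rewrite normr0 expr0n mulr0 form0l.
have nx0 : 0 < `|x| by rewrite normr_gt0.
have /xmin : `|x|^-1 *: x \in S.
  rewrite inE; split; first exact: memvZ.
  by rewrite normrZ normfV normr_id mulVf// gt_eqF.
rewrite BZl formZr mulrA -expr2 exprVn mulrC ler_pdivlMr ?exprn_gt0//.
Qed.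

Lemma form_bounded : exists2 C : R, 0 < C & forall x, B x x <= C * `|x| ^+ 2.
Proof.
pose C := \sum_i \sum_j `|B (delta_mx 0 i) (delta_mx 0 j)|.
exists (C + 1); first by rewrite ltr_pwDr// !sumr_ge0// => i _; rewrite sumr_ge0.
move=> x; apply: (@le_trans _ _ (C * `|x| ^+ 2)); last first.
  by rewrite ler_wpM2r ?exprn_ge0// lerDl.
rewrite {1 2}(row_sum_delta x) form_suml /C mulr_suml; apply: ler_sum => i _.
rewrite form_sumr mulr_sumr mulr_suml; apply: ler_sum => j _.
have xi k := rV_coord_le_norm x k.
apply: le_trans (ler_norm _) _; rewrite !normrM mulrA mulrC ler_wpM2l// expr2.
by apply: ler_pM.
Qed.

End Form.
End FiniteDimension.

(** * Perturbation and bounds for convex hulls of families *)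

Section HullTransfer.
Variables (R : realType) (n : nat) (I : Type).
Local Notation V := 'rV[R]_n.

Lemma hull_family_near (K : set I) (p q : I -> V) (e : R) (v : V) :
  (forall k, K k -> `|p k - q k| <= e) -> convex_hull [set p k | k in K] v ->
  exists2 v', convex_hull [set q k | k in K] v' & `|v - v'| <= e.
Proof.
move=> pq /convex_hullP[J [l [u [l0 l1 Au ->]]]].
have /choice[k kP] : forall j, exists k, K k /\ p k = u j by move=> j; have [k ? ?] := Au j; exists k.
exists (\sum_j l j *: q (k j)).
  apply/convex_hullP; exists J, l, (fun j => q (k j)); split=> // j.
  by exists (k j) => //; case: (kP j).
rewrite -sumrB; apply: le_trans (ler_norm_sum _ _ _) _.
rewrite -[leRHS]mul1r -l1 mulr_suml; apply: ler_sum => j _.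
have [Kk <-] := kP j.
by rewrite -scalerBr normrZ ger0_norm// ler_wpM2l// pq.
Qed.

Lemma convex_hull_norm (A : set V) (M : R) (v : V) :
  (forall x, A x -> `|x| <= M) -> convex_hull A v -> `|v| <= M.
Proof.
move=> AM /convex_hullP[J [l [u [l0 l1 Au ->]]]].
apply: le_trans (ler_norm_sum _ _ _) _.
rewrite -[leRHS]mul1r -l1 mulr_suml; apply: ler_sum => j _.
by rewrite normrZ ger0_norm// ler_wpM2l// AM.
Qed.

Lemma convex_hull_vspace (A : set V) (a : {vspace V}) (v : V) :
  (forall x, A x -> x \in a) -> convex_hull A v -> v \in a.
Proof.
move=> AM /convex_hullP[J [l [u [l0 l1 Au ->]]]].
by apply: memv_suml => j _; apply: memvZ; exact: AM.
Qed.

End HullTransfer.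

(** * The reduced control system over an abstract Weyl group action *)

Section ReducedControlSystem.
Variables (R : realType) (n : nat) (G : Type) (a : {vspace 'rV[R]_n}).
Local Notation V := 'rV[R]_n.
(** [f k] stands for the field induced by [k], [w g] for the adjoint action of [g], [N] for the
    normalizer of [a] in [K], [D] for a closed chamber and [B] for an invariant form. Beyond the
    group laws and the invariance of [B], what is asked of the Weyl group is that its orbits are
    compact and meet [D], and the inequality [D_max]. *)
Variables (K N : set G) (f w : G -> V -> V) (B : V -> V -> R) (D : set V).
Local Notation orbit b := [set w g b | g in N].
Local Notation derv x := [set f k x | k in K].
Local Notation F x := (convex_hull (derv x)).

Hypothesis K_ex : exists k, K k.
Hypothesis fa : forall k b, K k -> b \in a -> f k b \in a.
Variable L : R.
Hypothesis L0 : 0 <= L.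
Hypothesis fL : forall k b b', K k -> b \in a -> b' \in a -> `|f k b - f k b'| <= L * `|b - b'|.
Hypothesis derv_compact : forall b, b \in a -> compact (derv b).
Hypothesis f_affine : forall k (I : finType) (l : I -> R) (u : I -> V), K k ->
  (forall i, u i \in a) -> \sum_i l i = 1 -> f k (\sum_i l i *: u i) = \sum_i l i *: f k (u i).
Hypothesis w_linear : forall g, linear (w g).
Hypothesis wa : forall g b, N g -> b \in a -> w g b \in a.
Hypothesis w1 : exists2 g, N g & forall b, b \in a -> w g b = b.
Hypothesis wM : forall g h, N g -> N h -> exists2 m, N m & forall b, b \in a -> w m b = w g (w h b).
Hypothesis wV : forall g, N g -> exists2 m, N m & forall b, b \in a -> w m (w g b) = b.
Hypothesis orbit_compact : forall b, b \in a -> compact (orbit b).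
Hypothesis fw : forall g k, N g -> K k ->
  exists2 k', K k' & forall b, b \in a -> f k (w g b) = w g (f k' b).
Hypothesis BDl : forall x y z, B (x + y) z = B x z + B y z.
Hypothesis BZl : forall c x z, B (c *: x) z = c * B x z.
Hypothesis BC : forall x y, B x y = B y x.
Hypothesis B_pos : forall x, x \in a -> x != 0 -> 0 < B x x.
Hypothesis Bw : forall g x y, N g -> x \in a -> y \in a -> B (w g x) (w g y) = B x y.
Hypothesis D_ex : forall b, b \in a -> exists2 g, N g & D (w g b).
Hypothesis D_max : forall z b g, z \in a -> b \in a -> D z -> D b -> N g -> B z (w g b) <= B z b.

Lemma w_sum g (I : finType) (l : I -> R) (u : I -> V) :
  w g (\sum_i l i *: u i) = \sum_i l i *: w g (u i).
Proof.
pose wl : {linear V -> V} := HB.pack (w g) (GRing.isLinear.Build _ _ _ _ (w g) (@w_linear g)).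
rewrite -[w g _]/(wl _) linear_sum; apply: eq_bigr => i _.
by rewrite linearZ.
Qed.

Lemma wD g x y : w g (x + y) = w g x + w g y.
Proof. by rewrite -[x]scale1r w_linear !scale1r. Qed.

Lemma wZ g c x : w g (c *: x) = c *: w g x.
Proof.
have w0 : w g 0 = 0 by have := wD g 0 0; rewrite addr0 => /(congr1 (fun z => z - w g 0)); rewrite subrr addrK.
by rewrite -[c *: x]addr0 w_linear w0 addr0.
Qed.

Lemma wB g x y : w g (x - y) = w g x - w g y.
Proof. by rewrite wD -scaleN1r wZ scaleN1r. Qed.

Lemma wVr g : N g -> exists2 m, N m & forall b, b \in a -> w m (w g b) = b /\ w g (w m b) = b.
Proof.
move=> Ng; have [m Nm mg] := wV Ng; have [m' Nm' m'm] := wV Nm.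
exists m => // b ba; split; first exact: mg.
have : w m' (w m (w g (w m b))) = w m' (w m b) by rewrite (mg (w m b))// wa.
by rewrite !m'm ?wa.
Qed.

(** The norm is the sup norm, which the Weyl group need not preserve, while it preserves [B]; [kp]
    converts comparisons in [B] into comparisons in norm. The summand 1 arranges [1 <= kp]. *)
Lemma exists_kappa : exists2 kp : R, 1 <= kp &
  forall x y, x \in a -> y \in a -> B x x <= B y y -> `|x| <= kp * `|y|.
Proof.
have [c c0 cB] := form_coercive BDl BZl BC B_pos.
have [C C0 CB] := form_bounded BDl BZl BC.
exists (Num.sqrt (C / c) + 1); first by rewrite lerDr sqrtr_ge0.
move=> x y xa ya xy; apply: (@le_trans _ _ (Num.sqrt (C / c) * `|y|)); last first.
  by rewrite ler_wpM2r// lerDl.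
have h : `|x| ^+ 2 <= C / c * `|y| ^+ 2.
  rewrite mulrAC ler_pdivlMr// mulrC.
  exact: le_trans (cB x xa) (le_trans xy (CB y)).
rewrite -(ler_pXn2r (n := 2))// ?nnegrE ?mulr_ge0 ?sqrtr_ge0//.
by rewrite exprMn sqr_sqrtr// divr_ge0// ltW.
Qed.

(** Nearest point projection for [B] in place of Hahn-Banach: the separating functional is then
    given by a vector of [a], which can be moved into the chamber. *)
Lemma separation (C : set V) p : compact C -> C !=set0 ->
  convex_set (C : set (convex_lmodType V)) ->
  (forall x, C x -> x \in a) -> p \in a -> ~ C p ->
  exists2 z, z \in a & forall x, C x -> B z x < B z p.
Proof.
move=> cC C0 vC Ca pa nCp.
have [||q /set_mem Cq qmin] := @compact_EVT_min V R (fun x => B (x - p) (x - p)) C _ cC.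
- exact: C0.
- by apply: continuous_subspaceT; exact: form_shift_continuous.
have qpa : q - p \in a by rewrite memvB// Ca.
have qp0 : q - p != 0 by rewrite subr_eq0; apply: contra_notN nCp => /eqP <-.
have Bqp := B_pos qpa qp0.
exists (p - q); first by rewrite memvB// Ca.
move=> x Cx.
have dB z : B (p - q) z = - B (q - p) z by rewrite -opprB formNl.
suff h : 0 <= B (q - p) (x - q).
  rewrite !dB ltrN2; move: h Bqp; rewrite !formBr// => h1 h2; lra.
rewrite leNgt; apply/negP => h.
pose s := B (x - q) (x - q); pose d := - B (q - p) (x - q).
have d0 : 0 < d by rewrite oppr_gt0.
have s0 : 0 <= s.
  rewrite /s; have [->|n0] := eqVneq (x - q) 0; first by rewrite form0l.
  by apply/ltW/B_pos => //; rewrite memvB// Ca.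
(* A step of this size from [q] towards [x] keeps the quadratic term below the linear one, so a
   negative pairing would contradict the minimality of [q]. *)
pose t := Num.min 1 (d / (s + 1)).
have t0 : 0 < t by rewrite /t lt_min ltr01 divr_gt0// ltr_pwDr.
have t1 : t <= 1 by rewrite ge_min lexx.
have td : t * s <= d.
  apply: (@le_trans _ _ (d / (s + 1) * s)).
    by rewrite ler_wpM2r// ge_min lexx orbT.
  by rewrite mulrAC ler_pdivrMr ?ltr_pwDr// ler_wpM2l ?lerDl// ltW.
have := qmin (t *: x + (1 - t) *: q); rewrite inE => /(_ (convex_set_comb vC (ltW t0) t1 Cx Cq)).
have -> : t *: x + (1 - t) *: q - p = (q - p) + t *: (x - q).
  by rewrite scalerBl scale1r scalerBr; move: (t *: x) (t *: q) => X Y; apply/rowP => j; rewrite !mxE; ring.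
have expand P X : B (P + t *: X) (P + t *: X) = B P P + 2 * t * B P X + t * (t * B X X).
  by rewrite BDl !(formDr BDl BC) BZl !(formZr BZl BC) BZl (BC X P); ring.
rewrite expand -/s.
have -> : B (q - p) (x - q) = - d by rewrite opprK.
move=> hh.
have : t * (t * s) <= t * d by rewrite ler_wpM2l// ltW.
have : 0 < t * d by rewrite mulr_gt0.
lra.
Qed.

Lemma orbit_in b x : b \in a -> orbit b x -> x \in a.
Proof. by move=> ba [g Ng <-]; exact: wa. Qed.

(** Membership in a compact convex hull is tested on support functions. A Weyl element moves the
    separating vector into [D]; the orbit of [y] is unaffected but [x] moves along, which is why [g]
    appears. *)
Lemma maj_criterion x y : x \in a -> y \in a ->
  (forall z g, z \in a -> D z -> N g -> exists2 g', N g' & B z (w g x) <= B z (w g' y)) ->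
  convex_hull (orbit y) x.
Proof.
move=> xa ya H; apply: contrapT => nx.
have [|||z0 z0a z0P] := @separation (convex_hull (orbit y)) x _ _ (@convex_hull_convex _ _ _) _ xa nx.
- by apply: convex_hull_compact; exact: orbit_compact.
- by have [g Ng _] := w1; exists (w g y); apply: sub_convex_hull; exists g.
- by move=> u; apply: convex_hull_vspace => v; exact: orbit_in.
have [g Ng Dz] := D_ex z0a.
have [g' Ng' gg'] := H (w g z0) g (wa Ng z0a) Dz Ng.
have [m Nm mP] := wVr Ng; have [m' Nm' m'P] := wM Nm Ng'.
have : B z0 (w m' y) < B z0 x by apply: z0P; apply: sub_convex_hull; exists m'.
rewrite -(Bw Ng) ?wa// m'P// (mP _ (wa Ng' ya)).2 -[ltRHS](Bw Ng)// ltNge.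
by rewrite gg'.
Qed.

Lemma F_in x v : x \in a -> F x v -> v \in a.
Proof. by move=> xa; apply: convex_hull_vspace => _ [k Kk <-]; exact: fa. Qed.

Lemma F_lipschitz x y v : x \in a -> y \in a -> F x v ->
  exists2 v', F y v' & `|v - v'| <= L * `|x - y|.
Proof.
by move=> xa ya; apply: hull_family_near => k Kk; exact: fL.
Qed.

Lemma F_equivariant g b v : N g -> b \in a -> F (w g b) v -> exists2 v', F b v' & v = w g v'.
Proof.
move=> Ng ba /convex_hullP[J [l [u [l0 l1 Au ->]]]].
have /choice[k kP] : forall j, exists k', K k' /\ u j = w g (f k' b).
  move=> j; have [k Kk <-] := Au j; have [k' Kk' k'P] := fw Ng Kk.
  by exists k'; rewrite k'P.
exists (\sum_j l j *: f (k j) b).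
  apply/convex_hullP; exists J, l, (fun j => f (k j) b); split=> // j.
  by exists (k j) => //; case: (kP j).
by rewrite w_sum; apply: eq_bigr => j _; have [_ ->] := kP j.
Qed.

Lemma F_equivariantV g b v : N g -> b \in a -> F b v -> F (w g b) (w g v).
Proof.
move=> Ng ba Fv; have [m Nm mP] := wVr Ng.
have : F (w m (w g b)) v by rewrite (mP b ba).1.
move=> /(F_equivariant Nm (wa Ng ba))[v' Fv' ->].
by rewrite (mP v' (F_in (wa Ng ba) Fv')).2.
Qed.

Lemma F_bounded : exists2 A : R, 0 <= A & forall b v, b \in a -> F b v -> `|v| <= A + L * `|b|.
Proof.
have /compact_bounded[A [Areal HA]] := derv_compact (mem0v a).
pose A' := Num.max 0 (A + 1).
have A'P v : derv 0 v -> `|v| <= A'.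
  by move=> dv; rewrite le_max; apply/orP; right; apply: HA => //; rewrite ltrDl.
exists A'; first by rewrite le_max lexx.
move=> b v ba; apply: convex_hull_norm => _ [k Kk <-].
rewrite -[f k b](subrK (f k 0)) addrC; apply: le_trans (ler_normD _ _) _.
apply: lerD; first by apply: A'P; exists k.
by apply: le_trans (fL Kk ba (mem0v a)) _; rewrite subr0.
Qed.

(** Affinity enters here: at [x = sum l_i w_(g i) b] the field of [k] is the same combination of its
    values at the translates, and equivariance turns each of them into a translate of a value at
    [b]. Since [x] and [v] share the weights and the elements [g i], the point [x + h v] is the
    combination of the points [w_(g i) (b + h u_i)]. *)
Lemma maj_derv x b v : x \in a -> b \in a -> convex_hull (orbit b) x -> F x v ->
  exists (I : finType) (l : I -> R) (g : I -> G) (u : I -> V),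
  [/\ forall i, 0 <= l i, \sum_i l i = 1, forall i, N (g i) /\ F b (u i),
      x = \sum_i l i *: w (g i) b & v = \sum_i l i *: w (g i) (u i)].
Proof.
move=> xa ba /convex_hullP[I [l [y [l0 l1 Ay xE]]]] /convex_hullP[J [m [z [m0 m1 Az ->]]]].
have /choice[g gP] : forall i, exists g, N g /\ w g b = y i.
  by move=> i; have [g ? ?] := Ay i; exists g.
have /choice[k kP] : forall j, exists k, K k /\ f k x = z j.
  by move=> j; have [k ? ?] := Az j; exists k.
have /choice[k' k'P] : forall p : I * J, exists k',
    K k' /\ forall b, b \in a -> f (k p.2) (w (g p.1) b) = w (g p.1) (f k' b).
  move=> [i j]; have [Ng _] := gP i; have [Kk _] := kP j.
  by have [k' ? ?] := fw Ng Kk; exists k'.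
exists I, l, g, (fun i => \sum_j m j *: f (k' (i, j)) b); split=> //.
- move=> i; split; first by case: (gP i).
  apply/convex_hullP; exists J, m, (fun j => f (k' (i, j)) b); split=> // j.
  by exists (k' (i, j)) => //; case: (k'P (i, j)).
- by rewrite xE; apply: eq_bigr => i _; have [_ ->] := gP i.
transitivity (\sum_j \sum_i (l i * m j) *: w (g i) (f (k' (i, j)) b)).
  apply: eq_bigr => j _; have [Kk <-] := kP j.
  rewrite xE f_affine//; last by move=> i; have [Ng <-] := gP i; exact: wa.
  rewrite scaler_sumr; apply: eq_bigr => i _; rewrite scalerA mulrC; congr (_ *: _).
  by have [_ <-] := gP i; have [_ ->] := k'P (i, j).
rewrite exchange_big; apply: eq_bigr => i _; rewrite w_sum scaler_sumr.
by apply: eq_bigr => j _; rewrite scalerA.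
Qed.

Section Step.
Variable kp : R.
Hypothesis kp1 : 1 <= kp.
Hypothesis kpP : forall x y, x \in a -> y \in a -> B x x <= B y y -> `|x| <= kp * `|y|.

Lemma kappa_w g x : N g -> x \in a -> `|w g x| <= kp * `|x|.
Proof. by move=> Ng xa; apply: kpP; rewrite ?wa ?Bw. Qed.

(** By the chamber inequality [b] pairs with [y = w g (b + h v)] at least as much as with [b + h v],
    and these have equal length; so in [B] the point [y] is no further from [b] than [b + h v] is.
    This gives one half of the bound, [w g (h v)] the other. *)
Lemma chamber_move b v h g : b \in a -> v \in a -> D b -> 0 <= h -> N g -> D (w g (b + h *: v)) ->
  `|w g b - b| <= 2 * kp * h * `|v|.
Proof.
move=> ba va Db h0 Ng Dy; pose y := w g (b + h *: v).
have bva : b + h *: v \in a by rewrite memvD// memvZ.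
have ya : y \in a by rewrite wa.
have [m Nm mP] := wVr Ng.
have h1 : `|y - b| <= kp * `|h *: v|.
  apply: kpP; rewrite ?memvB ?memvZ//.
  have e1 : B y y = B (b + h *: v) (b + h *: v) by rewrite Bw.
  have e2 : B (b + h *: v) b <= B y b.
    have := D_max ba ya Db Dy Nm; rewrite (mP _ bva).1 => h1.
    by rewrite ![B _ b]BC.
  have -> : B (h *: v) (h *: v) = B ((b + h *: v) - b) ((b + h *: v) - b) by rewrite addrC addKr.
  rewrite !(formBl BDl BZl) !(formBr BDl BZl BC) e1.
  have e3 := BC b y; have e4 := BC b (b + h *: v); lra.
have -> : w g b - b = (y - b) - w g (h *: v) by rewrite /y wD addrAC addrK.
apply: le_trans (ler_normB _ _) _.
have h2 : `|w g (h *: v)| <= kp * `|h *: v| by rewrite kappa_w// memvZ.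
have -> : 2 * kp * h * `|v| = kp * `|h *: v| + kp * `|h *: v|.
  by rewrite normrZ ger0_norm//; ring.
exact: lerD.
Qed.

(** [u'] averages the velocities after [g' i] has brought [b + h v_i] back to [D]. For [z] in [D]
    the chamber inequality is used twice: a translate of [b + h v_i] pairs with [z] at most as much
    as its representative in [D], and [w_(g' i) b] at most as much as [b]. The distance to [F b] is
    the Lipschitz constant times the displacement of [b] under [g' i]. *)
Lemma step_in_chamber x b v h M : x \in a -> b \in a -> D b -> convex_hull (orbit b) x -> F x v ->
  0 <= h -> (forall v', F b v' -> `|v'| <= M) ->
  exists u u', [/\ F b u, u' \in a, convex_hull (orbit (b + h *: u')) (x + h *: v) &
    `|u' - u| <= 2 * L * kp * h * M].
Proof.
move=> xa ba Db xb Fv h0 MF.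
have [I [l [g [vi [l0 l1 gv xE vE]]]]] := maj_derv xa ba xb Fv.
have via i : vi i \in a by apply: (F_in ba); case: (gv i).
have bva i : b + h *: vi i \in a by rewrite memvD// memvZ.
have /choice[g' g'P] : forall i, exists g', N g' /\ D (w g' (b + h *: vi i)).
  by move=> i; have [g' ? ?] := D_ex (bva i); exists g'.
have /choice[ui uiP] : forall i, exists ui, F b ui /\ `|w (g' i) (vi i) - ui| <= 2 * L * kp * h * M.
  move=> i; have [Ng' Dg'] := g'P i; have [Ng Fi] := gv i.
  have [ui Fu le] := F_lipschitz (wa Ng' ba) ba (F_equivariantV Ng' ba Fi).
  exists ui; split=> //; apply: le_trans le _.
  have -> : 2 * L * kp * h * M = L * (2 * kp * h * M) by ring.
  rewrite ler_wpM2l//; apply: le_trans (chamber_move ba (via i) Db h0 Ng' Dg') _.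
  rewrite ler_wpM2l ?MF// !mulr_ge0// (le_trans _ kp1)//.
exists (\sum_i l i *: ui i), (\sum_i l i *: w (g' i) (vi i)); split.
- by apply: convex_hull_comb => // i; case: (uiP i).
- by apply: memv_suml => i _; rewrite memvZ// wa//; case: (g'P i).
- have ua : \sum_i l i *: w (g' i) (vi i) \in a.
    by apply: memv_suml => i _; rewrite memvZ// wa//; case: (g'P i).
  have va : v \in a by exact: F_in Fv.
  apply: maj_criterion; rewrite ?memvD ?memvZ// => z q za Dz Nq.
  have [e Ne eP] := w1; exists e => //; rewrite eP; last by rewrite memvD// memvZ.
  have -> : x + h *: v = \sum_i l i *: w (g i) (b + h *: vi i).
    rewrite xE vE scaler_sumr -big_split; apply: eq_bigr => i _ /=.
    by rewrite wD wZ scalerDr !scalerA mulrC.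
  have -> : b + h *: \sum_i l i *: w (g' i) (vi i) = \sum_i l i *: (b + h *: w (g' i) (vi i)).
    under [RHS]eq_bigr do rewrite scalerDr.
    rewrite big_split/= -scaler_suml l1 scale1r; congr (_ + _).
    by rewrite scaler_sumr; apply: eq_bigr => i _; rewrite !scalerA mulrC.
  rewrite w_sum !form_sumr//; apply: ler_sum => i _; rewrite ler_wpM2l//.
  have [Ng' Dg'] := g'P i; have [Ng Fi] := gv i.
  have [m Nm mP] := wVr Ng'; have [m1 Nm1 m1P] := wM Nq Ng; have [m2 Nm2 m2P] := wM Nm1 Nm.
  have := D_max za (wa Ng' (bva i)) Dz Dg' Nm2.
  rewrite m2P ?wa// (mP _ (bva i)).1 m1P// => le1; apply: le_trans le1 _.
  rewrite wD wZ !(formDr BDl BC) lerD2r.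
  exact: D_max.
- rewrite -sumrB; apply: le_trans (ler_norm_sum _ _ _) _.
  apply: (@le_trans _ _ (\sum_i l i * (2 * L * kp * h * M))); last by rewrite -mulr_suml l1 mul1r.
  apply: ler_sum => i _.
  by rewrite -scalerBr normrZ ger0_norm// ler_wpM2l//; case: (uiP i).
Qed.

Lemma orbit_w g b x : N g -> b \in a -> convex_hull (orbit b) x -> convex_hull (orbit (w g b)) x.
Proof.
move=> Ng ba /convex_hullP[I [l [y [l0 l1 Ay ->]]]].
apply/convex_hullP; exists I, l, y; split=> // i.
have [q Nq <-] := Ay i; have [m Nm mP] := wVr Ng; have [m' Nm' m'P] := wM Nq Nm.
by exists m' => //; rewrite m'P ?wa// (mP b ba).1.
Qed.

(** Conjugation of [b] into the chamber and back. Of the three factors [kp] one comes from the step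
    in the chamber, one from bounding the velocities at the conjugate of [b], and one from the
    return. *)
Lemma step x b v h M : x \in a -> b \in a -> convex_hull (orbit b) x -> F x v ->
  0 <= h -> (forall v', F b v' -> `|v'| <= M) ->
  exists u u', [/\ F b u, u' \in a, convex_hull (orbit (b + h *: u')) (x + h *: v) &
    `|u' - u| <= 2 * L * kp ^+ 3 * h * M].
Proof.
move=> xa ba xb Fv h0 MF.
have kp0 : 0 <= kp by rewrite (le_trans _ kp1).
have [g Ng Dg] := D_ex ba; have [m Nm mP] := wVr Ng.
have gba := wa Ng ba.
have MF' v' : F (w g b) v' -> `|v'| <= kp * M.
  move=> /(F_equivariant Ng ba)[v0 Fv0 ->].
  apply: le_trans (kappa_w Ng (F_in ba Fv0)) _.
  by rewrite ler_wpM2l// MF.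
have [u [u' [Fu u'a hu ule]]] := step_in_chamber xa gba Dg (orbit_w Ng ba xb) Fv h0 MF'.
exists (w m u), (w m u'); split.
- by have := F_equivariantV Nm gba Fu; rewrite (mP b ba).1.
- exact: wa.
- have : convex_hull (orbit (w m (w g b + h *: u'))) (x + h *: v).
    by apply: orbit_w => //; rewrite memvD// memvZ.
  by rewrite wD wZ (mP b ba).1.
- rewrite -wB; apply: le_trans (kappa_w Nm _) _; first by rewrite memvB//; exact: (F_in gba).
  have -> : 2 * L * kp ^+ 3 * h * M = kp * (2 * L * kp * h * (kp * M)) by ring.
  by rewrite ler_wpM2l.
Qed.

End Step.
(** A form of the differential inclusion that survives pointwise limits: no derivative, a velocity
    taken at the left endpoint, and a quadratic error. For functions with values in [a] it is
    equivalent to being a relaxed solution. *)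
Definition increments (x : R -> V) := forall T : R, 0 <= T ->
  exists2 E : R, 0 <= E & forall s u : R, 0 <= s -> s < u -> u <= T ->
    exists2 v, F (x s) v & `|x u - x s - (u - s) *: v| <= E * (u - s) ^+ 2.

Lemma F_ex x : exists v, F x v.
Proof. by have [k Kk] := K_ex; exists (f k x); apply: sub_convex_hull; exists k. Qed.

Lemma F_compact x : x \in a -> compact (F x).
Proof. by move=> xa; apply: convex_hull_compact; exact: derv_compact. Qed.

(** Taking [s = 0] first bounds [x] on [[0, T]]; this bounds the velocities, which give the
    Lipschitz constant. *)
Lemma increments_lipschitz (x : R -> V) : (forall t, 0 <= t -> x t \in a) -> increments x ->
  forall T, 0 <= T -> exists2 M : R, 0 <= M &
    forall s u, 0 <= s -> s <= u -> u <= T -> `|x u - x s| <= M * (u - s).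
Proof.
move=> xa xI T T0; have [E E0 EP] := xI T T0; have [A A0 AP] := F_bounded.
have xb s : 0 <= s -> s <= T -> `|x s| <= `|x 0| + (A + L * `|x 0|) * T + E * T ^+ 2.
  move=> s0 sT; have AL : 0 <= A + L * `|x 0| by rewrite addr_ge0// mulr_ge0.
  have [->|sn0] := eqVneq s 0; first by rewrite -addrA lerDl addr_ge0// mulr_ge0// exprn_ge0.
  have {sn0}s0 : 0 < s by rewrite lt_neqAle eq_sym sn0.
  have [v Fv] := EP 0 s (lexx _) s0 sT; rewrite subr0 => le1.
  have -> : x s = x 0 + s *: v + (x s - x 0 - s *: v).
    by move: (s *: v) => z; apply/rowP => j; rewrite !mxE; ring.
  apply: le_trans (ler_normD _ _) _; apply: lerD; last first.
    by apply: le_trans le1 _; rewrite ler_wpM2l// ler_pXn2r// nnegrE// ltW.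
  apply: le_trans (ler_normD _ _) _; rewrite lerD2l normrZ gtr0_norm// mulrC.
  by apply: ler_pM => //; [exact: ltW|exact: AP (xa _ (lexx _)) Fv].
set rho := _ + _ in xb.
have rho0 : 0 <= rho by apply: le_trans (xb 0 (lexx _) T0).
exists (A + L * rho + E * T); first by rewrite !addr_ge0// mulr_ge0.
move=> s u s0 su uT; have [->|sn] := eqVneq s u; first by rewrite !subrr normr0 mulr0.
have {sn}su : s < u by rewrite lt_neqAle sn.
have [v Fv le1] := EP s u s0 su uT.
rewrite -[x u - x s](subrK ((u - s) *: v)); apply: le_trans (ler_normD _ _) _.
have us0 : 0 < u - s by rewrite subr_gt0.
have h1 : `|v| <= A + L * rho.
  by apply: le_trans (AP _ _ (xa _ s0) Fv) _; rewrite lerD2l ler_wpM2l// xb// (le_trans (ltW su)).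
have h2 : `|(u - s) *: v| <= (u - s) * (A + L * rho) by rewrite normrZ gtr0_norm// ler_pM2l.
have h3 : E * (u - s) ^+ 2 <= E * T * (u - s).
  by rewrite expr2 mulrA; apply: ler_wpM2r; [exact: ltW|apply: ler_wpM2l => //; lra].
lra.
Qed.

Lemma solution_bounded (x : R -> V) T : absolutely_continuous_upto T x -> 0 <= T ->
  exists rho, forall t, 0 <= t -> t <= T -> `|x t| <= rho.
Proof.
move=> xac T0; have [d d0 dP] := xac 1 ltr01.
apply: (@real_induction _ (fun u => exists rho, forall t, 0 <= t -> t <= u -> `|x t| <= rho) 0 T T0).
  by exists `|x 0| => t t0 t0'; rewrite (_ : t = 0)//; apply/eqP; rewrite eq_le t0 t0'.
move=> t tT; exists (d / 2); first by rewrite divr_gt0.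
move=> p q p0 pt tq qT tp tq' [rho rhoP]; exists (Num.max rho (rho + 1)) => z z0 zq.
have [zp|pz] := leP z p; first by rewrite le_max rhoP.
rewrite le_max; apply/orP; right.
have := dP 1%N (fun=> p) (fun=> z); rewrite !big_ord1 => h.
have {}h : `|x z - x p| < 1.
  apply: h; last by lra.
    by move=> _; split=> //; [exact: ltW|exact: le_trans zq qT].
  by move=> i j; rewrite !ord1 eqxx.
rewrite -[x z](subrK (x p)); apply: le_trans (ler_normD _ _) _.
by rewrite addrC; apply: lerD; [exact: rhoP|exact: ltW].
Qed.

(** The convex mean value theorem is used twice: with a ball, to make [x] Lipschitz, and then with a
    neighbourhood of [F (x s)] that contains all velocities on [[s, u]], since [F] and [x] are
    Lipschitz. *)
Lemma solution_increments (x : R -> V) : relaxed_solution a (fun x => derv x) x -> increments x.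
Proof.
have aeF := ae_filter_ringOfSetsType (@lebesgue_measure R).
move=> [xa xac xae] T T0; have [A A0 AP] := F_bounded.
have [rho rhoP] := solution_bounded (xac T) T0.
have rho0 : 0 <= rho by apply: le_trans (rhoP 0 (lexx _) T0).
pose M := A + L * rho; have M0 : 0 <= M by rewrite addr_ge0// mulr_ge0.
have FM t v : 0 <= t -> t <= T -> F (x t) v -> `|v| <= M.
  move=> t0 tT Fv; apply: le_trans (AP _ _ (xa _ t0) Fv) _.
  by rewrite lerD2l ler_wpM2l// rhoP.
have xlip s u : 0 <= s -> s < u -> u <= T -> `|x u - x s| <= M * (u - s).
  move=> s0 su uT; apply/ler_addgt0Pr => e e0.
  have cvx : convex_set ([set v : V | `|v| <= M] : set (convex_lmodType V)).
    apply: convex_setI => p q t t0 t1 /= pM qM; apply: le_trans (ler_normD _ _) _.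
    rewrite !normrZ ger0_norm// ger0_norm ?subr_ge0//.
    have -> : M = t * M + (1 - t) * M by ring.
    by apply: lerD; apply: ler_wpM2l; rewrite ?subr_ge0.
  have [z Sw le1] : exists2 z, `|z| <= M & `|x u - x s - (u - s) *: z| <= e.
    apply: (ac_increment (M := M) (S := [set v | `|v| <= M])) => //.
    apply: filterS xae => t xt /andP[st tu]; have t0 : 0 <= t by exact: le_trans st.
    by have [dx /(FM _ _ t0 (le_trans tu uT))] := xt t0.
  rewrite -[x u - x s](subrK ((u - s) *: z)) addrC; apply: le_trans (ler_normD _ _) _.
  apply: lerD => //; rewrite normrZ gtr0_norm ?subr_gt0// mulrC; apply: ler_wpM2r => //.
  by rewrite subr_ge0 ltW.
(* The 1 is the tolerance [(u - s) ^+ 2] granted in the mean value theorem; [L * M] comes from the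
   radius of the neighbourhood. *)
exists (1 + L * M); first by rewrite addr_ge0// mulr_ge0.
move=> s u s0 su uT; have us0 : 0 < u - s by rewrite subr_gt0.
pose S := [set v | exists2 v', F (x s) v' & `|v - v'| <= L * (M * (u - s))].
have cvx : convex_set (S : set (convex_lmodType V)).
  apply: convex_setI => p q t t0 t1 [p' Fp pp'] [q' Fq qq'].
  exists (t *: p' + (1 - t) *: q').
    exact: (convex_set_comb (@convex_hull_convex _ _ _)).
  have -> : t *: p + (1 - t) *: q - (t *: p' + (1 - t) *: q') = t *: (p - p') + (1 - t) *: (q - q').
    by apply/rowP => j; rewrite !mxE; ring.
  apply: le_trans (ler_normD _ _) _.
  rewrite !normrZ ger0_norm// ger0_norm ?subr_ge0//.
  set c := L * _.
  have -> : c = t * c + (1 - t) * c by ring.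
  by apply: lerD; apply: ler_wpM2l; rewrite ?subr_ge0.
have [z [z' Fz zz'] le1] : exists2 z, S z & `|x u - x s - (u - s) *: z| <= (u - s) ^+ 2.
  apply: (ac_increment (M := L * (M * (u - s)) + M)) => //.
  - by rewrite exprn_gt0.
  - move=> z [z' Fz zz']; rewrite -[z](subrK z'); apply: le_trans (ler_normD _ _) _.
    by apply: lerD => //; apply: (FM s) => //; rewrite (le_trans (ltW su)).
  apply: filterS xae => t xt /andP[st tu]; have t0 : 0 <= t by exact: le_trans st.
  have [dx Dx] := xt t0; split=> //.
  have [v' Fv' vv'] := F_lipschitz (xa _ t0) (xa _ s0) Dx.
  exists v' => //; apply: le_trans vv' _; apply: ler_wpM2l => //.
  have [<-|sn] := eqVneq s t; first by rewrite subrr normr0 mulr_ge0// ltW.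
  apply: le_trans (xlip s t s0 _ (le_trans tu uT)) _; first by rewrite lt_neqAle sn.
  by apply: ler_wpM2l => //; rewrite lerD2r.
exists z' => //.
have -> : x u - x s - (u - s) *: z' = (x u - x s - (u - s) *: z) + (u - s) *: (z - z').
  by apply/rowP => j; rewrite !mxE; ring.
apply: le_trans (ler_normD _ _) _; rewrite mulrDl mul1r; apply: lerD => //.
rewrite normrZ gtr0_norm//.
have -> : L * M * (u - s) ^+ 2 = (u - s) * (L * (M * (u - s))) by ring.
by apply: ler_wpM2l => //; exact: ltW.
Qed.

Lemma increments_derivative (y : R -> V) (t : R) : (forall t, 0 <= t -> y t \in a) -> increments y ->
  0 <= t -> derivable y t 1 -> F (y t) ('D_1 y t).
Proof.
move=> ya yI t0 dy; apply: closed_approx => [|e e0]; first by apply: F_compact; exact: ya.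
have [|eta eta0 etaP] := derivable_approx dy (e := e / 2); first by rewrite divr_gt0.
have [|E E0 EP] := yI (t + 1); first by rewrite addr_ge0.
pose h := Num.min (Num.min 1 (eta / 2)) (e / 2 / (E + 1)).
have E1 : 0 < E + 1 by rewrite ltr_pwDr.
have h0 : 0 < h by rewrite !lt_min ltr01 !divr_gt0.
have [|||v Fv vle] := EP t (t + h) => //; first by rewrite ltrDl.
  by rewrite lerD2l !ge_min lexx.
exists v => //.
have := etaP h; rewrite gtr0_norm// => /(_ _)hle.
have {}hle : `|y (t + h) - y t - h *: 'D_1 y t| <= e / 2 * h.
  apply: hle; have : h <= eta / 2 by rewrite !ge_min lexx orbT.
  lra.
have th : t + h - t = h by rewrite addrC addKr.
rewrite th in vle.
have Eh : E * h <= e / 2.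
  apply: (@le_trans _ _ (E * (e / 2 / (E + 1)))).
    by apply: ler_wpM2l => //; rewrite ge_min lexx orbT.
  rewrite mulrCA; apply: ler_piMr; first by rewrite divr_ge0// ltW.
  by rewrite ler_pdivrMr// mul1r lerDl.
suff : h * `|'D_1 y t - v| <= h * e by rewrite ler_pM2l.
rewrite -[X in X * _](gtr0_norm h0) -normrZ.
have -> : h *: ('D_1 y t - v) = (y (t + h) - y t - h *: v) - (y (t + h) - y t - h *: 'D_1 y t).
  by rewrite scalerBr; move: (h *: 'D_1 y t) (h *: v) => p q; apply/rowP => j; rewrite !mxE; ring.
apply: le_trans (ler_normB _ _) _; apply: le_trans (lerD vle hle) _.
have : h * (E * h) <= h * (e / 2) by rewrite ler_pM2l.
rewrite expr2; lra.
Qed.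

Lemma increments_solution (y : R -> V) : (forall t, 0 <= t -> y t \in a) -> increments y ->
  relaxed_solution a (fun x => derv x) y.
Proof.
have aeF := ae_filter_ringOfSetsType (@lebesgue_measure R).
move=> ya yI; split=> //.
  move=> T e e0; have [|M M0 MP] := increments_lipschitz ya yI (T := Num.max T 0).
    by rewrite le_max lexx orbT.
  exists (e / (M + 1)); first by rewrite divr_gt0// ltr_pwDr.
  move=> m u v uv _ sumd.
  apply: (@le_lt_trans _ _ (M * \sum_i (v i - u i))).
    rewrite mulr_sumr; apply: ler_sum => i _; have [h1 h2 h3] := uv i.
    by apply: MP => //; rewrite le_max h3.
  have sum0 : 0 <= \sum_i (v i - u i).
    by apply: sumr_ge0 => i _; rewrite subr_ge0; have [] := uv i.
  apply: (@le_lt_trans _ _ ((M + 1) * \sum_i (v i - u i))).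
    by apply: ler_wpM2r => //; rewrite lerDl.
  by rewrite mulrC -ltr_pdivlMr// ltr_pwDr.
pose c (q : nat) (t : R) := Num.min (Num.max t 0) q.+1%:R.
have dN (q : nat) : {ae @lebesgue_measure R, forall t, derivable (fun t => y (c q t)) t 1}.
  have [|M M0 MP] := increments_lipschitz ya yI (T := q.+1%:R); first by [].
  have c0 t : 0 <= c q t by rewrite le_min le_max lexx orbT/=.
  have cN t : c q t <= q.+1%:R by rewrite ge_min lexx orbT.
  have yL p r : `|y (c q p) - y (c q r)| <= M * `|p - r|.
    apply: (@le_trans _ _ (M * `|c q p - c q r|)); last first.
      by apply: ler_wpM2l => //; exact: clamp_lipschitz.
    wlog pq : p r / c q r <= c q p.
      by move=> H; have [|/ltW] := leP (c q r) (c q p); move=> /H// h; rewrite distrC (distrC (c q p)).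
    by rewrite [X in M * X]ger0_norm ?subr_ge0//; exact: MP.
  have dj (j : 'I_n) : {ae @lebesgue_measure R, forall t, derivable (fun t => y (c q t) 0 j) t 1}.
    apply: (@lipschitz_ae_derivable _ _ M) => p r; apply: le_trans (yL p r).
    by apply: le_trans (rV_coord_le_norm _ j); rewrite !mxE.
  have : {ae @lebesgue_measure R, forall t, forall j, derivable (fun t => y (c q t) 0 j) t 1}.
    exact: filter_forall.
  by apply: filterS => t H; apply/derivable_mxP => i j; rewrite ord1.
(* Nothing is known of [y] at negative times, so a two-sided derivative at 0 cannot be expected. *)
have n0 : {ae @lebesgue_measure R, forall t : R, t != 0}.
  exists [set 0]; split; [exact: measurable_set1|exact: lebesgue_measure_set1|].
  by move=> t /= /negP; rewrite negbK => /eqP.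
have H := @filterI _ _ aeF _ _ (ae_foralln dN) n0; apply: (@filterS _ _ aeF _ _ _ H) => t [dt tn0] t0.
have {tn0}t0' : 0 < t by rewrite lt_neqAle eq_sym tn0.
suff dy : derivable y t 1 by split=> //; exact: increments_derivative.
have := dt (Num.bound t); apply: near_eq_derivable; near=> z; rewrite /c.
have z0 : 0 < z by near: z; exact: lt_nbhsr.
have zN : z < (Num.bound t).+1%:R.
  near: z; apply: lt_nbhsl; apply: lt_trans (archi_boundP t0) _.
  by rewrite ltr_nat.
by rewrite max_l ?min_l// ltW.
Unshelve. all: by end_near. Qed.
(** The constant in [increments] depends on the time horizon, while a polygon is built for all times
    at once. A velocity of least defect is as good as the one provided for any horizon. *)
Lemma best_increment (x : R -> V) s u : x s \in a -> exists2 v, F (x s) v &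
  forall v', F (x s) v' -> `|x u - x s - (u - s) *: v| <= `|x u - x s - (u - s) *: v'|.
Proof.
move=> xa; have [||v /set_mem Fv vmin] :=
  @compact_EVT_min V R (fun v => `|x u - x s - (u - s) *: v|) (F (x s)) _ (F_compact xa).
- by have [v Fv] := F_ex (x s); exists v.
- apply: continuous_subspaceT => v; apply: (cvg_norm (F := nbhs v)).
  apply: (cvgB (F := nbhs v)); first exact: cvg_cst.
  by apply: (cvgZl_tmp (F := nbhs v)); exact: cvg_id.
by exists v => // v' Fv'; apply: vmin; rewrite inE.
Qed.

Section Polygon.
Variables (kp A : R).
Hypothesis kp1 : 1 <= kp.
Hypothesis kpP : forall x y, x \in a -> y \in a -> B x x <= B y y -> `|x| <= kp * `|y|.
Hypothesis A0 : 0 <= A.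
Hypothesis AP : forall b v, b \in a -> F b v -> `|v| <= A + L * `|b|.

Let kp0 : 0 <= kp. Proof. exact: le_trans kp1. Qed.

(** The first coordinate only approximates [x]; in return it can stay exactly majorized by the
    second. What is recorded is the input of the error recursions: [v] is a velocity at [x], and the
    transfer of [v] to the vertex [p.1] costs a Lipschitz error. *)
Definition polygon_step (x : R -> V) (h : R) (i : nat) (p p' : V * V) :=
  [/\ exists2 v, F (x (i%:R * h)) v &
        (forall v', F (x (i%:R * h)) v' ->
           `|x (i.+1%:R * h) - x (i%:R * h) - h *: v| <= `|x (i.+1%:R * h) - x (i%:R * h) - h *: v'|) /\
        `|x (i%:R * h) + h *: v - p'.1| <= (1 + h * L) * `|x (i%:R * h) - p.1| &
      exists u u', [/\ F p.2 u, p'.2 = p.2 + h *: u' & `|u' - u| <= 2 * L * kp ^+ 3 * h * (A + L * `|p.2|)]].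

Lemma polygon_ex (x : R -> V) (b0 : V) (h : R) : (forall t, 0 <= t -> x t \in a) -> 0 <= h ->
  b0 \in a -> convex_hull (orbit b0) (x 0) ->
  exists p : nat -> V * V, [/\ p 0%N = (x 0, b0),
    forall i, [/\ (p i).1 \in a, (p i).2 \in a & convex_hull (orbit (p i).2) (p i).1] &
    forall i, polygon_step x h i (p i) (p i.+1)].
Proof.
move=> xa h0 b0a xb.
pose ok (p : V * V) := [/\ p.1 \in a, p.2 \in a & convex_hull (orbit p.2) p.1].
have H (q : nat * (V * V)) : exists p', ok q.2 -> ok p' /\ polygon_step x h q.1 q.2 p'.
  case: q => i [y b]; have [okq|nok] := pselect (ok (y, b)); last by exists (0, 0).
  have [/= ya ba yb] := okq.
  have xia : x (i%:R * h) \in a by apply: xa; rewrite mulr_ge0.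
  have [v Fv vbest] := best_increment (i.+1%:R * h) xia.
  have hE : i.+1%:R * h - i%:R * h = h by rewrite -mulrBl -natrB ?leqnSn// subSnn mul1r.
  rewrite hE in vbest.
  have [v' Fv' vv'] := F_lipschitz xia ya Fv.
  have [u [u' [Fu u'a ub ule]]] := step kp1 kpP ya ba yb Fv' h0 (fun v => AP ba).
  exists (y + h *: v', b + h *: u') => _; split; first by split; rewrite /= ?memvD ?memvZ// (F_in ya).
  split; last by exists u, u'.
  exists v => //; split=> //=.
  have -> : x (i%:R * h) + h *: v - (y + h *: v') = (x (i%:R * h) - y) + h *: (v - v').
    by apply/rowP => j; rewrite !mxE; ring.
  apply: le_trans (ler_normD _ _) _; rewrite mulrDl mul1r lerD2l normrZ ger0_norm// -mulrA.
  by apply: ler_wpM2l.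
have [nx nxP] := choice H.
pose p := fix p i := if i is j.+1 then nx (j, p j) else (x 0, b0).
have okp i : ok (p i).
  elim: i => [|i IH]; first by split=> //=; exact: xa.
  by have [] := nxP (i, p i) IH.
by exists p; split=> // i; have [] := nxP (i, p i) (okp i).
Qed.

Section Bounds.
Variables (x : R -> V) (h : R) (p : nat -> V * V).
Hypothesis xa : forall t, 0 <= t -> x t \in a.
Hypothesis h0 : 0 < h.
Hypothesis h1 : h <= 1.
Hypothesis p0 : (p 0%N).1 = x 0.
Hypothesis pok : forall i, [/\ (p i).1 \in a, (p i).2 \in a & convex_hull (orbit (p i).2) (p i).1].
Hypothesis pstep : forall i, polygon_step x h i (p i) (p i.+1).

(** Constant of linear growth: [A + L] for the velocities in [F], and the other factor for the
    defect of the step when [h <= 1]. *)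
Let M1 := (A + L) * (1 + 2 * L * kp ^+ 3).

Let M10 : 0 <= M1.
Proof. by rewrite /M1 mulr_ge0// ?addr_ge0// ?mulr_ge0// ?exprn_ge0. Qed.

Lemma polygon_velocity i : exists u u', [/\ F (p i).2 u, (p i.+1).2 = (p i).2 + h *: u',
  `|u' - u| <= 2 * L * kp ^+ 3 * (A + L) * (1 + `|(p i).2|) * h & `|u'| <= M1 * (1 + `|(p i).2|)].
Proof.
have [_ [u [u' [Fu pE ule]]]] := pstep i; have [_ ba _] := pok i.
exists u, u'; set b := (p i).2 in Fu ule ba *.
have kp3 : 0 <= kp ^+ 3 by rewrite exprn_ge0.
have AL : A + L * `|b| <= (A + L) * (1 + `|b|).
  have := mulr_ge0 A0 (normr_ge0 b); have := L0; lra.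
have C0 : 0 <= 2 * L * kp ^+ 3 by rewrite !mulr_ge0.
have le1 : `|u' - u| <= 2 * L * kp ^+ 3 * (A + L) * (1 + `|b|) * h.
  apply: le_trans ule _.
  have -> : 2 * L * kp ^+ 3 * (A + L) * (1 + `|b|) * h = 2 * L * kp ^+ 3 * h * ((A + L) * (1 + `|b|)) by ring.
  by apply: ler_wpM2l => //; rewrite mulr_ge0// ltW.
split=> //; rewrite -[u'](subrK u); apply: le_trans (ler_normD _ _) _.
have le2 : `|u| <= (A + L) * (1 + `|b|) by apply: le_trans AL; exact: AP.
have le3 : 2 * L * kp ^+ 3 * (A + L) * (1 + `|b|) * h <= 2 * L * kp ^+ 3 * (A + L) * (1 + `|b|).
  by apply: ler_piMr => //; rewrite !mulr_ge0// addr_ge0.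
rewrite /M1; apply: le_trans (lerD (le_trans le1 le3) le2) _.
by rewrite le_eqVlt; apply/orP; left; apply/eqP; ring.
Qed.

(** Discrete Gronwall: a step multiplies the left side by at most [1 + M1 h], hence by at most
    [expR (M1 * h)]. *)
Lemma polygon_growth i : 1 + `|(p i).2| <= (1 + `|(p 0%N).2|) * expR (M1 * (i%:R * h)).
Proof.
elim: i => [|i IH]; first by rewrite mul0r mulr0 expR0 mulr1.
have [u [u' [_ -> _ u'le]]] := polygon_velocity i.
apply: (@le_trans _ _ ((1 + `|(p i).2|) * (1 + M1 * h))).
  apply: (@le_trans _ _ (1 + (`|(p i).2| + `|h *: u'|))); first by rewrite lerD2l ler_normD.
  rewrite normrZ gtr0_norm//.
  have := ler_wpM2l (ltW h0) u'le; lra.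
have -> : M1 * (i.+1%:R * h) = M1 * (i%:R * h) + M1 * h by rewrite -natr1; ring.
rewrite expRD [X in _ <= X]mulrA; apply: ler_pM; [exact: addr_ge0| |exact: IH|exact: expR_ge1Dx].
by rewrite addr_ge0// mulr_ge0// ltW.
Qed.

(** Discrete Gronwall with local error [E h ^ 2] and amplification [1 + h L]; the local errors of
    [i] steps add up to [E * h * (i h)]. *)
Lemma polygon_error T E i : 0 <= E ->
  (forall s u, 0 <= s -> s < u -> u <= T ->
    exists2 v, F (x s) v & `|x u - x s - (u - s) *: v| <= E * (u - s) ^+ 2) ->
  i%:R * h <= T -> `|x (i%:R * h) - (p i).1| <= E * h * (i%:R * h) * expR (L * (i%:R * h)).
Proof.
move=> E0 EP; elim: i => [|i IH] iT.
  have z0 : 0%:R * h = 0 by rewrite mul0r.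
  by rewrite z0 p0 subrr normr0 mulr0 mul0r.
have ihS : i.+1%:R * h = i%:R * h + h by rewrite -natr1 mulrDl mul1r.
have ih0 : 0 <= i%:R * h by rewrite mulr_ge0// ltW.
have iT' : i%:R * h <= T by apply: le_trans iT; rewrite ihS lerDl ltW.
have [[v Fv [vbest vle]] _] := pstep i.
have [|v1 Fv1] := EP (i%:R * h) (i.+1%:R * h) ih0 _ iT; first by rewrite ihS ltrDl.
have -> : i.+1%:R * h - i%:R * h = h by rewrite ihS addrC addKr.
move=> v1le; have le1 := le_trans (vbest _ Fv1) v1le.
have -> : x (i.+1%:R * h) - (p i.+1).1 =
   (x (i.+1%:R * h) - x (i%:R * h) - h *: v) + (x (i%:R * h) + h *: v - (p i.+1).1).
  by move: (h *: v) => z; apply/rowP => j; rewrite !mxE; ring.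
apply: le_trans (ler_normD _ _) _; apply: le_trans (lerD le1 vle) _.
have e1 : 1 <= expR (L * (i.+1%:R * h)) 
  by rewrite -expR0 ler_expR !mulr_ge0// ltW.
have e2 : expR (L * (i.+1%:R * h)) = expR (L * (i%:R * h)) * expR (h * L).
  by rewrite -expRD ihS; congr expR; ring.
have e3 : (1 + h * L) * `|x (i%:R * h) - (p i).1| <=
    E * h * (i%:R * h) * expR (L * (i.+1%:R * h)).
  rewrite e2 [X in _ <= X]mulrA [X in X <= _]mulrC.
  apply: ler_pM => //; [|exact: IH|exact: expR_ge1Dx].
  by rewrite addr_ge0// mulr_ge0// ltW.
apply: le_trans (lerD (lexx _) e3) _.
set X := expR (L * (i.+1%:R * h)) in e1 *.
have -> : E * h * (i.+1%:R * h) * X = E * h ^+ 2 * X + E * h * (i%:R * h) * X by rewrite ihS; ring.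
by rewrite lerD2r; apply: ler_peMr => //; rewrite mulr_ge0// exprn_ge0// ltW.
Qed.

(** Each single velocity is close to [F (p i).2] because the polygon has moved little, and induction
    on [k] keeps the average velocity as one vector of this convex set. The extra [h] in the last
    factor pays for the defects of the single steps. *)
Lemma polygon_increments i k rho :
  (forall l, (l <= i + k)%N -> 1 + `|(p l).2| <= rho) ->
  exists2 v, F (p i).2 v & `|(p (i + k)%N).2 - (p i).2 - (k%:R * h) *: v| <=
    rho * (L * M1 + 2 * L * kp ^+ 3 * (A + L)) * (k%:R * h) * (k%:R * h + h).
Proof.
move=> rhoP; set C := rho * _.
have rho0 : 0 <= rho by apply: le_trans (rhoP i (leq_addr _ _)); rewrite addr_ge0.
have kp3 : 0 <= kp ^+ 3 by rewrite exprn_ge0.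
have moved l : (l <= k)%N -> `|(p (i + l)%N).2 - (p i).2| <= l%:R * h * (M1 * rho).
  elim: l => [|l IH] lk; first by rewrite addn0 subrr normr0 !mul0r.
  rewrite addnS; have [u [u' [_ -> _ u'le]]] := polygon_velocity (i + l).
  rewrite addrAC; apply: le_trans (ler_normD _ _) _.
  rewrite -natr1 2!mulrDl mul1r; apply: lerD; first by apply: IH; exact: ltnW.
  rewrite normrZ gtr0_norm//; apply: ler_wpM2l; first exact: ltW.
  apply: le_trans u'le _; apply: ler_wpM2l => //; apply: rhoP.
  by rewrite leq_add2l ltnW.
elim: k {rhoP} moved (rhoP) => [|k IH] moved rhoP.
  have [v Fv] := F_ex (p i).2; exists v => //.
  by rewrite addn0 !mul0r scale0r subrr subr0 normr0 mulr0 mul0r.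
have [||v Fv vle] := IH.
- by move=> l lk; apply: moved; exact: leqW.
- by move=> l lk; apply: rhoP; rewrite addnS leqW.
have [u [u' [Fu pE uu' _]]] := polygon_velocity (i + k).
have [_ pia _] := pok i; have [_ pka _] := pok (i + k).
have [w' Fw' wle] := F_lipschitz pka pia Fu.
have k1 : 0 < k.+1%:R :> R by [].
exists ((k%:R / k.+1%:R) *: v + (1 - k%:R / k.+1%:R) *: w').
  apply: (convex_set_comb (@convex_hull_convex _ _ _)) => //.
  by rewrite ler_pdivrMr// mul1r ler_nat.
rewrite addnS pE.
have -> : (p (i + k)%N).2 + h *: u' - (p i).2 -
    (k.+1%:R * h) *: ((k%:R / k.+1%:R) *: v + (1 - k%:R / k.+1%:R) *: w') =
   ((p (i + k)%N).2 - (p i).2 - (k%:R * h) *: v) + h *: ((u' - u) + (u - w')).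
  have -> : (k.+1%:R * h) *: ((k%:R / k.+1%:R) *: v + (1 - k%:R / k.+1%:R) *: w') =
     (k%:R * h) *: v + h *: w'.
    rewrite scalerDr !scalerA; congr (_ *: _ + _ *: _); first by field; lra.
    by rewrite -natr1; field; rewrite natr1; lra.
  by apply/rowP => j; rewrite !mxE; ring.
apply: le_trans (ler_normD _ _) _.
have nle : `|u' - u + (u - w')| <= C * (k.+1%:R * h).
  apply: le_trans (ler_normD _ _) _.
  have a1 : `|u' - u| <= 2 * L * kp ^+ 3 * (A + L) * rho * h.
    apply: le_trans uu' _; apply: ler_wpM2r; first exact: ltW.
    by apply: ler_wpM2l; [rewrite !mulr_ge0// addr_ge0|apply: rhoP; rewrite leq_add2l].
  have a2 : `|u - w'| <= L * (k%:R * h * (M1 * rho)).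
    by apply: le_trans wle _; apply: ler_wpM2l => //; exact: moved.
  have a3 : 2 * L * kp ^+ 3 * (A + L) * rho * h <= 2 * L * kp ^+ 3 * (A + L) * rho * (k.+1%:R * h).
    apply: ler_wpM2l; first by rewrite !mulr_ge0// addr_ge0.
    by apply: ler_peMl; [exact: ltW|rewrite ler1n].
  have a4 : L * (k%:R * h * (M1 * rho)) <= L * (k.+1%:R * h * (M1 * rho)).
    apply: ler_wpM2l => //; apply: ler_wpM2r; first exact: mulr_ge0.
    by apply: ler_wpM2r; [exact: ltW|rewrite ler_nat].
  apply: le_trans (lerD (le_trans a1 a3) (le_trans a2 a4)) _.
  by rewrite /C le_eqVlt; apply/orP; left; apply/eqP; ring.
rewrite normrZ gtr0_norm//; apply: le_trans (lerD vle (ler_wpM2l (ltW h0) nle)) _.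
have C0 : 0 <= C by rewrite /C mulr_ge0 ?addr_ge0 ?mulr_ge0 ?addr_ge0 ?mulr_ge0 ?addr_ge0 ?exprn_ge0.
rewrite -natr1; set q : R := k%:R; have q0 : 0 <= q by rewrite /q.
rewrite -subr_ge0.
have -> : C * ((q + 1) * h) * ((q + 1) * h + h) - (C * (q * h) * (q * h + h) + h * (C * ((q + 1) * h))) =
  C * (h * h) * (q + 1) by ring.
by apply: mulr_ge0; [apply: mulr_ge0 => //; apply: mulr_ge0; exact: ltW|exact: addr_ge0].
Qed.

End Bounds.
End Polygon.
Lemma vspace_ball_compact (r : R) : compact [set z : V | z \in a /\ `|z| <= r].
Proof.
apply: bounded_closed_compact.
  by exists r; split; [exact: num_real|move=> M rM z [_ zr] /=; exact: le_trans zr (ltW rM)].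
rewrite (_ : [set z : V | _] = [set x | x \in a] `&` (fun x : V => `|x|) @^-1` [set x | x <= r]); last by [].
apply: closedI; first exact: vspace_closed.
by apply: closed_comp => [x _|]; [exact: norm_continuous|exact: closed_le].
Qed.

Let h (m : nat) : R := m.+1%:R^-1.
Let idx (m : nat) (t : R) : nat := Num.truncn (t * m.+1%:R).

Let h_gt0 m : 0 < h m. Proof. by rewrite invr_gt0. Qed.

Let idx_itv m t : 0 <= t -> (idx m t)%:R * h m <= t < (idx m t)%:R * h m + h m.
Proof.
move=> t0; have := @truncn_itv R (t * m.+1%:R); rewrite mulr_ge0// => /(_ isT)/andP[le1 lt1].
rewrite ler_pdivrMr// le1/=; have -> : (idx m t)%:R * h m + h m = (idx m t).+1%:R / m.+1%:R.
  by rewrite -natr1 mulrDl mul1r.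
by rewrite ltr_pdivlMr.
Qed.

Let idx_le m s u : s <= u -> (idx m s <= idx m u)%N.
Proof. by move=> su; apply: le_truncn; rewrite ler_wpM2r. Qed.

Lemma majorizing_solution (x : R -> V) (b0 : V) :
  relaxed_solution a (fun x => derv x) x -> b0 \in a -> convex_hull (orbit b0) (x 0) ->
  exists y : R -> V, [/\ relaxed_solution a (fun x => derv x) y, y 0 = b0 &
    forall t, 0 <= t -> convex_hull (orbit (y t)) (x t)].
Proof.
move=> xsol b0a xb; have xI := solution_increments xsol; have [xa _ _] := xsol.
have [kp kp1 kpP] := exists_kappa; have [A A0 AP] := F_bounded.
have kp0 : 0 <= kp by apply: le_trans kp1.
have /choice[P PP] : forall m, exists p : nat -> V * V, [/\ p 0%N = (x 0, b0),
    forall i, [/\ (p i).1 \in a, (p i).2 \in a & convex_hull (orbit (p i).2) (p i).1] &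
    forall i, polygon_step kp A x (h m) i (p i) (p i.+1)].
  by move=> m; apply: polygon_ex => //; exact: ltW.
pose M1 := (A + L) * (1 + 2 * L * kp ^+ 3).
have M10 : 0 <= M1 by rewrite /M1 mulr_ge0 ?addr_ge0 ?mulr_ge0 ?exprn_ge0.
have h1 m : h m <= 1 by rewrite invf_le1// ler1n.
pose rho T := (1 + `|b0|) * expR (M1 * T).
have rhoP m l T : l%:R * h m <= T -> 1 + `|(P m l).2| <= rho T.
  move=> lT; have [p0 pok pst] := PP m.
  have := polygon_growth kp1 A0 AP (h_gt0 m) (h1 m) pok pst l.
  rewrite p0 => /le_trans; apply; apply: ler_wpM2l; first exact: addr_ge0.
  by rewrite ler_expR; apply: ler_wpM2l.
(* Every time [t] gets its limit along the same [U], so neither equicontinuity of the polygons nor a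
   diagonal sequence is called for. *)
have [U [UU sU]] := ultraFilterLemma (eventually_filter : ProperFilter \oo).
have hU : h @ U --> (0 : R) by move=> S /cvg_harmonic/sU.
have h_small (e : R) : 0 < e -> \forall m \near U, h m <= e.
  move=> e0; have /cvgrPdist_le/(_ e e0) := hU; apply: filterS => m.
  by rewrite sub0r normrN gtr0_norm.
have idxU t : 0 <= t -> (fun m => (idx m t)%:R * h m) @ U --> t.
  move=> t0; apply/cvgrPdist_le => e e0; have := h_small e e0; apply: filterS => m le1.
  have /andP[i1 i2] := idx_itv m t0; rewrite ger0_norm ?subr_ge0//; lra.
have /choice[y yP] : forall t, exists yt, 0 <= t -> yt \in a /\ (fun m => (P m (idx m t)).2) @ U --> yt.
  move=> t; have [t0|] := boolP (0 <= t); last by exists 0.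
  have [|yt [yta _] ylim] := @ultra_compact_cvg _ _ U (fun m => (P m (idx m t)).2) _ UU
     (@vspace_ball_compact (rho t)); last by exists yt.
  apply: filterE => m; split; first by have [_ /(_ (idx m t))[]] := PP m.
  by apply: le_trans (rhoP m (idx m t) t _); [rewrite lerDr|case/andP: (idx_itv m t0)].
have ya t : 0 <= t -> y t \in a by move=> /yP[].
have yU t : 0 <= t -> (fun m => (P m (idx m t)).2) @ U --> y t by move=> /yP[].
have y_small t (e : R) : 0 <= t -> 0 < e -> \forall m \near U, `|(P m (idx m t)).2 - y t| <= e.
  by move=> t0 e0; have /cvgrPdistC_le/(_ e e0) := yU t t0.
exists y; split.
- apply: increments_solution => // T T0.
  pose C := rho T * (L * M1 + 2 * L * kp ^+ 3 * (A + L)).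
  exists C.
    have rho0 : 0 <= rho T by rewrite /rho mulr_ge0 ?addr_ge0 ?expR_ge0.
    have kp3 : 0 <= kp ^+ 3 by rewrite exprn_ge0.
    by rewrite /C; apply: mulr_ge0 => //; apply: addr_ge0; do ![apply: mulr_ge0 => //]; exact: addr_ge0.
  move=> s u s0 su uT; have u0 : 0 <= u by apply: le_trans (ltW su).
  (* The velocities are moved from the vertices to the fixed compact set [F (y s)], where they have
     a limit; the price, proportional to the distance of the vertex to [y s], tends to 0 along
     [U]. *)
  have /choice[v vP] : forall m, exists v, F (y s) v /\
      `|(P m (idx m u)).2 - (P m (idx m s)).2 - ((idx m u)%:R * h m - (idx m s)%:R * h m) *: v| <=
      C * ((idx m u)%:R * h m - (idx m s)%:R * h m) * ((idx m u)%:R * h m - (idx m s)%:R * h m + h m) +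
      ((idx m u)%:R * h m - (idx m s)%:R * h m) * (L * `|(P m (idx m s)).2 - y s|).
    move=> m; have [p0 pok pst] := PP m.
    have isu : (idx m s + (idx m u - idx m s) = idx m u)%N by rewrite subnKC// idx_le// ltW.
    have [|v Fv vle] := polygon_increments kp1 A0 AP (h_gt0 m) (h1 m) pok pst
      (i := idx m s) (k := (idx m u - idx m s)%N) (rho := rho T).
      move=> l; rewrite isu => lu; apply: rhoP; apply: le_trans uT.
      have /andP[+ _] := idx_itv m u0; apply: le_trans.
      by apply: ler_wpM2r; [exact: ltW|rewrite ler_nat].
    have dE : (idx m u - idx m s)%:R * h m = (idx m u)%:R * h m - (idx m s)%:R * h m.
      by rewrite natrB ?mulrBl//; apply: idx_le; exact: ltW.
    rewrite isu dE in vle.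
    set d : R := (idx m u)%:R * h m - (idx m s)%:R * h m in vle *.
    have d0 : 0 <= d.
      by rewrite subr_ge0; apply: ler_wpM2r; [exact: ltW|rewrite ler_nat idx_le// ltW].
    have [_ psa _] := pok (idx m s).
    have [v' Fv' vv'] := F_lipschitz psa (ya s s0) Fv.
    exists v'; split=> //.
    have -> : (P m (idx m u)).2 - (P m (idx m s)).2 - d *: v' =
       ((P m (idx m u)).2 - (P m (idx m s)).2 - d *: v) + d *: (v - v').
      by apply/rowP => j; rewrite !mxE; ring.
    apply: le_trans (ler_normD _ _) _; apply: lerD => //.
    by rewrite normrZ ger0_norm//; apply: ler_wpM2l.
  have [|w0 Fw0 vU] := @ultra_compact_cvg _ _ U v _ UU (F_compact (ya s s0)).
    by apply: filterE => m; case: (vP m).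
  exists w0 => //.
  have dU : (fun m => (idx m u)%:R * h m - (idx m s)%:R * h m) @ U --> u - s.
    by apply: cvgB; apply: idxU.
  have lhs : (fun m => `|(P m (idx m u)).2 - (P m (idx m s)).2 -
      ((idx m u)%:R * h m - (idx m s)%:R * h m) *: v m|) @ U --> `|y u - y s - (u - s) *: w0|.
    apply: cvg_norm; apply: cvgB; last exact: cvgZ.
    by apply: cvgB; apply: yU.
  have nU : (fun m => `|(P m (idx m s)).2 - y s|) @ U --> (0 : R).
    have : (fun m => `|(P m (idx m s)).2 - y s|) @ U --> `|y s - y s|.
      by apply: cvg_norm; apply: cvgB; [exact: yU|exact: cvg_cst].
    by rewrite subrr normr0.
  have rhs : (fun m => C * ((idx m u)%:R * h m - (idx m s)%:R * h m) *
      ((idx m u)%:R * h m - (idx m s)%:R * h m + h m) +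
      ((idx m u)%:R * h m - (idx m s)%:R * h m) * (L * `|(P m (idx m s)).2 - y s|)) @ U -->
      C * (u - s) * (u - s + 0) + (u - s) * (L * 0).
    apply: cvgD; apply: cvgM.
    - by apply: cvgM; [exact: cvg_cst|].
    - exact: cvgD.
    - exact: dU.
    - by apply: cvgM; [exact: cvg_cst|].
  have := ler_cvg_to lhs rhs; rewrite addr0 !mulr0 addr0 expr2 mulrA; apply.
  by apply: filterE => m; case: (vP m).
- have [_ y0] := yP 0 (lexx _).
  have h0 : (fun m => (P m (idx m 0)).2) @ U --> b0.
    apply: cvg_near_cst; apply: filterE => m; have [p0 _ _] := PP m.
    by rewrite /idx mul0r truncn0 p0.
  exact: (cvg_unique _ y0 h0).
(* The orbit hull of [y t] is compact, so approximation suffices: [x t] is near the first vertex,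
   which lies in the hull over the second vertex, and the same Weyl elements applied to [y t] change
   a hull point by at most [kp] times the distance. *)
- move=> t t0; apply: closed_approx => [|e e0].
    by apply: convex_hull_compact; apply: orbit_compact; exact: ya.
  have [E E0 EP] := xI t t0; have [M M0 MP] := increments_lipschitz xa xI t0.
  pose C := M + E * t * expR (L * t) + 1.
  have C0 : 0 < C by rewrite /C ltr_wpDl// addr_ge0// !mulr_ge0// expR_ge0.
  have e1 : 0 < e / 2 / C by rewrite !divr_gt0.
  have e2 : 0 < e / 2 / kp by rewrite !divr_gt0// (lt_le_trans _ kp1).
  have [m [hm ym]] := filter_ex (filterI (h_small _ e1) (y_small t _ t0 e2)).
  have [p0 pok pst] := PP m; have [ama bma ab] := pok (idx m t).
  have [z Fz zle] : exists2 z, convex_hull (orbit (y t)) z &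
     `|(P m (idx m t)).1 - z| <= kp * `|(P m (idx m t)).2 - y t|.
    apply: (hull_family_near _ ab) => g Ng; rewrite -wB.
    by apply: kappa_w => //; rewrite memvB// ya.
  exists z => //.
  have /andP[i1 i2] := idx_itv m t0.
  have i0 : 0 <= (idx m t)%:R * h m by rewrite mulr_ge0// ltW.
  have l1 : `|x t - x ((idx m t)%:R * h m)| <= M * h m.
    by apply: le_trans (MP _ _ i0 i1 (lexx _)) _; apply: ler_wpM2l => //; lra.
  have l2 : `|x ((idx m t)%:R * h m) - (P m (idx m t)).1| <= E * t * expR (L * t) * h m.
    have p01 : (P m 0%N).1 = x 0 by rewrite p0.
    apply: le_trans (polygon_error (h_gt0 m) p01 pst E0 EP i1) _.
    have -> : E * t * expR (L * t) * h m = E * h m * (t * expR (L * t)) by ring.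
    rewrite -mulrA; apply: ler_wpM2l; first by rewrite mulr_ge0// ltW.
    apply: ler_pM => //; rewrite ?expR_ge0//.
    by rewrite ler_expR; apply: ler_wpM2l.
  have -> : x t - z = (x t - x ((idx m t)%:R * h m)) + ((x ((idx m t)%:R * h m) - (P m (idx m t)).1) +
     ((P m (idx m t)).1 - z)).
    by apply/rowP => j; rewrite !mxE; ring.
  apply: le_trans (ler_normD _ _) _; apply: le_trans (lerD l1 (ler_normD _ _)) _.
  have l3 : kp * `|(P m (idx m t)).2 - y t| <= e / 2.
    by rewrite mulrC -ler_pdivlMr// (lt_le_trans _ kp1).
  have l4 : C * h m <= e / 2 by rewrite mulrC -ler_pdivlMr.
  have := h_gt0 m; rewrite /C in l4; lra.
Qed.

End ReducedControlSystem.

(** * Differential calculus of germs and slices *)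

Section NearEqualDifferential.
Variables (R : realType).

Lemma near_eq_diff (V W : normedModType R) (f g : V -> W) (x : V) : (\forall y \near x, f y = g y) ->
  differentiable f x -> differentiable g x /\ 'd g x = 'd f x :> (V -> W).
Proof.
move=> fg df; have fgx : f x = g x := nbhs_singleton fg.
have gE : g \o shift x = cst (g x) + 'd f x +o_ 0 id.
  apply/eqaddoP => e e0; have /eqaddoP/(_ e e0) := diff_locally df.
  have : \forall h \near 0, f (h + x) = g (h + x).
    have : (fun h => h + x) @ 0 --> 0 + x by apply: cvgD; [exact: cvg_id|exact: cvg_cst].
    by rewrite add0r => /(_ _ fg).
  apply: filterS2 => h hE; rewrite /= -fgx.
  suff -> : (f \o shift x - (cst (f x) + 'd f x)) h = (g \o shift x - (cst (f x) + 'd f x)) h by [].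
  by rewrite -![(_ - _) h]/(_ - _) /= hE.
have dE := diff_unique (diff_continuous df) gE.
split=> //; apply/diff_locallyP; split; last by rewrite dE.
by rewrite dE; exact: diff_continuous.
Qed.

Variables (V W : normedModType R).

Lemma differentiable_scale (f : V -> R) (g : V -> W) (x : V) :
  differentiable f x -> differentiable g x -> differentiable (fun y => f y *: g y) x.
Proof.
move=> df dg.
have sb : bilinear_for (GRing.Scale.Law.clone _ _ *:%R _) (GRing.Scale.Law.clone _ _ *:%R _)
    (fun (k : R^o) (v : W) => k *: v).
  split=> [u'|u'] k u v /=; first by rewrite scalerDl scalerA.
  by rewrite scalerDr !scalerA mulrC.
pose b : {bilinear R^o -> W -> W} := HB.pack (fun (k : R^o) (v : W) => k *: v)
  (bilinear_isBilinear.Build R R^o W W _ _ (fun (k : R^o) (v : W) => k *: v) sb).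
have db := @differentiable_bilin R R^o W W b (f x, g x).
apply: (@differentiable_comp _ _ _ _ (fun y => (f y : R^o, g y)) (fun p : R^o * W => b p.1 p.2)).
  exact: differentiable_pair.
apply: db => p; apply: cvgZ; [exact: cvg_fst|exact: cvg_snd].
Qed.

Lemma is_derive_diff_comp (f : V -> W) (g : R -> V) (t : R) (dg : V) :
  differentiable f (g t) -> is_derive t 1 g dg -> is_derive t 1 (f \o g) ('d f (g t) dg).
Proof.
move=> df [gd gE]; have {}gd : differentiable g t by apply/derivable1_diffP.
have fg : differentiable (f \o g) t by exact: differentiable_comp.
split; first exact: diff_derivable.
by rewrite deriveE// diff_comp//= -[X in 'd f _ X = _]deriveE// gE.
Qed.

Lemma diff_comp_near (U0 V0 W0 : normedModType R) (f : V0 -> W0) (g : U0 -> V0) (k : U0 -> W0)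
    (x v : U0) (y : V0) :
  g x = y -> differentiable g x -> differentiable f y ->
  (\forall z \near x, f (g z) = k z) ->
  differentiable k x /\ 'd k x v = 'd f y ('d g x v).
Proof.
move=> <- dg df fgk; have dfg := differentiable_comp dg df.
have [dk ->] : differentiable k x /\ 'd k x = 'd (f \o g) x :> (U0 -> W0).
  exact: near_eq_diff fgk dfg.
by rewrite diff_comp.
Qed.

Lemma diff_slicel (U : normedModType R) (f : U * V -> W) (x : U) (y : V) (u : U) :
  differentiable f (x, y) ->
  differentiable (fun z => f (z, y)) x /\ 'd (fun z => f (z, y)) x u = 'D_(u, 0) f (x, y).
Proof.
move=> df; have dp : is_diff x (fun z : U => (z, y)) (fun u => (u, 0)).
  exact: is_diff_pair.
have [dk ->] := diff_comp_near (f := f) (g := fun z => (z, y)) (k := fun z => f (z, y)) u erefl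
  ex_diff df (filterE _ (fun=> erefl)).
by split=> //; rewrite diff_val deriveE.
Qed.

Lemma diff_slicer (U : normedModType R) (f : V * U -> W) (x : V) (y u : U) :
  differentiable f (x, y) ->
  differentiable (fun z => f (x, z)) y /\ 'd (fun z => f (x, z)) y u = 'D_(0, u) f (x, y).
Proof.
move=> df; have dp : is_diff y (fun z : U => (x, z)) (fun u => (0, u)).
  exact: is_diff_pair.
have [dk ->] := diff_comp_near (f := f) (g := fun z => (x, z)) (k := fun z => f (x, z)) u erefl
  ex_diff df (filterE _ (fun=> erefl)).
by split=> //; rewrite diff_val deriveE.
Qed.

End NearEqualDifferential.

(** Chain rule for [f (m (v, z), w)] in [z], with partial differentials written as directional
    derivatives: these are what [smooth_on] controls, so their dependence on [v] becomes
    accessible. *)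
Lemma diff_slices (R : realType) (n : nat) (W : normedModType R)
    (m : 'rV[R]_n * 'rV[R]_n -> 'rV[R]_n) (f : 'rV[R]_n * 'rV[R]_n -> W)
    (k : 'rV[R]_n -> W) (v w e y : 'rV[R]_n) :
  m (v, e) = v -> differentiable m (v, e) -> differentiable f (v, w) ->
  (\forall z \near e, f (m (v, z), w) = k z) ->
  'd k e y = \sum_j 'D_(0, y) m (v, e) 0 j *: 'D_(delta_mx 0 j, 0) f (v, w).
Proof.
move=> mv dm df h.
have [d1 _] := diff_slicel 0 df; have [d2 d2E] := diff_slicer y dm.
rewrite (diff_comp_near (f := fun z => f (z, w)) (g := fun z => m (v, z)) y mv d2 d1 h).2.
rewrite d2E; set p := 'D_(0, y) m (v, e).
rewrite [X in 'd _ _ X = _](row_sum_delta p) linear_sum.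
apply: eq_bigr => j _; rewrite linearZ /=; congr (_ *: _).
by have [_ ->] := diff_slicel (delta_mx 0 j) df.
Qed.

Lemma differentiable_slices (R : realType) (n : nat)
    (p : 'rV[R]_n * 'rV[R]_n -> 'rV[R]_n) (q : 'I_n -> 'rV[R]_n * 'rV[R]_n -> 'rV[R]_n)
    (i : 'rV[R]_n -> 'rV[R]_n) (e e' : 'rV[R]_n) :
  differentiable p (e, e') -> differentiable i e -> (forall j, differentiable (q j) (e, i e)) ->
  differentiable (fun v => \sum_j p (v, e') 0 j *: q j (v, i v)) e.
Proof.
move=> dp di dq.
have -> : (fun v => \sum_j p (v, e') 0 j *: q j (v, i v)) =
    \sum_j (fun v => p (v, e') 0 j *: q j (v, i v)).
  by apply/funext => v; rewrite fct_sumE.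
apply: differentiable_sum => j; apply: differentiable_scale.
  apply: (@differentiable_comp _ _ _ _ (fun v => p (v, e')) (fun M : 'rV_n => M 0 j)).
    by have [] := diff_slicel 0 dp.
  exact: differentiable_coord.
apply: (@differentiable_comp _ _ _ _ (fun v => (v, i v)) (q j)) => //.
exact: differentiable_pair.
Qed.

Lemma is_derive_line (R : realType) (V : normedModType R) (x v : V) (t : R) :
  is_derive t 1 (fun t : R => x + t *: v) v.
Proof.
have : is_derive t 1 (fun t : R => x + t *: v) (0 + v); last by rewrite add0r.
apply: is_deriveD; have h := is_diff_scalel (t : R) v.
split; first by apply: diff_derivable; apply: ex_diff.
by rewrite deriveE ?diff_val ?scale1r//; apply: ex_diff.
Qed.

Lemma is_derive_translate (R : realType) (W : normedModType R) (f : R -> W) (t : R) (d : W) :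
  is_derive (0 : R) 1 f d -> is_derive t 1 (fun u => f (u - t)) d.
Proof.
have E : (fun h : R => h^-1 *: (((fun u => f (u - t)) \o shift t) (h *: 1) - f (t - t))) =
    (fun h : R => h^-1 *: ((f \o shift 0) (h *: 1) - f 0)).
  by apply/funext => h /=; rewrite subrr addrK addr0.
by move=> [fd fE]; split; rewrite /derivable /derive E.
Qed.

Lemma mean_value (R : realType) (V : normedModType R) (f : V -> R) (x y : V) :
  (forall t : R, 0 <= t <= 1 -> differentiable f (x + t *: (y - x))) ->
  exists2 t : R, 0 <= t <= 1 & f y - f x = 'd f (x + t *: (y - x)) (y - x).
Proof.
move=> df; pose g (t : R) := f (x + t *: (y - x)).
have dg (t : R) : 0 <= t <= 1 -> is_derive t 1 g ('d f (x + t *: (y - x)) (y - x)).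
  move=> t01.
  apply: (@is_derive_diff_comp _ _ _ f (fun t => x + t *: (y - x))); first exact: df.
  exact: is_derive_line.
have [|||c c01 cE] := @MVT_segment R g (fun t => 'd f (x + t *: (y - x)) (y - x)) 0 1.
- by [].
- by move=> t; rewrite in_itv/= => /andP[/ltW t0 /ltW t1]; apply: dg; rewrite t0.
- apply: derivable_within_continuous => t; rewrite in_itv/= => /dg[].
  by [].
exists c; first by move: c01; rewrite in_itv.
by move: cE; rewrite /g scale1r scale0r addr0 subr0 mulr1 [x + (y - x)]addrC subrK.
Qed.

Section StrictDerivative.
Variables (R : realType) (n : nat).
Local Notation V := 'rV[R]_n.

Lemma diff_coord (U : normedModType R) (h : U -> V) (x u : U) k : differentiable h x ->
  differentiable (fun w => h w 0 k) x /\ 'd (fun w => h w 0 k) x u = 'd h x u 0 k.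
Proof.
move=> dh.
have lf : linear (fun M : V => M 0 k : R^o) by move=> c x1 y1; rewrite !mxE.
pose fl : {linear V -> R^o} := HB.pack (fun M : V => M 0 k : R^o)
  (GRing.isLinear.Build _ _ _ _ (fun M : V => M 0 k : R^o) lf).
have cf : continuous fl by exact: coord_continuous.
have df : differentiable (fl : V -> R^o) (h x) by exact: linear_differentiable.
have [d1 ->] := diff_comp_near (f := (fl : V -> R^o)) (g := h) (k := fun w => h w 0 k) u erefl
  dh df (filterE _ (fun=> erefl)).
by split=> //; rewrite diff_lin.
Qed.

Lemma rV_norm_le (x : V) (b : R) : 0 <= b -> (forall k, `|x 0 k| <= b) -> `|x| <= b.
Proof.
move=> b0 xb; rewrite -[X in X <= _]/(mx_norm x) mx_normrE.
by apply: bigmax_le => // -[i k] _ /=; rewrite (ord1 i).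
Qed.

(** Strict differentiability in the second variable, uniform in the first: the partial differential
    is continuous at [(e, e)] and the identity there, and the mean value theorem is applied to each
    coordinate of [m (v, w) - w]. The shares [eps / n.+1] of the [n] basis directions add up to at
    most [eps]. *)
Lemma slicer_strict (m : V * V -> V) (e : V) (eps : R) :
  (\forall z \near (e, e), differentiable m z) ->
  (forall u, {for (e, e), continuous ('D_(0, u) m)}) ->
  (\forall w \near e, m (e, w) = w) -> 0 < eps ->
  \forall z \near (e, e), `|m z - m (z.1, e) - (z.2 - e)| <= eps * `|z.2 - e|.
Proof.
move=> dm cDm me eps0.
have De u : 'D_(0, u) m (e, e) = u.
  have [_ <-] := diff_slicer u (nbhs_singleton dm).
  have [_ ->] : differentiable (fun w => m (e, w)) e /\
      'd (fun w => m (e, w)) e = 'd (fun w : V => w) e :> (V -> V).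
    by apply: near_eq_diff; [apply: filterS me => w ->|exact: ex_diff].
  by rewrite (diff_val (f := fun x : V => x)).
have e1 : 0 < eps / n.+1%:R by rewrite divr_gt0 ?ltr0n.
have nD : \forall z \near (e, e), differentiable m z /\
    forall l : 'I_n, `|'D_(0, delta_mx 0 l) m z - delta_mx 0 l| <= eps / n.+1%:R.
  apply: (@filterI _ _ (nbhs_filter (e, e)) _ _ dm).
  apply: (@filter_forall _ _ _ _ (nbhs_filter (e, e))) => l.
  have /cvgrPdist_le/(_ _ e1) := cDm (delta_mx 0 l).
  by apply: filterS => z; rewrite De distrC.
have /nbhs_ballP[d d0 dP] := nD.
apply/nbhs_ballP; exists d => // -[v w] [/= vd wd].
have seg (t : R) : 0 <= t <= 1 -> ball (e, e) d (v, e + t *: (w - e)).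
  move=> /andP[t0 t1]; split=> //=; move: wd; rewrite -!ball_normE /ball_ /= => wd.
  rewrite opprD addNKr normrN normrZ ger0_norm//.
  by rewrite distrC (le_lt_trans _ wd)// ler_piMl.
apply: rV_norm_le; first by rewrite mulr_ge0// ltW.
move=> k.
pose f w' := m (v, w') - w'.
have df w' u : ball (e, e) d (v, w') -> differentiable f w' /\
    'd f w' u = 'D_(0, u) m (v, w') - u.
  move=> /dP[/= dmz _]; have [d1 d1E] := diff_slicer u dmz.
  have [di diE] : differentiable (fun w : V => w) w' /\ 'd (fun w : V => w) w' u = u.
    by split; [exact: ex_diff|rewrite diff_val].
  have -> : f = (fun w : V => m (v, w)) - (fun w : V => w) by [].
  split; first exact: differentiableB.
  rewrite (diffB d1 di) -[LHS]/('d (fun w => m (v, w)) w' u - 'd (fun w : V => w) w' u).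
  by congr (_ - _).
have [t t01 ft] := @mean_value _ _ (fun w' => f w' 0 k) e w
  (fun t t01 => (diff_coord 0 k (df _ 0 (seg t t01)).1).1).
have bt := seg t t01; move: ft.
rewrite (diff_coord _ k (df _ 0 bt).1).2 (df _ (w - e) bt).2.
have -> : f w 0 k - f e 0 k = (m (v, w) - m (v, e) - (w - e)) 0 k.
  by rewrite /f !mxE; lra.
move=> ->; have [/= dmz Dl] := dP _ bt.
set z := (v, _) in dmz Dl *; set u := w - e.
have -> : 'D_(0, u) m z - u = \sum_l u 0 l *: ('D_(0, delta_mx 0 l) m z - delta_mx 0 l).
  have [_ <-] := diff_slicer u dmz; rewrite {1 2}(row_sum_delta u) linear_sum -sumrB.
  apply: eq_bigr => l _; rewrite [RHS]scalerBr; congr (_ - _).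
  rewrite [LHS]linearZ /=; congr (_ *: _).
  by have [_ ->] := diff_slicer (delta_mx 0 l) dmz.
apply: le_trans (rV_coord_le_norm _ _) _; apply: le_trans (ler_norm_sum _ _ _) _.
apply: le_trans (ler_sum _ (G := fun=> `|u| * (eps / n.+1%:R)) _) _ => [l _|].
  by rewrite normrZ; apply: ler_pM => //; exact: rV_coord_le_norm.
rewrite sumr_const card_ord.
have -> : `|u| * (eps / n.+1%:R) *+ n = eps / n.+1%:R * n%:R * `|u|.
  by rewrite -mulr_natr; move: `|u| (n.+1%:R : R)^-1 => ? ?; ring.
rewrite ler_wpM2r// -mulrA ler_piMr ?(ltW eps0)//.
by rewrite mulrC ler_pdivrMr ?ltr0n// mul1r ler_nat.
Qed.
End StrictDerivative.

(** * Lie groups in charts: the adjoint representation *)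

Section LieGroupCharts.
Variables (R : realType) (n : nat) (G : topGroupType) (A : set (chart R n G)).
Local Notation V := 'rV[R]_n.
Hypothesis GL : is_lie_group A.

Lemma lie_hausdorff : hausdorff_space G. Proof. by case: GL => -[]. Qed.

Lemma lie_chart d : A d -> is_chart d.
Proof. by case: GL => -[_ _ [+ _ _]] _; apply. Qed.

Lemma cvg_mulg (T : Type) (F : set_system T) (FF : Filter F) (f g : T -> G) (p q : G) :
  f @ F --> p -> g @ F --> q -> (fun t => (f t * g t)%g) @ F --> (p * q)%g.
Proof.
case: GL => _ [mc _ _ _] fp gq.
apply: (@cvg_comp _ _ _ (fun t => (f t, g t)) (fun z : G * G => (z.1 * z.2)%g) F (nbhs (p, q))).
  exact: cvg_pair.
exact: (mc (p, q)).
Qed.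

Lemma cvg_invg (T : Type) (F : set_system T) (FF : Filter F) (f : T -> G) (p : G) :
  f @ F --> p -> (fun t => (f t)^-1%g) @ F --> (p^-1)%g.
Proof.
case: GL => _ [_ ic _ _] fp.
exact: (@cvg_comp _ _ _ f (fun z : G => z^-1%g) F (nbhs p) _ fp (ic p)).
Qed.

Section Chart.
Variables (d : chart R n G) (Ad : A d).

Lemma chart_nbhs g : cdom d g -> nbhs g (cdom d).
Proof. by move=> dg; apply: open_nbhs_nbhs; split=> //; case: (lie_chart Ad). Qed.

Lemma cinvK g : cdom d g -> cinv d (d g) = g.
Proof. by have [_ _ _ _] := lie_chart Ad; apply. Qed.

Lemma cim_nbhs v : cim d v -> nbhs v (cim d).
Proof. by move=> dg; apply: open_nbhs_nbhs; split=> //; case: (lie_chart Ad). Qed.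

Lemma cim_map g : cdom d g -> cim d (d g). Proof. by move=> dg; exists g. Qed.

Lemma cmapK v : cim d v -> d (cinv d v) = v.
Proof. by move=> [g dg <-]; rewrite cinvK. Qed.

Lemma cdom_inv v : cim d v -> cdom d (cinv d v).
Proof. by move=> [g dg <-]; rewrite cinvK. Qed.

Lemma cvg_cinv v : cim d v -> cinv d @ v --> cinv d v.
Proof. by have [_ _ _ + _] := lie_chart Ad; apply. Qed.

Lemma cvg_cmap g : cdom d g -> d @ g --> d g.
Proof. by have [_ _ + _ _] := lie_chart Ad; apply. Qed.

End Chart.

Lemma ex_chart g : exists2 d, A d & cdom d g.
Proof. by case: GL => -[_ _ [_ + _]] _; apply. Qed.

Lemma mul_smooth d1 d2 d3 : A d1 -> A d2 -> A d3 ->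
  smooth_on [set z : V * V | [/\ cim d1 z.1, cim d2 z.2 & cdom d3 (cinv d1 z.1 * cinv d2 z.2)%g]]
    (fun z : V * V => d3 (cinv d1 z.1 * cinv d2 z.2)%g).
Proof. by case: GL => _ [_ _ + _]; apply. Qed.

Lemma mul_diff d1 d2 d3 (z : V * V) : A d1 -> A d2 -> A d3 ->
  cim d1 z.1 -> cim d2 z.2 -> cdom d3 (cinv d1 z.1 * cinv d2 z.2)%g ->
  differentiable (fun z : V * V => d3 (cinv d1 z.1 * cinv d2 z.2)%g) z.
Proof.
move=> A1 A2 A3 h1 h2 h3; have [+ _] := mul_smooth A1 A2 A3 1%N.
by apply; split.
Qed.

Lemma mul_diffl d1 d2 d3 g : A d1 -> A d2 -> A d3 ->
  cdom d1 g -> forall w, cim d2 w -> cdom d3 (g * cinv d2 w)%g ->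
  differentiable (fun w => d3 (g * cinv d2 w)%g) w.
Proof.
move=> A1 A2 A3 h1 w h2 h3.
have := @mul_diff d1 d2 d3 (d1 g, w) A1 A2 A3 (cim_map h1) h2.
rewrite /= cinvK// => /(_ h3) h4.
have -> : (fun w => d3 (g * cinv d2 w)%g) =
  (fun z : V * V => d3 (cinv d1 z.1 * cinv d2 z.2)%g) \o (fun w => (d1 g, w)).
  by apply/funext => w' /=; rewrite cinvK.
exact: differentiable_comp.
Qed.

Lemma mul_diffr d1 d2 d3 g : A d1 -> A d2 -> A d3 ->
  cdom d2 g -> forall w, cim d1 w -> cdom d3 (cinv d1 w * g)%g ->
  differentiable (fun w => d3 (cinv d1 w * g)%g) w.
Proof.
move=> A1 A2 A3 h1 w h2 h3.
have := @mul_diff d1 d2 d3 (w, d2 g) A1 A2 A3 h2 (cim_map h1).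
rewrite /= cinvK// => /(_ h3) h4.
have -> : (fun w => d3 (cinv d1 w * g)%g) =
  (fun z : V * V => d3 (cinv d1 z.1 * cinv d2 z.2)%g) \o (fun w => (w, d2 g)).
  by apply/funext => w' /=; rewrite cinvK.
exact: differentiable_comp.
Qed.

Section AtOne.
Variables (c : chart R n G) (cA : A c) (c1 : cdom c 1%g).
Local Notation e := (c 1%g).
Local Notation s := (cinv c).

Let ce : cim c e. Proof. exact: cim_map. Qed.
Let se : s e = 1%g. Proof. exact: cinvK. Qed.

Lemma cvg_cinv1 : s @ e --> 1%g.
Proof. by have := cvg_cinv cA ce; rewrite se. Qed.

Lemma cvg_mull g : (fun v => (g * s v)%g) @ e --> g.
Proof.
have := @cvg_mulg _ (nbhs e) (nbhs_filter e) (fun=> g) _ _ _ (cvg_cst _) cvg_cinv1.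
by rewrite mulg1; apply.
Qed.

Definition conj_chart (g : G) (v : V) : V := c (g * s v * g^-1)%g.

Lemma conj_chart1 g : conj_chart g e = e.
Proof. by rewrite /conj_chart se mulg1 mulgV. Qed.

Lemma cvg_conj g : (fun v => (g * s v * g^-1)%g) @ e --> 1%g.
Proof.
have := @cvg_mulg _ (nbhs e) (nbhs_filter e) _ (fun=> g^-1%g) _ _ (@cvg_mull g) (cvg_cst _).
by rewrite mulgV; apply.
Qed.

(** [g] may lie outside the domain of [c], so conjugation is factored through a chart around [g] and
    a chart around its inverse. *)
Lemma conj_chart_diff g : differentiable (conj_chart g) e.
Proof.
have [d dA dg] := ex_chart g; have [d' d'A d'g] := ex_chart (g^-1)%g.
have h1 : differentiable (fun w => d (g * s w)%g) e.
  by apply: (mul_diffl dA cA dA dg ce); rewrite se mulg1.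
have h2 : differentiable (fun w => c (cinv d w * g^-1)%g) (d (g * s e)%g).
  have gse : (g * s e = g)%g by rewrite se mulg1.
  by apply: (mul_diffr dA d'A cA d'g); rewrite gse ?(cinvK dA)// ?mulgV//; exact: cim_map.
have h3 := differentiable_comp h1 h2.
apply: (near_eq_diff _ h3).1; near=> v.
rewrite /conj_chart /= (cinvK dA)//; near: v.
by apply: (@cvg_mull g); exact: chart_nbhs.
Unshelve. all: by end_near. Qed.

Lemma AdE g : Ad c g = 'd (conj_chart g) e :> (V -> V). Proof. by []. Qed.

Lemma Ad_linear g : linear (Ad c g). Proof. by move=> k x y; rewrite /Ad linearP. Qed.

Lemma Ad_mul g h x : Ad c (g * h)%g x = Ad c g (Ad c h x).
Proof.
apply: (diff_comp_near _ (conj_chart1 h) (conj_chart_diff h) (conj_chart_diff g) _).2.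
near=> v; rewrite /conj_chart (cinvK cA); first by rewrite invgM !mulgA.
by near: v; apply: (@cvg_conj h); exact: chart_nbhs.
Unshelve. all: by end_near. Qed.

Lemma Ad_one x : Ad c 1%g x = x.
Proof.
rewrite AdE.
have [_ ->] : differentiable (conj_chart 1%g) e /\ 'd (conj_chart 1%g) e = 'd (fun x : V => x) e :> (V -> V).
  apply: near_eq_diff; last exact: ex_diff.
  near=> v; rewrite /conj_chart mul1g invg1 mulg1 cmapK//; near: v.
  exact: cim_nbhs.
by rewrite (diff_val (f := fun x : V => x)).
Unshelve. all: by end_near. Qed.

Lemma AdV g x : Ad c g^-1%g (Ad c g x) = x.
Proof. by rewrite -Ad_mul mulVg Ad_one. Qed.

Lemma AdVK g x : Ad c g (Ad c g^-1%g x) = x.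
Proof. by rewrite -Ad_mul mulgV Ad_one. Qed.

Let m (z : V * V) : V := c (s z.1 * s z.2)%g.
Let i (v : V) : V := c (s v)^-1%g.
Let U2 : set (V * V) := [set z | [/\ cim c z.1, cim c z.2 & cdom c (s z.1 * s z.2)%g]].

Let ie : i e = e. Proof. by rewrite /i se invg1. Qed.

Let U2e v : cim c v -> U2 (v, e).
Proof. by move=> cv; split=> //=; rewrite se mulg1; exact: cdom_inv. Qed.

Let m_e v : cim c v -> m (v, e) = v.
Proof. by move=> cv; rewrite /m/= se mulg1 cmapK. Qed.

Let cvg_Vs : (fun v => (s v)^-1%g) @ e --> 1%g.
Proof.
have := @cvg_invg _ (nbhs e) (nbhs_filter e) _ _ cvg_cinv1.
by rewrite invg1.
Qed.

Let near_cdomV : \forall v \near e, cdom c (s v)^-1%g.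
Proof.
have h := cvg_Vs.
by apply: h; exact: chart_nbhs.
Qed.

Let dm z : U2 z -> differentiable m z.
Proof. by case=> h1 h2 h3; exact: (mul_diff cA cA cA). Qed.

Let dDm u z : U2 z -> differentiable ('D_u m) z.
Proof.
move=> Uz; have [_ /(_ u)[+ _]] := mul_smooth cA cA cA 2%N.
exact.
Qed.

Let di : differentiable i e.
Proof.
have : smooth_on [set v | cim c v /\ cdom c (s v)^-1%g] i.
  by case: GL => _ [_ _ _]; apply.
move=> /(_ 1%N)[+ _]; apply; split; first exact: ce.
by rewrite se invg1.
Qed.

(** In the chart, conjugation by [s v] reads [m (m (v, w), i v)]. The chain rule leaves first
    derivatives of [m], which are themselves differentiable because [m] is smooth. *)
Lemma Ad_chart y : \forall v \near e, Ad c (s v) y =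
  \sum_j 'D_(0, y) m (v, e) 0 j *: 'D_(delta_mx 0 j, 0) m (v, i v).
Proof.
near=> v.
have cv : cim c v by near: v; exact: cim_nbhs.
have cV : cdom c (s v)^-1%g by near: v; exact: near_cdomV.
have Ui : U2 (v, i v).
  by split=> //=; [exact: cim_map|rewrite /i cinvK// mulgV].
have h : \forall w \near e, m (m (v, w), i v) = conj_chart (s v) w.
  have h' : \forall w \near e, cdom c (s v * s w)%g.
    by have h := @cvg_mull (s v); apply: h; apply: (chart_nbhs cA); exact: cdom_inv.
  by apply: filterS h' => w h'; rewrite /conj_chart /m /i /= (cinvK cA h') (cinvK cA cV).
exact: (diff_slices y (m_e cv) (dm (U2e cv)) (dm Ui) h).
Unshelve. all: by end_near. Qed.

Lemma Ad_diff y : differentiable (fun v => Ad c (s v) y) e.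
Proof.
have h : differentiable (fun v => \sum_j 'D_(0, y) m (v, e) 0 j *: 'D_(delta_mx 0 j, 0) m (v, i v)) e.
  apply: (@differentiable_slices _ _ ('D_(0, y) m) (fun j => 'D_(delta_mx 0 j, 0) m)).
  - by apply: dDm; exact: U2e.
  - exact: di.
  - by move=> j; rewrite ie; apply: dDm; exact: U2e.
by apply: (near_eq_diff _ h).1; apply: filterS (Ad_chart y) => v ->.
Qed.

Variable br : V -> V -> V.
Hypothesis G_br : lie_algebra_is c br.

Lemma Ad_diffE y x : 'd (fun v => Ad c (s v) y) e x = br x y.
Proof.
have [_ h] := G_br x y.
have dl := is_derive_line e x (0 : R).
have dA : differentiable (fun v => Ad c (s v) y) (e + 0 *: x).
  by rewrite scale0r addr0; exact: Ad_diff.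
have := is_derive_diff_comp dA dl; rewrite scale0r addr0 => -[_].
by rewrite -h => ->.
Qed.

(** The chart gives continuity at 1; the homomorphism property carries it to any [g]. *)
Lemma Ad_continuous y : continuous (fun g => Ad c g y).
Proof.
have h1 : (fun g => Ad c g y) @ 1%g --> Ad c 1%g y.
  have hc := differentiable_continuous (Ad_diff y).
  have : (fun g => Ad c (s (c g)) y) @ 1%g --> Ad c (s e) y.
    exact: (@cvg_comp _ _ _ c (fun v => Ad c (s v) y) _ _ _ (cvg_cmap cA c1) hc).
  rewrite se; apply: cvg_trans; apply: near_eq_cvg.
  by apply: filterS (chart_nbhs cA c1) => g cg; rewrite cinvK.
move=> g.
have hg : (fun h : G => (g^-1 * h)%g) @ g --> 1%g.
  have := @cvg_mulg _ (nbhs g) (nbhs_filter g) (fun=> g^-1%g) id _ _ (cvg_cst _) (fun _ h => h).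
  by rewrite mulVg; apply.
have h2 := @cvg_comp _ _ _ _ (fun g => Ad c g y) _ _ _ hg h1.
have h3 := @cvg_comp _ _ _ _ (Ad c g) _ _ _ h2 (rV_lin_continuous (Ad_linear g) (x := _)).
move: h3; rewrite -Ad_mul mulg1; apply: cvg_trans; apply: near_eq_cvg.
by apply: nearW => h /=; rewrite -Ad_mul mulgA mulgV mul1g.
Qed.

Lemma is_derive_Ad gam x y (t : R) : one_parameter_subgroup c gam x ->
  is_derive t 1 (fun t => Ad c (gam t) y) (br x (Ad c (gam t) y)).
Proof.
move=> [gamD gamc gamd].
have gam0 : gam 0 = 1%g.
  by apply: (@mulgI _ (gam 0)); rewrite -gamD addr0 mulg1.
have h0 z : is_derive (0 : R) 1 (fun t => Ad c (gam t) z) (br x z).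
  have dA : differentiable (fun v => Ad c (s v) z) (c (gam 0)) by rewrite gam0; exact: Ad_diff.
  have := is_derive_diff_comp dA gamd; rewrite gam0 Ad_diffE.
  apply: near_eq_is_derive.
  have : \forall t \near (0 : R), cdom c (gam t).
    by apply: (gamc 0); rewrite gam0; exact: chart_nbhs.
  by apply: filterS => u cu /=; rewrite cinvK.
have -> : (fun t => Ad c (gam t) y) = (fun u => Ad c (gam (u - t)) (Ad c (gam t) y)).
  by apply/funext => u /=; rewrite -Ad_mul -gamD subrK.
exact: (@is_derive_translate _ _ (fun u => Ad c (gam u) (Ad c (gam t) y))).
Qed.

(** The error is proportional to the size of the second factor alone, so that the errors of repeated
    multiplication by one small element add up linearly. *)
Lemma mul_strict (eps : R) : 0 < eps -> exists2 d : R, 0 < d &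
  forall v w, `|v - e| < d -> `|w - e| < d ->
    [/\ cim c v, cim c w, cdom c (s v * s w)%g
      & `|c (s v * s w)%g - v - w + e| <= eps * `|w - e|].
Proof.
move=> eps0.
have oU : \forall z \near (e, e), U2 z.
  have h1 : \forall z \near (e, e), cim c z.1 /\ cim c z.2.
    by exists (cim c, cim c) => //=; split; exact: cim_nbhs.
  have h2 : \forall z \near (e, e), cdom c (s z.1 * s z.2)%g.
    have := @cvg_mulg (V * V) (nbhs (e, e)) (nbhs_filter (e, e)) (fun z => s z.1) (fun z => s z.2) 1%g 1%g.
    rewrite mulg1 => /(_ _ _ (cdom c)); apply; last exact: chart_nbhs.
      exact: (@cvg_comp _ _ _ fst s (nbhs (e, e)) (nbhs e) _ cvg_fst cvg_cinv1).
    exact: (@cvg_comp _ _ _ snd s (nbhs (e, e)) (nbhs e) _ cvg_snd cvg_cinv1).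
  apply: (@filterS2 _ _ (nbhs_filter (e, e)) _ _ _ _ h1 h2) => z [h3 h4] h5.
  by split.
have h : \forall z \near (e, e), `|m z - m (z.1, e) - (z.2 - e)| <= eps * `|z.2 - e|.
  apply: slicer_strict => //.
  - by apply: (@filterS _ _ (nbhs_filter (e, e)) _ _ _ oU) => z; exact: dm.
  - by move=> u; apply: differentiable_continuous; apply: dDm; exact: U2e.
  - by apply: filterS (cim_nbhs cA ce) => w cw; rewrite /m/= se mul1g cmapK.
have /nbhs_ballP[d d0 dP] := @filterI _ _ (nbhs_filter (e, e)) _ _ oU h.
exists d => // v w vd wd.
have [|[/= h1 h2 h3] h4] := dP (v, w).
  by split=> /=; rewrite -ball_normE /ball_ /= distrC.
split=> //; move: h4; rewrite /= m_e// => h4.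
by move: h4; rewrite opprB addrA [_ + e - w]addrAC.
Qed.

(** * Existence of one-parameter subgroups *)

Section OneParameter.
Variable x : V.
Local Notation M j := (j.+1%:R : R).
Let g (j : nat) : G := s (e + (M j)^-1 *: x).

Let step_small (d : R) : 0 < d -> \forall j \near \oo, `|x| / M j < d.
Proof.
move=> d0.
have h : (fun j => `|x| / M j) @ \oo --> (`|x| * 0 : R).
  by apply: cvgM; [exact: cvg_cst|exact: cvg_harmonic].
move/cvgrPdist_lt : h => /(_ _ d0); apply: filterS => j.
by rewrite mulr0 sub0r normrN ger0_norm// mulr_ge0// invr_ge0.
Qed.

Let step_norm j : `|(M j)^-1 *: x| = `|x| / M j.
Proof. by rewrite normrZ ger0_norm ?invr_ge0// mulrC. Qed.

(** Each of the [k] multiplications by [g j] adds [x / (j + 1)] with relative error [eps], provided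
    the power is still within [d] of [e]; the second smallness condition ensures this. *)
Let power_estimate (eps : R) : 0 < eps -> exists2 d : R, 0 < d &
  (forall v, `|v - e| < d -> cim c v) /\ forall j k, `|x| / M j < d -> (1 + eps) * (k%:R / M j * `|x|) < d ->
  cdom c (g j ^+ k)%g /\
  `|c (g j ^+ k)%g - e - (k%:R / M j) *: x| <= eps * (k%:R / M j * `|x|).
Proof.
move=> eps0; have [d d0 dP] := mul_strict eps0; exists d => //; split.
  by move=> v vd; have [] := dP v e vd; rewrite ?subrr ?normr0.
move=> j k jd.
elim: k => [|k IH] kd.
  by rewrite expg0 subrr mul0r scale0r subrr normr0 mul0r mulr0.
have q0 : 0 <= k%:R / M j * `|x| by rewrite mulr_ge0// divr_ge0.
have SE : k.+1%:R / M j * `|x| = k%:R / M j * `|x| + `|x| / M j.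
  by rewrite -natr1 mulrDl mulrDl mul1r [_^-1 * _]mulrC.
have x0 : 0 <= `|x| / M j by rewrite divr_ge0.
have {}/IH[IH1 IH2] : (1 + eps) * (k%:R / M j * `|x|) < d.
  by apply: le_lt_trans kd; rewrite ler_wpM2l ?SE ?lerDl// addr_ge0// ltW.
set v := c (g j ^+ k)%g in IH2.
have vd : `|v - e| < d.
  apply: le_lt_trans kd; rewrite SE -[v - e](subrK ((k%:R / M j) *: x)).
  apply: le_trans (ler_normD _ _) _; rewrite [`|_ *: x|]normrZ [`|k%:R / _|]ger0_norm ?divr_ge0//.
  apply: le_trans (lerD IH2 (lexx _)) _; move: q0 x0 (mulr_ge0 (ltW eps0) x0).
  by move: (k%:R / _ * _) (`|x| / _) => q p q0 p0 ep0; lra.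
have wd : `|(e + (M j)^-1 *: x) - e| < d by rewrite addrC addKr step_norm.
have [h1 h2 h3 h4] := dP _ _ vd wd.
have E : (g j ^+ k.+1)%g = (s v * s (e + (M j)^-1 *: x))%g by rewrite expgSr /v cinvK.
rewrite E; split=> //.
rewrite SE mulrDr -[k.+1%:R]natr1 mulrDl scalerDl mul1r.
have -> : c (s v * s (e + (M j)^-1 *: x))%g - e - (k%:R / M j *: x + (M j)^-1 *: x) =
  (v - e - (k%:R / M j) *: x) + (c (s v * s (e + (M j)^-1 *: x))%g - v - (e + (M j)^-1 *: x) + e).
  by apply/rowP => l; rewrite !mxE; ring.
apply: le_trans (ler_normD _ _) _; apply: lerD => //.
by apply: le_trans h4 _; rewrite addrC addKr step_norm.
Qed.

Variable U : set_system nat.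
Hypotheses (UU : UltraFilter U) (oU : \oo `<=` U).
Let idx (j : nat) (t : R) : nat := Num.truncn (t * M j).

Let idx_itv j t : 0 <= t -> (idx j t)%:R / M j <= t /\ t < (idx j t)%:R / M j + (M j)^-1.
Proof.
move=> t0; have := @truncn_itv R (t * M j); rewrite mulr_ge0// => /(_ isT)/andP[h1 h2].
split; first by rewrite ler_pdivrMr ?ltr0n.
by rewrite -[X in _ + X]mul1r -mulrDl natr1 ltr_pdivlMr ?ltr0n.
Qed.

(** For small times the powers stay in a compact ball inside the chart, hence converge along [U].
    The slack [eta] absorbs the difference between [t] and its grid point. *)
Let small_limit (eps : R) : 0 < eps -> exists2 d : R, 0 < d & forall t eta, 0 <= t -> 0 < eta ->
  (1 + eps) * (t * `|x|) + eta < d -> exists p : G,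
  [/\ (fun j => (g j ^+ idx j t)%g) @ U --> p, cdom c p
    & `|c p - e - t *: x| <= eps * (t * `|x|) + eta].
Proof.
move=> eps0; have [d d0 [dcim dP]] := power_estimate eps0; exists d => // t eta t0 eta0 td.
pose B := [set v : V | `|v - e - t *: x| <= eps * (t * `|x|) + eta].
have cB : compact B.
  apply: bounded_closed_compact.
    exists (eps * (t * `|x|) + eta + `|e + t *: x|); split; first exact: num_real.
    move=> r rlt v /= vB; apply/ltW; apply: le_lt_trans rlt.
    rewrite -[v](subrK (e + t *: x)); apply: le_trans (ler_normD _ _) _.
    by rewrite lerD2r opprD addrA.
  have -> : B = (fun v : V => `|v - e - t *: x|) @^-1` [set r : R | r <= eps * (t * `|x|) + eta] by [].
  apply: closed_comp; last exact: closed_le.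
  move=> v _; have h : (fun v : V => v - e - t *: x) @ nbhs v --> v - e - t *: x.
    by apply: (cvgB (F := nbhs v)); [apply: (cvgB (F := nbhs v))|]; try exact: cvg_cst; exact: cvg_id.
  exact: cvg_norm h.
have Bcim v : B v -> cim c v.
  move=> vB; apply: dcim; apply: le_lt_trans td; rewrite -[v - e](subrK (t *: x)).
  apply: le_trans (ler_normD _ _) _; rewrite normrZ ger0_norm// mulrDl mul1r.
  by rewrite -[leRHS]addrA [leRHS]addrC lerD2r.
have nearB : \forall j \near U, cdom c (g j ^+ idx j t)%g /\ B (c (g j ^+ idx j t)%g).
  apply: oU; have h1 := step_small d0; have h2 := step_small eta0.
  apply: filterS2 h1 h2 => j h1 h2; have [i1 i2] := idx_itv j t0.
  have [|h3 h4] := dP j (idx j t) h1.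
    apply: le_lt_trans td; rewrite -[leLHS]addr0; apply: lerD; last exact: ltW.
    by rewrite ler_wpM2l ?ler_wpM2r// addr_ge0// ltW.
  split=> //; rewrite /B /=.
  rewrite -[_ - t *: x]addr0 -(addNr ((idx j t)%:R / M j *: x)).
  rewrite [X in `|X|]addrACA.
  apply: le_trans (ler_normD _ _) _; apply: lerD.
    apply: le_trans h4 _; rewrite ler_wpM2l ?ler_wpM2r// ltW//.
  rewrite addrC -scalerBl normrZ; apply: le_trans (ltW h2); rewrite [leRHS]mulrC.
  rewrite ler_wpM2r// ler_norml; have : 0 <= (M j)^-1 by rewrite invr_ge0.
  move: i1 i2; move: ((idx j t)%:R / M j) ((M j)^-1) => q p i1 i2 p0.
  by apply/andP; split; lra.
have nB : \forall j \near U, B (c (g j ^+ idx j t)%g) by apply: filterS nearB => j [].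
have [v vB vU] := @ultra_compact_cvg _ _ U (fun j => c (g j ^+ idx j t)%g) _ UU cB nB.
exists (s v); split; last by rewrite cmapK//; exact: Bcim.
  have h := @cvg_comp _ _ _ _ s U (nbhs v) _ vU (cvg_cinv cA (Bcim _ vB)).
  apply: cvg_trans h; apply: near_eq_cvg; apply: filterS nearB => j [h _] /=.
  by rewrite cinvK.
exact: (cdom_inv cA (Bcim _ vB)).
Qed.

Let cvg_g : g @ U --> 1%g.
Proof.
have h : (fun j => e + (M j)^-1 *: x) @ \oo --> e + 0 *: x.
  apply: cvgD; first exact: cvg_cst.
  by apply: cvgZl; exact: cvg_harmonic.
rewrite scale0r addr0 in h.
have h' := @cvg_comp _ _ _ _ s _ _ _ h cvg_cinv1.
by move=> P /h'; exact: oU.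
Qed.

Let cvg_exp (p : G) (f : nat -> G) (k : nat) : f @ U --> p -> (fun j => (f j ^+ k)%g) @ U --> (p ^+ k)%g.
Proof.
move=> fp; elim: k => [|k IH]; first by rewrite expg0; exact: cvg_cst.
rewrite expgSr; under eq_fun do rewrite expgSr.
exact: cvg_mulg.
Qed.

Let cvg_small (N : nat) (r : nat -> nat) : (forall j, (r j < N)%N) ->
  (fun j => (g j ^+ r j)%g) @ U --> 1%g.
Proof.
move=> rN P P1.
have : \forall j \near U, forall k : 'I_N, P (g j ^+ k)%g.
  apply: filter_forall => k; have := @cvg_exp 1%g g k cvg_g; rewrite expg1n => h; exact: (h _ P1).
by apply: filterS => j /(_ (Ordinal (rN j))).
Qed.

Let ex_limit t : 0 <= t -> exists p : G, (fun j => (g j ^+ idx j t)%g) @ U --> p.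
Proof.
move=> t0; have [d d0 dP] := small_limit ltr01.
have d20 : 0 < d / 2 by rewrite divr_gt0.
(* [N] makes [t / N] short enough for the limit in the chart. The index of [t] is [N] times that of
   [t / N] plus a remainder below [N], and a bounded number of factors [g j] tends to 1. *)
pose N := (Num.truncn (2 * (t * `|x|) / (d / 2))).+1.
have Nlt : 2 * (t * `|x|) / (d / 2) < N%:R by exact: truncnS_gt.
have N0 : 0 < N%:R :> R by rewrite ltr0n.
have [|||p [pU _ _]] := dP (t / N%:R) (d / 2) _ _ _ => //.
- by rewrite divr_ge0// ltW.
- rewrite [ltRHS]splitr ltrD2r mulrAC mulrA ltr_pdivrMr//.
  by rewrite [ltRHS]mulrC -ltr_pdivrMr.
have E j : idx j (t / N%:R) = (idx j t %/ N)%N.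
  have [i1 i2] := idx_itv j t0; apply: truncn_def.
  have M0 : 0 < M j by rewrite ltr0n.
  move: i1; rewrite ler_pdivrMr// => i1.
  move: i2; rewrite -[X in _ + X]mul1r -mulrDl natr1 ltr_pdivlMr// => i2.
  rewrite mulrAC; apply/andP; split.
    rewrite ler_pdivlMr//; apply: le_trans i1; rewrite -natrM ler_nat.
    exact: leq_trunc_div.
  rewrite ltr_pdivrMr//; apply: lt_le_trans i2 _; rewrite -natrM ler_nat.
  by rewrite ltn_ceil.
exists (p ^+ N * 1)%g.
have -> : (fun j => (g j ^+ idx j t)%g) =
    (fun j => ((g j ^+ (idx j t %/ N)) ^+ N * g j ^+ (idx j t %% N))%g).
  by apply/funext => j; rewrite -expgnA -expgnDr -divn_eq.
apply: cvg_mulg.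
  by apply: cvg_exp; under eq_fun do rewrite -E.
by apply: (@cvg_small N) => j; rewrite ltn_pmod.
Qed.

(* Limit of s(e + x/(j+1))^floor(t(j+1)) along the ultrafilter [U]. *)
Let Gam t : G := xget 1%g [set p | (fun j => (g j ^+ idx j t)%g) @ U --> p].

Let GamP t : 0 <= t -> (fun j => (g j ^+ idx j t)%g) @ U --> Gam t.
Proof. by move=> /ex_limit[p pP]; rewrite /Gam; case: xgetP => [q _ //|/(_ p)]. Qed.

Let lim_uniq (f : nat -> G) (p q : G) : f @ U --> p -> f @ U --> q -> p = q.
Proof. by move=> fp fq; apply: (cvg_unique lie_hausdorff fp fq). Qed.

(** The floor of a sum exceeds the sum of the floors by 0 or 1, and one factor [g j] disappears in
    the limit. *)
Let GamD t u : 0 <= t -> 0 <= u -> Gam (t + u) = (Gam t * Gam u)%g.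
Proof.
move=> t0 u0; pose r j := (idx j (t + u) - (idx j t + idx j u))%N.
have rE j : (idx j t + idx j u <= idx j (t + u))%N /\ (r j < 2)%N.
  have M0 : 0 < M j by rewrite ltr0n.
  have I v : 0 <= v -> (idx j v)%:R <= v * M j /\ v * M j < (idx j v).+1%:R.
    by move=> v0; have := @truncn_itv R (v * M j); rewrite mulr_ge0// => /(_ isT)/andP[].
  have [a1 a2] := I _ t0; have [b1 b2] := I _ u0; have [c1' c2] := I _ (addr_ge0 t0 u0).
  have h1 : (idx j t + idx j u < (idx j (t + u)).+1)%N.
    by rewrite -(ltr_nat R) natrD; rewrite mulrDl in c2; apply: le_lt_trans c2; exact: lerD.
  split=> //; rewrite /r ltn_subLR// -(ltr_nat R) !natrD.
  by rewrite mulrDl in c1'; move: a2 b2; rewrite -!natr1; lra.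
apply: (@lim_uniq (fun j => (g j ^+ idx j (t + u))%g)); first by apply: GamP; exact: addr_ge0.
have -> : (fun j => (g j ^+ idx j (t + u))%g) =
    (fun j => (g j ^+ idx j t * g j ^+ idx j u * g j ^+ r j)%g).
  by apply/funext => j; rewrite -!expgnDr /r subnKC//; case: (rE j).
rewrite -[X in _ --> X]mulg1; apply: cvg_mulg; first by apply: cvg_mulg; exact: GamP.
by apply: (@cvg_small 2) => j; case: (rE j).
Qed.

Let Gam0 : Gam 0 = 1%g.
Proof. by apply: (@mulgI _ (Gam 0)); rewrite -GamD// addr0 mulg1. Qed.

Let Gam_chart (eps : R) : 0 < eps -> exists2 d : R, 0 < d & forall t, 0 <= t -> t < d ->
  cdom c (Gam t) /\ `|c (Gam t) - e - t *: x| <= eps * (t * `|x|).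
Proof.
move=> eps0; have [d d0 dP] := small_limit eps0.
pose D := (1 + eps) * (1 + `|x|).
have D0 : 0 < D by rewrite mulr_gt0// ltr_pwDl// ltW.
exists (d / D); first by rewrite divr_gt0.
move=> t t0; rewrite ltr_pdivlMr// => td.
have h0 : (1 + eps) * (t * `|x|) < d.
  apply: le_lt_trans td; rewrite mulrCA ler_wpM2l// /D ler_wpM2l//.
    by rewrite addr_ge0// ltW.
  by rewrite lerDr.
have h eta : 0 < eta -> (1 + eps) * (t * `|x|) + eta < d ->
    cdom c (Gam t) /\ `|c (Gam t) - e - t *: x| <= eps * (t * `|x|) + eta.
  move=> eta0 /(dP _ _ t0 eta0)[p [pU cp pe]].
  by rewrite (lim_uniq (GamP t0) pU).
pose eta0 := (d - (1 + eps) * (t * `|x|)) / 2.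
have eta00 : 0 < eta0 by rewrite divr_gt0// subr_gt0.
have eta0d : (1 + eps) * (t * `|x|) + eta0 < d by rewrite /eta0; lra.
split; first by have [] := h _ eta00 eta0d.
apply/ler_addgt0Pr => eta eta_gt0.
pose eta' := Num.min eta eta0.
have e1 : eta' <= eta by rewrite /eta' ge_min lexx.
have e2 : eta' <= eta0 by rewrite /eta' ge_min lexx orbT.
have e3 : 0 < eta' by rewrite /eta' lt_min eta_gt0.
have [|_ h2] := h _ e3; first by apply: le_lt_trans eta0d; rewrite lerD2l.
by apply: le_trans h2 _; rewrite lerD2l.
Qed.

Let gamma (t : R) : G := (Gam (Num.max t 0) * (Gam (Num.max (- t) 0))^-1)%g.

Let gammaE a b : 0 <= a -> 0 <= b -> gamma (a - b) = (Gam a * (Gam b)^-1)%g.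
Proof.
move=> a0 b0; rewrite /gamma; set p := Num.max _ _; set q := Num.max _ _.
have p0 : 0 <= p by rewrite /p le_max lexx orbT.
have q0 : 0 <= q by rewrite /q le_max lexx orbT.
have E : p + b = a + q.
  rewrite /p /q; have [h|h] := ltP (a - b) 0; have [h'|h'] := ltP (- (a - b)) 0; lra.
have E2 : (Gam p * Gam b)%g = (Gam q * Gam a)%g by rewrite -!GamD// E addrC.
have cm u v : 0 <= u -> 0 <= v -> (Gam u * Gam v)%g = (Gam v * Gam u)%g.
  by move=> u0 v0; rewrite -!GamD// addrC.
have cmV u v : 0 <= u -> 0 <= v -> ((Gam u)^-1 * Gam v)%g = (Gam v * (Gam u)^-1)%g.
  move=> u0 v0; apply: (mulgI (Gam u)); rewrite mulgA mulgV mul1g mulgA cm//.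
  by rewrite -mulgA mulgV mulg1.
apply: (mulIg (Gam b)); rewrite -[in RHS]mulgA mulVg mulg1 -mulgA cmV// mulgA E2.
by rewrite cm// -mulgA mulgV mulg1.
Qed.

Let gamma_pos t : 0 <= t -> gamma t = Gam t.
Proof. by move=> t0; rewrite -[t in LHS]subr0 gammaE// Gam0 invg1 mulg1. Qed.

Let gammaD t u : gamma (t + u) = (gamma t * gamma u)%g.
Proof.
have p0 (v : R) : 0 <= Num.max v 0 by rewrite le_max lexx orbT.
have E (v : R) : v = Num.max v 0 - Num.max (- v) 0.
  by have [h|h] := ltP v 0; have [h'|h'] := ltP (- v) 0; lra.
rewrite {1}(E t) {1}(E u).
have -> (a b a' b' : R) : a - b + (a' - b') = (a + a') - (b' + b) by lra.
rewrite gammaE ?addr_ge0// !GamD// invgM.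
set p := Gam (Num.max t 0); set p' := Gam (Num.max u 0).
rewrite /gamma -/p -/p' -!mulgA; congr (_ * _)%g; rewrite !mulgA; congr (_ * _)%g.
apply: (mulgI (Gam (Num.max (- t) 0))); rewrite !mulgA mulgV mul1g -GamD// addrC GamD//.
by rewrite -!mulgA mulgV mulg1.
Qed.

Let Gam_cvg : (fun t => Gam (Num.max t 0)) @ (0 : R) --> 1%g.
Proof.
have [d d0 dP] := Gam_chart ltr01.
have dP' t : `|t| < d -> cdom c (Gam (Num.max t 0)) /\
    `|c (Gam (Num.max t 0)) - e| <= 2 * `|x| * `|t|.
  move=> td; have m0 : 0 <= Num.max t 0 by rewrite le_max lexx orbT.
  have mt : Num.max t 0 <= `|t| by rewrite ge_max ler_norm normr_ge0.
  have [h1 h2] := dP _ m0 (le_lt_trans mt td); split=> //.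
  rewrite -[_ - e](subrK (Num.max t 0 *: x)).
  apply: le_trans (ler_normD _ _) _; apply: le_trans (lerD h2 (lexx _)) _.
  rewrite normrZ ger0_norm// mul1r.
  have : Num.max t 0 * `|x| <= `|t| * `|x| by rewrite ler_wpM2r.
  by move: (Num.max t 0 * _) => q; lra.
have n0 : \forall t \near (0 : R), `|t| < d.
  by apply/nbhs_ballP; exists d => //= t; rewrite -ball_normE /ball_ /= sub0r normrN.
have h : (fun t => c (Gam (Num.max t 0))) @ (0 : R) --> e.
  have hb : (fun t : R => 2 * `|x| * `|t|) @ (0 : R) --> (0 : R).
    have : (fun t : R => 2 * `|x| * `|t|) @ (0 : R) --> 2 * `|x| * `|0 : R|.
      by apply: cvgM; [exact: cvg_cst|exact: norm_continuous].
    by rewrite normr0 mulr0.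
  apply/cvgrPdist_lt => eps eps0; move/cvgrPdist_lt : hb => /(_ _ eps0) hb.
  apply: filterS2 n0 hb => t /dP'[_ h1]; rewrite sub0r normrN => h2.
  rewrite distrC; apply: le_lt_trans h1 _; apply: le_lt_trans h2; exact: ler_norm.
have h' := @cvg_comp _ _ _ _ s _ _ _ h cvg_cinv1.
apply: cvg_trans h'; apply: near_eq_cvg; apply: filterS n0 => t /dP'[h1 _] /=.
by rewrite cinvK.
Qed.

Let gamma_cvg0 : gamma @ (0 : R) --> 1%g.
Proof.
have h1 : (fun t => Gam (Num.max (- t) 0)) @ (0 : R) --> 1%g.
  have hN : (fun t : R => - t) @ (0 : R) --> (0 : R).
    by rewrite -[X in _ --> X]oppr0; apply: cvgN; exact: cvg_id.
  exact: (@cvg_comp _ _ _ _ (fun t => Gam (Num.max t 0)) _ _ _ hN Gam_cvg).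
have := @cvg_mulg _ (nbhs (0 : R)) (nbhs_filter (0 : R)) _ _ _ _ Gam_cvg
  (@cvg_invg _ (nbhs (0 : R)) (nbhs_filter (0 : R)) _ _ h1).
by rewrite invg1 mulg1.
Qed.

Let gamma_continuous : continuous gamma.
Proof.
move=> t.
have hN : (fun u : R => u - t) @ t --> (0 : R).
  by rewrite -[X in _ --> X](subrr t); apply: cvgB; [exact: cvg_id|exact: cvg_cst].
have h := @cvg_comp _ _ _ _ gamma _ _ _ hN gamma_cvg0.
have := @cvg_mulg _ (nbhs t) (nbhs_filter t) (fun=> gamma t) _ _ _ (cvg_cst _) h.
move=> /(_ _); rewrite mulg1; apply: cvg_trans; apply: near_eq_cvg; apply: nearW => u /=.
by rewrite -gammaD addrC subrK.
Qed.

Let gamma_derive : is_derive (0 : R) 1 (fun t => c (gamma t)) x.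
Proof.
have gamma0 : gamma 0 = 1%g by rewrite gamma_pos.
have est (eps : R) : 0 < eps -> eps <= 1 / 2 ->
    \forall t \near (0 : R), `|c (gamma t) - e - t *: x| <= 4 * eps * `|x| * `|t|.
  move=> eps0 eps1; have [d d0 dP] := Gam_chart eps0; have [d' d'0 dP'] := mul_strict eps0.
  have n0 : \forall t \near (0 : R), `|t| < d.
    by apply/nbhs_ballP; exists d => //= t; rewrite -ball_normE /ball_ /= sub0r normrN.
  have nc : \forall t \near (0 : R), cdom c (gamma t) /\ `|c (gamma t) - e| < d'.
    apply: filterI; first by apply: gamma_cvg0; exact: chart_nbhs.
    have h := @cvg_comp _ _ _ _ c _ _ _ gamma_cvg0 (cvg_cmap cA c1).
    by move/cvgrPdist_lt : h => /(_ _ d'0); apply: filterS => t; rewrite distrC.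
  have ncN : \forall t \near (0 : R), cdom c (gamma (- t)) /\ `|c (gamma (- t)) - e| < d'.
    have hN : (fun t : R => - t) @ (0 : R) --> (0 : R).
      by rewrite -[X in _ --> X]oppr0; apply: cvgN; exact: cvg_id.
    exact: (hN _ nc).
  near=> t.
  have td : `|t| < d by near: t.
  have [h1 h2] : cdom c (gamma t) /\ `|c (gamma t) - e| < d' by near: t.
  have [h3 h4] : cdom c (gamma (- t)) /\ `|c (gamma (- t)) - e| < d' by near: t.
  have [t0|t0] := leP 0 t.
    have [_ h] := dP t t0 (le_lt_trans (ler_norm t) td).
    rewrite gamma_pos// ger0_norm//; apply: le_trans h _.
    have : 0 <= t * `|x| by rewrite mulr_ge0.
    by rewrite -!mulrA [`|x| * t]mulrC; move: (t * _) => z z0; nra.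
  (* The estimate at negative [t] is drawn from the one at [- t] through
     [gamma (- t) * gamma t = 1], since multiplication is nearly addition. The bound [eps <= 1 / 2]
     allows [|w - e|] to be absorbed. *)
  have Nt0 : 0 <= - t by rewrite oppr_ge0 ltW.
  have [|_ h] := dP (- t) Nt0; first by rewrite -normrN ger0_norm in td.
  rewrite -gamma_pos// in h.
  have [_ _ _] := dP' _ _ h4 h2; rewrite !cinvK//.
  rewrite -gammaD addNr gamma0 => h5.
  have N1 : `|t| = - t by rewrite ltr0_norm.
  rewrite N1; set v := c (gamma (- t)) in h h4 h5; set w := c (gamma t) in h1 h2 h5 *.
  have q0 : 0 <= - t * `|x| by rewrite mulr_ge0.
  have A1 : `|w - e - t *: x| <= eps * `|w - e| + eps * (- t * `|x|).
    have -> : w - e - t *: x = - (e - v - w + e) - (v - e - - t *: x).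
      by apply/rowP => l; rewrite !mxE; ring.
    apply: le_trans (ler_normB _ _) _; rewrite normrN; exact: lerD.
  have A2 : `|w - e| <= `|w - e - t *: x| + - t * `|x|.
    rewrite -[in leLHS](subrK (t *: x) (w - e)); apply: le_trans (ler_normD _ _) _.
    by rewrite normrZ N1.
  have -> : 4 * eps * `|x| * - t = 4 * eps * (- t * `|x|) by ring.
  have n1 : 0 <= `|w - e| by []. have n2 : 0 <= `|w - e - t *: x| by [].
  move: A1 A2 q0 n1 n2; move: (`|w - e - _|) (`|w - e|) (- t * _) => P W q A1 A2 q0 n1 n2.
  have : eps * W <= 1 / 2 * W by rewrite ler_wpM2r.
  have : eps * q <= 1 / 2 * q by rewrite ler_wpM2r.
  move=> e1 e2; have W3 : W <= 3 * q by lra.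
  have : eps * W <= eps * (3 * q) by rewrite ler_wpM2l// ltW.
  by lra.
have L : (fun h : R => h^-1 *: (((fun t => c (gamma t)) \o shift 0) (h *: 1) - c (gamma 0))) @ 0^' --> x.
  apply/cvgrPdist_le => eta eta0; rewrite gamma0.
  pose eps := Num.min (1 / 2) (eta / (4 * (1 + `|x|))).
  have D0 : 0 < 4 * (1 + `|x|) by rewrite mulr_gt0// ltr_pwDl.
  have eps0 : 0 < eps by rewrite /eps lt_min divr_gt0//= divr_gt0.
  have eps1 : eps <= 1 / 2 by rewrite /eps ge_min lexx.
  have eps2 : eps * (4 * (1 + `|x|)) <= eta.
    by rewrite -ler_pdivlMr// /eps ge_min lexx orbT.
  have := est _ eps0 eps1 => h0.
  near=> h.
  have hn0 : h != 0 by near: h; exact: nbhs_dnbhs_neq.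
  have hE : `|c (gamma h) - e - h *: x| <= 4 * eps * `|x| * `|h|.
    by near: h; exact: (nbhs_dnbhs h0).
  rewrite /= addr0 [h *: 1]mulr1 distrC.
  have -> : h^-1 *: (c (gamma h) - e) - x = h^-1 *: (c (gamma h) - e - h *: x).
    by rewrite [RHS]scalerBr scalerA mulVf// scale1r.
  rewrite normrZ normfV mulrC ler_pdivrMr ?normr_gt0//; apply: le_trans hE _.
  rewrite ler_wpM2r//; apply: le_trans eps2.
  by have : 0 <= `|x| by []; nra.
by split; [apply/cvg_ex; exists x|apply: cvg_lim].
Unshelve. all: by end_near. Qed.

Lemma one_parameter_limit : exists gam, one_parameter_subgroup c gam x.
Proof. by exists gamma. Qed.

End OneParameter.

(** Every direction of [k] is thereby the velocity of a curve in [K], as the variations over [K]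
    require. *)
Lemma ex_one_parameter x : exists gam, one_parameter_subgroup c gam x.
Proof.
have [U [UU sU]] := ultraFilterLemma (eventually_filter : ProperFilter \oo).
exact: one_parameter_limit UU sU.
Qed.

End AtOne.
End LieGroupCharts.

(** * Uniqueness for linear differential equations *)

Section LinearODE.
Variable R : realType.

Lemma is_derive_bigsum (W : normedModType R) (I : Type) (r : seq I) (P : pred I)
    (F : I -> R -> W) (dF : I -> W) (t : R) :
  (forall i, is_derive t 1 (F i) (dF i)) ->
  is_derive t 1 (fun u => \sum_(i <- r | P i) F i u) (\sum_(i <- r | P i) dF i).
Proof.
move=> h; elim: r => [|i r IH].
  rewrite big_nil (_ : (fun _ => _) = cst 0); first exact: is_derive_cst.
  by apply/funext => u; rewrite big_nil.
rewrite big_cons; case: ifP => Pi.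
  rewrite (_ : (fun _ => _) = F i + (fun u => \sum_(j <- r | P j) F j u)); first exact: is_deriveD.
  by apply/funext => u; rewrite big_cons Pi.
rewrite (_ : (fun _ => _) = (fun u => \sum_(j <- r | P j) F j u)); first exact: IH.
by apply/funext => u; rewrite big_cons Pi.
Qed.

Lemma is_derive_bigprod (I : eqType) (r : seq I) (F : I -> R -> R) (dF : I -> R) (t : R) :
  uniq r -> (forall i, is_derive t 1 (F i) (dF i)) ->
  is_derive t 1 (fun u => \prod_(i <- r) F i u)
    (\sum_(i <- r) \prod_(j <- r) (if j == i then dF j else F j t)).
Proof.
move=> + h; elim: r => [_|k r IH /= /andP[kr ur]].
  rewrite big_nil (_ : (fun _ => _) = cst 1); first exact: is_derive_cst.
  by apply/funext => u; rewrite big_nil.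
rewrite (_ : (fun _ => _) = F k * (fun u => \prod_(i <- r) F i u)); last first.
  by apply/funext => u; rewrite big_cons.
rewrite big_cons; apply: is_derive_eq; first by apply: is_deriveM; exact: IH.
rewrite big_cons eqxx addrC; congr (_ + _).
  rewrite mulrC [LHS]/GRing.scale /=; congr (_ * _).
  by apply: eq_big_seq => j jr; case: eqP => // jk; rewrite -jk jr in kr.
rewrite [LHS]/GRing.scale /= mulr_sumr; apply: eq_big_seq => i ir; rewrite big_cons.
by case: eqP => // ki; rewrite ki ir in kr.
Qed.

(** Gronwall for the sum of squares: [N' <= C N], so [N] times [expR (- C * t)] does not increase
    from its value 0. Through this uniqueness, identities valid at time 0 propagate along
    one-parameter subgroups. *)
Lemma linear_ode_zero (I : finType) (y : I -> R -> R) (Z : I -> I -> R) :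
  (forall i (t : R), is_derive t 1 (y i) (\sum_j Z i j * y j t)) ->
  (forall i, y i 0 = 0) -> forall i (t : R), 0 <= t -> y i t = 0.
Proof.
move=> dy y0 i t t0.
pose N (t : R) := \sum_i y i t ^+ 2.
pose C := \sum_i \sum_j 2 * `|Z i j|.
pose N' (t : R) := \sum_i 2 * y i t * \sum_j Z i j * y j t.
have dN (u : R) : is_derive u 1 N (N' u).
  apply: is_derive_bigsum => k.
  have -> : (fun u => y k u ^+ 2) = y k * y k by apply/funext => v; rewrite expr2.
  have h := is_deriveM (dy k u) (dy k u); apply: is_derive_eq.
  by rewrite -[LHS]/(y k u * _ + y k u * _); ring.
have NC (u : R) : N' u <= C * N u.
  rewrite /N' /C mulr_suml; apply: ler_sum => k _; rewrite mulr_sumr mulr_suml.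
  apply: ler_sum => l _.
  have h1 : y k u ^+ 2 <= N u.
    by rewrite /N (bigD1 k)//= lerDl sumr_ge0// => ? _; exact: sqr_ge0.
  have h2 : y l u ^+ 2 <= N u.
    by rewrite /N (bigD1 l)//= lerDl sumr_ge0// => ? _; exact: sqr_ge0.
  apply: (@le_trans _ _ (`|Z k l| * (y k u ^+ 2 + y l u ^+ 2))).
    have := ler_norm (Z k l); have := ler_norm (- Z k l); rewrite normrN.
    have := sqr_ge0 (y k u - y l u); have := sqr_ge0 (y k u + y l u).
    by move: (`|Z k l|) (Z k l) (y k u) (y l u) => a b p q; nra.
  by rewrite [2 * _]mulrC -mulrA ler_wpM2l//; lra.
pose E (u : R) := N u * expR (- C * u).
have dE (u : R) : is_derive u 1 E ((N' u - C * N u) * expR (- C * u)).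
  have d1 : is_derive u 1 (fun u : R => - C * u) (- C).
    have := is_deriveZ (- C) (is_derive_id u (1 : R)).
    by rewrite [X in is_derive _ _ _ X]/GRing.scale /= mulr1.
  have d2 : is_derive u 1 (fun u : R => expR (- C * u)) (expR (- C * u) * - C).
    have := @is_derive1_comp R expR (fun u : R => - C * u) u _ _ (is_derive_expR _) d1.
    exact.
  have h := is_deriveM (dN u) d2; apply: is_derive_eq.
  by rewrite -[LHS]/(N u * (expR (- C * u) * - C) + expR (- C * u) * N' u); ring.
have E0 : E 0 = 0 by rewrite /E /N big1 ?mul0r// => k _; rewrite y0 expr0n.
have Et : E t <= 0.
  have [||c c01 cE] := @MVT_segment R E (fun u => (N' u - C * N u) * expR (- C * u)) 0 t.
  - by [].
  - by apply: derivable_within_continuous => u _; have [] := dE u.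
  move: cE; rewrite E0 !subr0 => ->; apply: mulr_le0_ge0 => //.
  by apply: mulr_le0_ge0; rewrite ?subr_le0// expR_ge0.
have Nt : N t <= 0 by rewrite -(pmulr_lle0 _ (expR_gt0 (- C * t))).
have : y i t ^+ 2 <= 0.
  apply: le_trans Nt; rewrite /N (bigD1 i)//= lerDl sumr_ge0// => ? _; exact: sqr_ge0.
by move=> h; apply/eqP; rewrite -sqrf_eq0 eq_le h sqr_ge0.
Qed.

End LinearODE.

(** * Exterior powers through minors *)

Section Minors.
Variables (R : realType) (n d : nat).
Local Notation I := {ffun 'I_d -> 'I_n}.
Local Notation T := {ffun I -> R^o}.
Implicit Types (X Y : 'M[R]_n) (W : 'M[R]_(n, d)) (t : T) (f : I).

Let scaleE (k : R) (x : R^o) : k *: x = k * x. Proof. by []. Qed.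

Definition upd f (i : 'I_d) (l : 'I_n) : I := [ffun j => if j == i then l else f j].

Definition minors W : T := [ffun f : I => \det (rowsub f W)].

Definition slot (i : 'I_d) X t : T := [ffun f : I => \sum_l X (f i) l * t (upd f i l)].

(* The derivation action of a matrix on d-fold tensors. *)
Definition star X t : T := \sum_i slot i X t.

Lemma starE X t f : star X t f = \sum_i \sum_l X (f i) l * t (upd f i l).
Proof. by rewrite /star sum_ffunE; apply: eq_bigr => i _; rewrite ffunE. Qed.

Lemma slot_linear i X : linear (slot i X).
Proof.
move=> k t t'; apply/ffunP => f; rewrite !ffunE scaleE mulr_sumr -big_split/=.
by apply: eq_bigr => l _; rewrite !ffunE scaleE mulrDr mulrCA.
Qed.

Lemma star_linear X : linear (star X).
Proof.
move=> k t t'; rewrite /star scaler_sumr -big_split/=.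
by apply: eq_bigr => i _; rewrite slot_linear.
Qed.

HB.instance Definition _ i X := GRing.isLinear.Build R T T _ (slot i X) (slot_linear i X).
HB.instance Definition _ X := GRing.isLinear.Build R T T _ (star X) (star_linear X).

Lemma star_lincomb (J : finType) (k : J -> R) (X : J -> 'M[R]_n) t :
  star (\sum_j k j *: X j) t = \sum_j k j *: star (X j) t.
Proof.
apply/ffunP => f; rewrite starE sum_ffunE.
under eq_bigr => i _ do (under eq_bigr => l _ do rewrite summxE mulr_suml; rewrite exchange_big/=).
rewrite exchange_big/=; apply: eq_bigr => j _; rewrite !ffunE starE scaleE mulr_sumr.
apply: eq_bigr => i _; rewrite mulr_sumr; apply: eq_bigr => l _.
by rewrite !mxE mulrA.
Qed.

Lemma slot_comm i i' X Y t : i != i' -> slot i X (slot i' Y t) = slot i' Y (slot i X t).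
Proof.
move=> ii'; apply/ffunP => f; rewrite !ffunE.
under eq_bigr => l _ do rewrite ffunE mulr_sumr.
under [RHS]eq_bigr => l _ do rewrite ffunE mulr_sumr.
rewrite exchange_big/=; apply: eq_bigr => l _; apply: eq_bigr => l' _.
rewrite !ffunE (negbTE ii') eq_sym (negbTE ii') mulrCA; congr (_ * (_ * t _)).
apply/ffunP => j; rewrite !ffunE; case: eqP => // ->.
by rewrite eq_sym (negbTE ii').
Qed.

Lemma slotM i X Y t : slot i X (slot i Y t) = slot i (X *m Y) t.
Proof.
apply/ffunP => f; rewrite !ffunE.
under eq_bigr => l _ do rewrite ffunE mulr_sumr.
rewrite exchange_big/=; apply: eq_bigr => l' _; rewrite mxE mulr_suml.
apply: eq_bigr => l _; rewrite ffunE eqxx mulrA; congr (_ * t _).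
by apply/ffunP => j; rewrite !ffunE; case: eqP.
Qed.

(** Operators in different slots commute and their contributions cancel; only products within one
    slot remain. *)
Lemma star_bracket X Y t : star X (star Y t) = star Y (star X t) + star (X *m Y - Y *m X) t.
Proof.
have E X' Y' : star X' (star Y' t) = \sum_i slot i (X' *m Y') t +
    \sum_i \sum_(j | j != i) slot i X' (slot j Y' t).
  rewrite -big_split/=; apply: eq_bigr => i _.
  by rewrite /star linear_sum (bigD1 i)//= slotM.
have cross : \sum_i \sum_(j | j != i) slot i X (slot j Y t) =
    \sum_i \sum_(j | j != i) slot i Y (slot j X t).
  rewrite (exchange_big_dep xpredT)//=; apply: eq_bigr => i _.
  by apply: eq_big => [j|j ji]; [rewrite eq_sym|rewrite slot_comm// eq_sym].
rewrite !E cross -addrA [X in _ = _ + X]addrC addrA; congr (_ + _); rewrite /star.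
rewrite -big_split/=; apply: eq_bigr => i _; apply/ffunP => f.
rewrite !ffunE -big_split/=; apply: eq_bigr => l _; rewrite !mxE -mulrDl.
by rewrite addrCA subrr addr0.
Qed.

Lemma det_row_upd (A : 'M[R]_d) i (u : 'I_d -> R) :
  \det (\matrix_(a, b) (if a == i then u b else A a b)) = \sum_b u b * cofactor A i b.
Proof.
rewrite (expand_det_row _ i); apply: eq_bigr => b _; rewrite mxE eqxx; congr (_ * _).
rewrite /cofactor; congr (_ * \det _); apply/matrixP => x y; rewrite !mxE.
by rewrite eq_sym (negbTE (neq_lift _ _)).
Qed.

Lemma star_minors X W f : star X (minors W) f =
  \sum_i \det (\matrix_(a, b) (if a == i then (X *m W) (f a) b else W (f a) b)).
Proof.
rewrite starE; apply: eq_bigr => i _.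
have -> : (\matrix_(a, b) (if a == i then (X *m W) (f a) b else W (f a) b)) =
    \matrix_(a, b) (if a == i then (X *m W) (f i) b else rowsub f W a b).
  by apply/matrixP => a b; rewrite !mxE; case: eqP => // ->.
rewrite det_row_upd.
under eq_bigr => l _.
  rewrite ffunE.
  have -> : rowsub (upd f i l) W = \matrix_(a, b) (if a == i then W l b else rowsub f W a b).
    by apply/matrixP => a b; rewrite !mxE !ffunE; case: eqP.
  rewrite det_row_upd mulr_sumr; over.
rewrite exchange_big/=; apply: eq_bigr => b _; rewrite mxE mulr_suml.
by apply: eq_bigr => l _; rewrite mulrA.
Qed.

(** [X] acts on the span of the columns by [Y], hence on their wedge by the trace. In coordinates,
    expanding along the one replaced row turns the sum into the trace of [A Y adj A]. *)
Lemma star_minors_stable X W (Y : 'M[R]_d) : X *m W = W *m Y ->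
  star X (minors W) = \tr Y *: minors W.
Proof.
move=> XW; apply/ffunP => f; rewrite star_minors !ffunE.
set A := rowsub f W.
have -> : \sum_i \det (\matrix_(a, b) (if a == i then (X *m W) (f a) b else W (f a) b)) =
    \tr (A *m Y *m \adj A).
  rewrite /mxtrace; apply: eq_bigr => i _.
  have -> : (\matrix_(a, b) (if a == i then (X *m W) (f a) b else W (f a) b)) =
      \matrix_(a, b) (if a == i then (A *m Y) i b else A a b).
    apply/matrixP => a b; rewrite XW !mxE; case: eqP => // ->.
    by apply: eq_bigr => j _; rewrite mxE.
  by rewrite det_row_upd [RHS]mxE; apply: eq_bigr => b _; congr (_ * _); rewrite mxE.
rewrite mxtrace_mulC mulmxA mul_adj_mx mul_scalar_mx mxtraceZ mulrC.
by rewrite scaleE.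
Qed.

Lemma is_derive_minors (W : R -> 'M[R]_(n, d)) X f (t : R) :
  (forall l a, is_derive t 1 (fun u => W u l a) ((X *m W t) l a)) ->
  is_derive t 1 (fun u => minors (W u) f) (star X (minors (W t)) f).
Proof.
move=> dW; rewrite star_minors.
have -> : (fun u => minors (W u) f) =
    (fun u => \sum_(s : {perm 'I_d}) (-1) ^+ s * \prod_i W u (f i) (s i)).
  apply/funext => u; rewrite ffunE; apply: eq_bigr => s _; congr (_ * _).
  by apply: eq_bigr => i _; rewrite mxE.
rewrite /determinant exchange_big/=; apply: is_derive_bigsum => s.
rewrite -mulr_sumr; have := @is_derive_bigprod R _ (index_enum 'I_d) (fun i u => W u (f i) (s i))
   (fun i => (X *m W t) (f i) (s i)) t (index_enum_uniq _) (fun i => dW _ _).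
move=> h; have {}h := is_deriveZ ((-1) ^+ s : R) h.
set D := (X in is_derive _ _ _ X).
suff -> : D = (-1) ^+ s *: \sum_i \prod_j (if j == i then (X *m W t) (f j) (s j) else W t (f j) (s j)).
  exact: h.
rewrite /D [RHS]scaleE; congr (_ * _); apply: eq_bigr => i _; apply: eq_bigr => j _.
by rewrite mxE; case: eqP.
Qed.

End Minors.

(** * Stable subspaces and curves inside them *)

Section StableSubspaces.
Variables (R : realType) (n : nat).

(** A stable subspace of least dimension cannot shrink when intersected with another one. It serves
    as the module generated by [v], without any words in the operators. *)
Lemma minimal_stable (T : vectType R) (v : T) (I : Type) (J : set I) (F : I -> 'End(T)) :
  exists U : {vspace T}, [/\ v \in U, forall i, J i -> forall t, t \in U -> F i t \in U
    & forall U' : {vspace T}, v \in U' -> (forall i, J i -> forall t, t \in U' -> F i t \in U') ->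
      (U <= U')%VS].
Proof.
pose st (U : {vspace T}) := v \in U /\ forall i, J i -> forall t, t \in U -> F i t \in U.
have ex : exists m, `[< exists U, st U /\ \dim U = m >].
  exists (\dim {:T}); apply/asboolP; exists {:T}%VS; split=> //.
  by split=> [|i _ t _]; exact: memvf.
case: (ex_minnP ex) => m /asboolP[U [[vU stU] dU]] min.
exists U; split=> // U' vU' stU'.
have st' : st (U :&: U')%VS.
  split; first by rewrite memv_cap vU.
  by move=> i Ji t; rewrite !memv_cap => /andP[/stU -> // /stU' ->].
have le : (m <= \dim (U :&: U'))%N by apply: min; apply/asboolP; exists (U :&: U')%VS.
have /eqP <- : (U :&: U' == U)%VS by rewrite eqEdim capvSl dU.
exact: capvSr.
Qed.

(** Let [E] remove the component in [U]. Stability gives [E (star X x) = E (star X (E x))], so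
    [E (minors (W t))] solves a linear equation of its own and vanishes at 0. *)
Lemma star_curve d (U : {vspace {ffun {ffun 'I_d -> 'I_n} -> R^o}}) (X : 'M[R]_n)
    (W : R -> 'M[R]_(n, d)) :
  (forall t, t \in U -> star X t \in U) ->
  (forall (t : R) l a, is_derive t 1 (fun u => W u l a) ((X *m W t) l a)) ->
  minors (W 0) \in U -> forall t : R, 0 <= t -> minors (W t) \in U.
Proof.
move=> stU dW W0 t t0.
pose T := {ffun {ffun 'I_d -> 'I_n} -> R^o}.
pose E (x : T) : T := x - projv U x.
have EL : linear E by move=> k x y; rewrite /E linearP scalerBr opprD addrACA.
pose EE : {linear T -> T} := HB.pack E (GRing.isLinear.Build _ _ _ _ E EL).
have E0 (x : T) : x \in U -> E x = 0 by move=> xU; rewrite /E projv_id// subrr.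
have EX (x : T) : EE (star X x) = EE (star X (EE x)).
  rewrite -[x in LHS](subrK (projv U x)) linearD linearD /=.
  by rewrite [E (star X (projv U x))]E0 ?addr0//; apply: stU; exact: memv_proj.
pose dl (g : {ffun 'I_d -> 'I_n}) : T := [ffun h => (h == g)%:R].
have dec (x : T) : x = \sum_g x g *: dl g.
  apply/ffunP => f; rewrite sum_ffunE (bigD1 f)//= !ffunE eqxx big1 ?addr0.
    by rewrite -[RHS]/(x f * 1) mulr1.
  by move=> g gf; rewrite !ffunE eq_sym (negbTE gf) -[LHS]/(x g * 0) mulr0.
have expand (F : {linear T -> T}) (x : T) f : F x f = \sum_g F (dl g) f * x g.
  rewrite {1}(dec x) linear_sum sum_ffunE; apply: eq_bigr => g _.
  by rewrite linearZ ffunE -[LHS]/(x g * _) mulrC.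
pose y f (u : R) := EE (minors (W u)) f : R.
have dy f (u : R) : is_derive u 1 (y f) (\sum_g EE (star X (dl g)) f * y g u).
  have -> : y f = (fun u => \sum_g EE (dl g) f * minors (W u) g).
    by apply/funext => v; rewrite /y expand.
  have -> : \sum_g EE (star X (dl g)) f * y g u = \sum_g EE (dl g) f * star X (minors (W u)) g.
    rewrite -(expand EE) EX.
    by rewrite (expand (HB.pack (EE \o star X) (GRing.isLinear.Build R T T _ (EE \o star X)
      (fun k x y => etrans (congr1 EE (linearP _ k x y)) (linearP _ k _ _))))).
  apply: is_derive_bigsum => g.
  exact: (is_deriveZ (EE (dl g) f : R) (is_derive_minors g (dW u))).
have y0 f : y f 0 = 0 by rewrite /y /= E0// ffunE.
have Et : E (minors (W t)) = 0.
  by apply/ffunP => f; rewrite [RHS]ffunE; exact: (linear_ode_zero dy y0 f t0).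
by move/eqP: Et; rewrite subr_eq0 => /eqP ->; exact: memv_proj.
Qed.

End StableSubspaces.

(** * Weighted Cauchy-Binet identities *)

Section CauchyBinet.
Variables (R : realType) (n d : nat).
Implicit Types N : 'M[R]_(n, d).

(** The weight depends on the slot so that a single slot can be weighted: with orthonormal columns,
    the remaining slots already force the two permutations to agree. *)
Lemma sum_minors_sqr N (c : 'I_d -> 'I_n -> R) :
  \sum_(f : {ffun 'I_d -> 'I_n}) minors N f ^+ 2 * \prod_i c i (f i) =
  \sum_(s : {perm 'I_d}) \sum_(t : {perm 'I_d})
    (-1) ^+ s * (-1) ^+ t * \prod_i \sum_l c i l * N l (s i) * N l (t i).
Proof.
transitivity (\sum_(f : {ffun 'I_d -> 'I_n}) \sum_(s : {perm 'I_d}) \sum_(t : {perm 'I_d})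
    (-1) ^+ s * (-1) ^+ t * \prod_i (c i (f i) * N (f i) (s i) * N (f i) (t i))).
  apply: eq_bigr => f _; rewrite ffunE expr2 {1}/determinant -mulrA mulr_suml.
  apply: eq_bigr => s _; rewrite /determinant mulr_suml mulr_sumr; apply: eq_bigr => t _.
  rewrite !big_split/=; under eq_bigr => i _ do rewrite mxE.
  under [in X in _ * (_ * X * _)]eq_bigr => i _ do rewrite mxE.
  by move: (\prod_i _) (\prod_i _) (\prod_i _) ((-1) ^+ s) ((-1) ^+ t) => p1 p2 p3 x1 x2; ring.
rewrite exchange_big/=; apply: eq_bigr => s _; rewrite exchange_big/=; apply: eq_bigr => t _.
rewrite -mulr_sumr; congr (_ * _).
by rewrite (bigA_distr_bigA (fun i l => c i l * N l (s i) * N l (t i))).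
Qed.

Variable N : 'M[R]_(n, d).
Hypothesis N_orth : N^T *m N = 1%:M.

Let N_orthE a b : \sum_l N l a * N l b = (a == b)%:R.
Proof.
have := congr1 (fun A : 'M[R]_d => A a b) N_orth; rewrite !mxE => <-.
by apply: eq_bigr => l _; rewrite mxE.
Qed.

Let perm_eq_but (s t : {perm 'I_d}) i : (forall j, j != i -> s j = t j) -> s = t.
Proof.
move=> st; apply/permP => j; case: (eqVneq j i) => [->|/st//].
have : (s^-1)%g (t i) = i.
  apply/eqP; apply/negPn/negP => ne.
  have := st _ ne; rewrite permKV => /perm_inj h.
  by rewrite -h eqxx in ne.
by move=> h; rewrite -[in LHS]h permKV.
Qed.

Lemma sum_minors_orth_one : \sum_(f : {ffun 'I_d -> 'I_n}) minors N f ^+ 2 = (d`!)%:R.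
Proof.
transitivity (\sum_(f : {ffun 'I_d -> 'I_n}) minors N f ^+ 2 * \prod_(i < d) (fun _ _ => 1 : R) i (f i)).
  by apply: eq_bigr => f _; rewrite big1 ?mulr1.
apply: (etrans (sum_minors_sqr N (fun _ _ => 1))).
transitivity (\sum_(s : {perm 'I_d}) (1 : R)).
  apply: eq_bigr => s _; rewrite (bigD1 s)//= [X in _ + X]big1 ?addr0; last first.
    move=> t ts; have [i sti] : exists i, s i != t i.
      apply/existsP; apply: contraR ts; rewrite negb_exists => /forallP h.
      by apply/eqP/permP => i; apply/eqP; rewrite eq_sym; move: (h i); rewrite negbK.
    rewrite (bigD1 i)//=; under eq_bigr => l _ do rewrite mul1r.
    by rewrite N_orthE (negbTE sti) mul0r mulr0.
  rewrite big1; first by rewrite mulr1 -expr2 sqrr_sign.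
  by move=> i _; under eq_bigr => l _ do rewrite mul1r; rewrite N_orthE eqxx.
by rewrite sumr_const -(card_Sn d) cardT -cardE.
Qed.

(** Weighting one slot at a time and summing over the slots produces [d]! times the trace of the
    diagonal operator [b] compressed to the span of the columns. *)
Lemma sum_minors_orth (b : 'I_n -> R) :
  \sum_(f : {ffun 'I_d -> 'I_n}) minors N f ^+ 2 * (\sum_i b (f i)) =
  (d`!)%:R * \sum_a \sum_l b l * N l a ^+ 2.
Proof.
under eq_bigr => f _ do rewrite mulr_sumr.
rewrite exchange_big/=.
transitivity (\sum_(i < d) \sum_(s : {perm 'I_d}) \sum_l b l * N l (s i) ^+ 2).
  apply: eq_bigr => i _.
  pose c (j : 'I_d) l := if j == i then b l else 1.
  transitivity (\sum_(f : {ffun 'I_d -> 'I_n}) minors N f ^+ 2 * \prod_(j < d) c j (f j)).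
    apply: eq_bigr => f _; rewrite (bigD1 i)//= {1}/c eqxx big1 ?mulr1// => j ji.
    by rewrite /c (negbTE ji).
  apply: (etrans (sum_minors_sqr N c)); apply: eq_bigr => s _.
  have cE j a b' : j != i -> \sum_l c j l * N l a * N l b' = (a == b')%:R.
    move=> ji; rewrite -N_orthE; apply: eq_bigr => l _.
    by rewrite /c (negbTE ji) mul1r.
  rewrite (bigD1 s)//= [X in _ + X]big1 ?addr0; last first.
    move=> t ts; have [j ji sti] : exists2 j, j != i & s j != t j.
      apply/exists_inP; apply: contraR ts; rewrite negb_exists => /forallP h.
      rewrite eq_sym; apply/eqP/(@perm_eq_but _ _ i) => j ji; apply/eqP.
      by move: (h j); rewrite ji/= negbK.
    by rewrite (bigD1 j)//= cE// (negbTE sti) mul0r mulr0.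
  rewrite -expr2 sqrr_sign mul1r (bigD1 i)//= [X in _ * X]big1 ?mulr1.
    by apply: eq_bigr => l _; rewrite /c eqxx -mulrA expr2.
  by move=> j ji; rewrite cE// eqxx.
rewrite exchange_big/= mulr_natl.
transitivity (\sum_(s : {perm 'I_d}) \sum_a \sum_l b l * N l a ^+ 2).
  by apply: eq_bigr => s _; rewrite [RHS](reindex_inj (@perm_inj _ s)).
by rewrite sumr_const -(card_Sn d) cardT -cardE.
Qed.

End CauchyBinet.

(** * Kostant's inequality by layers *)

Section LayerInequality.
Variables (R : realType) (n : nat).
(** [X j] is to be the matrix of [ad] of the [j]-th root vector, [z j] and [b j] the values of its
    root at two points of one chamber, and [J] the set of negative roots. The first two hypotheses
    express that brackets add roots. *)
Variables (X : 'I_n -> 'M[R]_n) (z b : 'I_n -> R) (J : set 'I_n).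
Hypothesis X_z : forall j l i, X j l i != 0 -> z l = z i + z j.
Hypothesis X_b : forall j l i, X j l i != 0 -> b i = b l - b j.
Hypothesis X_closed : forall j k, X j *m X k - X k *m X j = \sum_l X j l k *: X l.
Hypothesis J_b : forall j, J j -> b j <= 0.
Hypothesis J_z : forall j, ~ J j -> 0 <= z j.

(* The matrices of the linear group generated by the span of the [X j]: they
   preserve every subspace of minors stable under all the derivations. *)
Definition preserves_stable (M : 'M[R]_n) : Prop :=
  forall d (U : {vspace {ffun {ffun 'I_d -> 'I_n} -> R^o}}) (W : 'M[R]_(n, d)),
    (forall j t, t \in U -> star (X j) t \in U) ->
    minors W \in U -> minors (M *m W) \in U.

Section Layer.
Variable mu : R.
Let Iset := [pred i | mu <= z i].
Let d := #|Iset|.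
Local Notation T := {ffun {ffun 'I_d -> 'I_n} -> R^o}.
Let W : 'M[R]_(n, d) := \matrix_(l, a) (l == enum_val a)%:R.
Let top := \sum_(i | mu <= z i) b i.

(** A nonzero minor makes [f] a bijection onto the layer, so the wedge of the layer has the single
    weight [top] at [b]. *)
Let rowsubW f : \det (rowsub f W) != 0 -> \sum_a b (f a) = top.
Proof.
move=> nz.
have finj : injective f.
  move=> a a' faa'; apply/eqP; apply: contraNT nz => aa'.
  by rewrite (determinant_alternate aa')// => j; rewrite !mxE faa'.
have fI a : f a \in Iset.
  apply: contraNT nz => fa; rewrite (expand_det_row _ a) big1// => j _.
  rewrite !mxE; case: eqP => [E|]; last by rewrite mul0r.
  by move: fa; rewrite E enum_valP.
pose sg a : 'I_d := enum_rank_in (fI a) (f a).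
have sgE a : enum_val (sg a) = f a by rewrite /sg enum_rankK_in.
have sginj : injective sg by move=> a a' /(congr1 enum_val); rewrite !sgE => /finj.
under eq_bigr => a _ do rewrite -sgE.
rewrite /top (_ : \sum_(i | mu <= z i) b i = \sum_(i in Iset) b i)//.
by rewrite (big_enum_val (A := Iset)) [RHS](reindex_inj sginj).
Qed.

(** Highest weight argument: operators outside [J] fix the line of [minors W], operators in [J]
    never raise the weight at [b], and what [J] generates from this vector is stable under all
    [X k], hence contains [minors (M *m W)]. *)
Lemma minors_weight M : preserves_stable M -> forall f, minors (M *m W) f != 0 ->
  \sum_a b (f a) <= top.
Proof.
move=> MP f; apply: contraNT; rewrite -ltNge => ftop.
pose F (j : 'I_n) : 'End(T) := linfun (star (X j)).
have FE j t : F j t = star (X j) t by rewrite lfunE.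
have [U [vU stU minU]] := minimal_stable (minors W) J F.
have stUall j t : t \in U -> star (X j) t \in U.
  (* [U'] consists of the tensors of [U] that no [X j] takes out of [U]. It contains the generator,
     and by the commutation relation it is stable under [J], so minimality gives [U <= U']. *)
  pose U' := (U :&: \bigcap_(j < n) (F j @^-1: U))%VS.
  have U'P t' : reflect (t' \in U /\ forall j, star (X j) t' \in U) (t' \in U').
    rewrite memv_cap; apply: (iffP andP) => -[-> h]; split=> //.
      by move=> k; move: h; rewrite memvE => /subv_bigcapP/(_ k isT); rewrite -memvE -memv_preim FE.
    by rewrite memvE; apply/subv_bigcapP => k _; rewrite -memvE -memv_preim FE.
  suff UU' : (U <= U')%VS by move=> /(subvP UU')/U'P[_]; apply.
  apply: minU.
    apply/U'P; split=> // k; have [Jk|Jk] := pselect (J k); first by rewrite -FE; exact: stU.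
    (* Outside [J] the operator [X k] does not lower [z], so it preserves the span of the layer and
       scales its wedge. *)
    pose Y : 'M[R]_d := \matrix_(a, a') X k (enum_val a) (enum_val a').
    rewrite (@star_minors_stable _ _ _ _ _ Y); first exact: memvZ.
    apply/matrixP => l a; rewrite !mxE.
    rewrite (bigD1 (enum_val a))//= !mxE eqxx mulr1 big1 ?addr0; last first.
      by move=> i ia; rewrite !mxE (negbTE ia) mulr0.
    have [lI|lI] := boolP (l \in Iset).
      rewrite (bigD1 (enum_rank_in lI l))//= !mxE enum_rankK_in// eqxx mul1r big1 ?addr0//.
      move=> a' a'l; rewrite !mxE; case: eqP => [E|]; last by rewrite mul0r.
      by case/eqP: a'l; apply: enum_val_inj; rewrite enum_rankK_in.
    rewrite big1 => [|a' _]; last first.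
      by rewrite !mxE; case: eqP => [E|]; [move: lI; rewrite E enum_valP|rewrite mul0r].
    apply/eqP; apply: contraNT lI => /X_z lE; rewrite inE lE.
    have := enum_valP a; rewrite inE => h; rewrite (le_trans h)// lerDl; exact: J_z.
  move=> k Jk t' /U'P[t'U t'st]; apply/U'P; split; first by rewrite FE.
  move=> k'; rewrite FE star_bracket; apply: memvD; first by rewrite -FE; apply: stU.
  by rewrite X_closed star_lincomb; apply: memv_suml => l _; apply: memvZ.
have MU : minors (M *m W) \in U by apply: MP.
(* [Z] keeps the coordinates of weight above [top]; its kernel contains the generator and is stable
   under [J], hence contains [U]. *)
pose Z (t : T) : T := [ffun f : {ffun 'I_d -> 'I_n} => if \sum_a b (f a) <= top then 0 else t f].
have ZL : linear Z.
  move=> k t t'; apply/ffunP => g; rewrite !ffunE; case: ifP => // _.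
  by rewrite scaler0 addr0.
pose ZZ : {linear T -> T} := HB.pack Z (GRing.isLinear.Build R T T _ Z ZL).
have kerP (t : T) : reflect (forall g : {ffun 'I_d -> 'I_n}, ~~ (\sum_a b (g a) <= top) -> t g = 0) (t \in lker (linfun ZZ)).
  rewrite memv_ker lfunE /=; apply: (iffP eqP) => [h g gt|h].
    by have := congr1 (fun t : T => t g) h; rewrite !ffunE (negbTE gt).
  by apply/ffunP => g; rewrite !ffunE; case: ifPn => // /h.
suff sub : (U <= lker (linfun ZZ))%VS.
  by have /kerP/(_ f) := subvP sub _ MU; rewrite -ltNge => /(_ ftop) ->.
apply: minU.
  apply/kerP => g; apply: contraNeq; rewrite ffunE => /rowsubW ->.
  exact: lexx.
move=> k Jk t /kerP h; apply/kerP => g gt; rewrite FE starE big1// => i _; rewrite big1// => l _.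
have [->|nz] := eqVneq (X k (g i) l) 0; first by rewrite mul0r.
rewrite h ?mulr0//; apply: contraNN gt; apply: le_trans.
have := X_b nz => lE.
rewrite (bigD1 i)//= [leRHS](bigD1 i)//= ffunE eqxx lerD//; last first.
  by apply: ler_sum => j ji; rewrite ffunE (negbTE ji).
by rewrite lE lerDl oppr_ge0; exact: J_b.
Qed.

(** For orthogonal [M] the squared minors of [M *m W] are weights of total [d]!. The left side is
    the mean of the weights at [b], all of which are at most [top]. *)
Lemma layer_inequality M : preserves_stable M -> M^T *m M = 1%:M ->
  \sum_(i | mu <= z i) \sum_l b l * M l i ^+ 2 <= \sum_(i | mu <= z i) b i.
Proof.
move=> MP MM.
have WW : W^T *m W = 1%:M.
  apply/matrixP => a a'; rewrite !mxE (bigD1 (enum_val a))//= !mxE eqxx mul1r big1 ?addr0.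
    by rewrite (inj_eq enum_val_inj).
  by move=> l la; rewrite !mxE (negbTE la) mul0r.
have NN : (M *m W)^T *m (M *m W) = 1%:M.
  by rewrite trmx_mul mulmxA -[W^T *m _ *m M]mulmxA MM mulmx1.
have NE l a : (M *m W) l a = M l (enum_val a).
  rewrite !mxE (bigD1 (enum_val a))//= !mxE eqxx mulr1 big1 ?addr0//.
  by move=> i ia; rewrite !mxE (negbTE ia) mulr0.
have d0 : 0 < (d`!)%:R :> R by rewrite ltr0n fact_gt0.
rewrite (_ : \sum_(i | mu <= z i) b i = top)//.
have -> : \sum_(i | mu <= z i) \sum_l b l * M l i ^+ 2 = \sum_a \sum_l b l * (M *m W) l a ^+ 2.
  rewrite (_ : \sum_(i | mu <= z i) _ = \sum_(i in Iset) \sum_l b l * M l i ^+ 2)//.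
  rewrite (big_enum_val (A := Iset)); apply: eq_bigr => a _; apply: eq_bigr => l _.
  by rewrite NE.
rewrite -(ler_pM2l d0) -(sum_minors_orth NN) -(sum_minors_orth_one NN) mulr_suml.
apply: ler_sum => f _.
have [->|nz] := eqVneq (minors (M *m W) f) 0; first by rewrite expr0n/= !mul0r.
by rewrite ler_wpM2l ?sqr_ge0//; exact: minors_weight MP _ nz.
Qed.

End Layer.

(** A nonnegative function is a positive combination of indicators of its upper level sets. The
    shift by [C] makes [y] nonnegative and changes nothing, because the [c i] sum to 0. *)
Lemma layered_sum (y c : 'I_n -> R) :
  (forall mu, 0 <= \sum_(i | mu <= y i) c i) -> \sum_i c i = 0 -> 0 <= \sum_i y i * c i.
Proof.
move=> h c0.
suff main m (y' : 'I_n -> R) : (forall i, 0 <= y' i) -> (#|[pred i | (0 < y' i)%R]| <= m)%N ->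
    (forall mu, 0 < mu -> 0 <= \sum_(i | mu <= y' i) c i) -> 0 <= \sum_i y' i * c i.
  pose C := \sum_i `|y i|.
  have := main _ (fun i => y i + C) _ (leqnn _); under eq_bigr => i _ do rewrite mulrDl.
  rewrite big_split/= -mulr_sumr c0 mulr0 addr0; apply.
    move=> i; rewrite /C (bigD1 i)//= addrA addr_ge0 ?sumr_ge0//.
    by have := ler_norm (- y i); rewrite normrN; lra.
  by move=> mu _; under eq_bigl => i do rewrite -lerBlDr.
elim: m y' => [|m IH] y' y'0 card lay.
  rewrite big1// => i _; have : i \notin [pred i | 0 < y' i].
    by move: card; rewrite leqn0 => /eqP/card0_eq ->.
  rewrite inE -leNgt => y'i; have -> : y' i = 0 by apply/eqP; rewrite eq_le y'i y'0.
  by rewrite mul0r.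
have [[i1 i1P]|none] := pselect (exists i, 0 < y' i); last first.
  rewrite big1// => i _; have -> : y' i = 0; last by rewrite mul0r.
  by apply/eqP; rewrite eq_le y'0 andbT leNgt; apply/negP => pi; apply: none; exists i.
have [i0 i0P i0min] := @arg_minP _ R _ i1 (fun i => 0 < y' i) y' i1P.
(* Subtracting the least positive value from all positive entries peels off one layer and lowers the
   number of positive entries. *)
pose m' := y' i0.
have posE i : (0 < y' i) = (m' <= y' i).
  by apply/idP/idP => [/i0min//|]; apply: lt_le_trans.
pose y'' i := if 0 < y' i then y' i - m' else 0.
have -> : \sum_i y' i * c i = \sum_i y'' i * c i + m' * \sum_(i | m' <= y' i) c i.
  rewrite mulr_sumr [X in _ + X]big_mkcond -big_split/=; apply: eq_bigr => i _.
  rewrite /y'' -posE; case: ifPn => [_|]; first by rewrite mulrBl subrK.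
  rewrite -leNgt => y'i; have -> : y' i = 0 by apply/eqP; rewrite eq_le y'i y'0.
  by rewrite mul0r addr0.
apply: addr_ge0; last by rewrite mulr_ge0 ?(ltW i0P)//; exact: lay.
apply: IH.
- by move=> i; rewrite /y''; case: ifP => //; rewrite posE subr_ge0.
- rewrite -ltnS; apply: leq_trans card; apply: proper_card; apply/properP; split.
    by apply/fintype.subsetP => i; rewrite !inE /y''; case: ifP => //; rewrite ltxx.
  by exists i0; rewrite !inE// /y'' i0P subrr ltxx.
- move=> mu mu0; have := lay (mu + m') (addr_gt0 mu0 i0P).
  rewrite (eq_bigl (fun i => mu <= y'' i))// => i; rewrite /y''; case: ifPn => [_|].
    by rewrite lerBrDr.
  rewrite -leNgt => y'i; rewrite [RHS]leNgt mu0/=; apply/negP => h1.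
  by have := lt_le_trans (addr_gt0 mu0 i0P) h1; rewrite ltNge y'i.
Qed.

(** Orthonormal columns serve the layers. Orthonormal rows make the differences of [b i] and
    [\sum_l b l * M l i ^+ 2] sum to zero, as summation by layers requires. *)
Lemma kostant_inequality M : preserves_stable M -> M^T *m M = 1%:M ->
  \sum_i z i * \sum_l b l * M l i ^+ 2 <= \sum_i z i * b i.
Proof.
move=> MP MM; rewrite -subr_ge0 -sumrB.
under eq_bigr => i _ do rewrite -mulrBr.
apply: layered_sum => [mu|].
  by rewrite sumrB subr_ge0; exact: layer_inequality.
rewrite sumrB exchange_big/= -sumrB big1// => l _.
rewrite -mulr_sumr -[X in X - _]mulr1 -mulrBr.
have := congr1 (fun A : 'M[R]_n => A l l) (mulmx1C MM); rewrite !mxE eqxx mulr1n => <-.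
rewrite (eq_bigr (fun i => M l i ^+ 2)) ?subrr ?mulr0// => i _.
by rewrite mxE expr2.
Qed.

Lemma preserves_stable1 : preserves_stable 1%:M.
Proof. by move=> d U W _; rewrite mul1mx. Qed.

Lemma preserves_stableM M N : preserves_stable M -> preserves_stable N -> preserves_stable (M *m N).
Proof. by move=> hM hN d U W st WU; rewrite -mulmxA; apply: hM => //; exact: hN. Qed.

Lemma preserves_stable_flow (M : R -> 'M[R]_n) (k : 'I_n -> R) (t : R) : 0 <= t -> M 0 = 1%:M ->
  (forall (u : R) l i, is_derive u 1 (fun u => M u l i) (((\sum_j k j *: X j) *m M u) l i)) ->
  preserves_stable (M t).
Proof.
move=> t0 M0 dM d U W st WU.
apply: (@star_curve _ _ _ U (\sum_j k j *: X j) (fun u => M u *m W)) => //.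
- by move=> x xU; rewrite star_lincomb; apply: memv_suml => j _; apply: memvZ; exact: st.
- move=> u l a; rewrite mulmxA [X in is_derive _ _ _ X]mxE.
  rewrite (_ : (fun _ => _) = (fun u => \sum_i W i a * M u l i)); last first.
    by apply/funext => v; rewrite mxE; apply: eq_bigr => i _; rewrite mulrC.
  rewrite (eq_bigr (fun i => W i a *: (((\sum_j k j *: X j) *m M u) l i : R))); last first.
    by move=> i _; rewrite mulrC.
  by apply: is_derive_bigsum => i; apply: (is_deriveZ (W i a) (dM u l i)).
- by rewrite M0 mul1mx.
Qed.

End LayerInequality.

(** * Simultaneous diagonalization of symmetric operators *)

Section SpectralTheorem.
Variables (R : realType) (n : nat).
Local Notation V := 'rV[R]_n.
Variables (Q : V -> V -> R).
Hypothesis QDl : forall x y z, Q (x + y) z = Q x z + Q y z.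
Hypothesis QZl : forall c x z, Q (c *: x) z = c * Q x z.
Hypothesis QC : forall x y, Q x y = Q y x.
Hypothesis Q_pos : forall x, x != 0 -> 0 < Q x x.

Let Q_eq0 x : Q x x = 0 -> x = 0.
Proof. by move=> h; apply/eqP; apply: contraT => /Q_pos; rewrite h ltxx. Qed.

(** [e] maximizes the Rayleigh quotient. Then [P = mu Q - B] is nonnegative on [U] and zero at [e],
    so [P e y = 0] on [U] as in Cauchy-Schwarz, and stability of [U] allows [y = mu e - T e]. *)
Lemma rayleigh_eigenvector (T : 'End(V)) (U : {vspace V}) :
  (forall x y, Q (T x) y = Q x (T y)) -> (forall x, x \in U -> T x \in U) -> U != 0%VS ->
  exists mu e, [/\ e \in U, e != 0 & T e = mu *: e].
Proof.
move=> Tsym TU U0.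
pose S := [set x : V | x \in U /\ `|x| = 1].
have S0 : S !=set0.
  have : vpick U != 0 by rewrite vpick0.
  exists (`|vpick U|^-1 *: vpick U); split; first by apply: memvZ; exact: memv_pick.
  by rewrite normrZ normfV normr_id mulVf// normr_eq0.
pose B x y := Q (T x) y.
have BDl x y z : B (x + y) z = B x z + B y z by rewrite /B linearD QDl.
have BZl c x z : B (c *: x) z = c * B x z by rewrite /B linearZ QZl.
have BC x y : B x y = B y x by rewrite /B Tsym QC.
have S_neq0 x : S x -> x != 0.
  by case=> _ h; rewrite -normr_eq0 h oner_eq0.
have cont : {within S, continuous (fun x => B x x / Q x x)}.
  apply: continuous_in_subspaceT => x; rewrite inE => Sx; apply: (@cvgM _ _ (nbhs x) (nbhs_filter x)).
    exact: (form_continuous BDl BZl BC).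
  apply: (@cvgV _ _ (nbhs x) (nbhs_filter x)); first by rewrite gt_eqF// Q_pos// S_neq0.
  exact: (form_continuous QDl QZl QC).
have [e] := compact_EVT_max S0 (vspace_sphere_compact (a := U)) cont.
rewrite inE => Se emax; set mu := B e e / Q e e in emax.
have [eU _] := Se; have e0 := S_neq0 _ Se.
have ub x : x \in U -> B x x <= mu * Q x x.
  move=> xU; have [->|x0] := eqVneq x 0.
    by rewrite (form0l BZl) (form0l QZl) mulr0.
  have nx0 : `|x| != 0 by rewrite normr_eq0.
  have /emax : `|x|^-1 *: x \in S.
    by rewrite inE; split; [exact: memvZ|rewrite normrZ normfV normr_id mulVf].
  rewrite BZl (formZr BZl BC) QZl (formZr QZl QC) -mulf_div divff ?mul1r ?invr_eq0//.
  rewrite -mulf_div divff ?mul1r ?invr_eq0//.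
  by rewrite ler_pdivrMr// Q_pos.
pose P x y := mu * Q x y - B x y.
have Pe : P e e = 0 by rewrite /P /mu mulfVK ?subrr// gt_eqF// Q_pos.
have Pz y : y \in U -> P e y = 0.
  move=> yU; have quad t : 0 <= 2 * t * P e y + t ^+ 2 * P y y.
    have : 0 <= P (e + t *: y) (e + t *: y).
      by rewrite /P subr_ge0; apply: ub; apply: memvD => //; exact: memvZ.
    have -> : P (e + t *: y) (e + t *: y) = P e e + (2 * t * P e y + t ^+ 2 * P y y).
      rewrite /P QDl !(formDr QDl QC) QZl !(formZr QZl QC) QZl BDl !(formDr BDl BC) BZl !(formZr BZl BC) BZl.
      by rewrite (BC y e) (QC y e); ring.
    by rewrite Pe add0r.
  have Py : 0 <= P y y by rewrite /P subr_ge0; exact: ub.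
  have P1 : 0 < 1 + P y y by rewrite ltr_pwDl.
  (* The minimizer of the quadratic would have denominator [P y y], which may vanish; with
     [1 + P y y] the value is still negative unless [P e y = 0]. *)
  have := quad (- P e y / (1 + P y y)).
  have -> : 2 * (- P e y / (1 + P y y)) * P e y + (- P e y / (1 + P y y)) ^+ 2 * P y y =
      - ((P e y) ^+ 2 * ((2 + P y y) / (1 + P y y) ^+ 2)).
    by field; rewrite gt_eqF.
  rewrite oppr_ge0 pmulr_lle0; last first.
    by rewrite divr_gt0 ?exprn_gt0// ltr_pwDl.
  by move=> h; apply/eqP; rewrite -sqrf_eq0 eq_le h sqr_ge0.
exists mu, e; split=> //; apply/esym/eqP; rewrite -subr_eq0; apply/eqP/Q_eq0.
rewrite {1}(formBl QDl QZl) QZl; apply: Pz.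
by apply: memvB; [exact: memvZ|exact: TU].
Qed.

Variable F : set 'End(V).
Hypothesis F_sym : forall T, F T -> forall x y, Q (T x) y = Q x (T y).
Hypothesis F_comm : forall T T', F T -> F T' -> forall x, T (T' x) = T' (T x).

Let stable (U : {vspace V}) := forall T, F T -> forall x, x \in U -> T x \in U.

Let common_eigenvector m (U : {vspace V}) : (\dim U <= m)%N -> stable U -> U != 0%VS ->
  exists e, [/\ e \in U, Q e e = 1 & forall T, F T -> exists mu, T e = mu *: e].
Proof.
elim: m U => [|m IH] U dU stU U0.
  by move: dU; rewrite leqn0 dimv_eq0 (negbTE U0).
have [sc|] := pselect (forall T, F T -> exists mu, forall x, x \in U -> T x = mu *: x).
  have x0 : vpick U != 0 by rewrite vpick0.
  have q0 := Q_pos x0; exists ((Num.sqrt (Q (vpick U) (vpick U)))^-1 *: vpick U).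
  have mem k : k *: vpick U \in U by apply: memvZ; exact: memv_pick.
  split=> //; last by move=> T /sc[mu h]; exists mu; exact: h.
  rewrite QZl (formZr QZl QC) mulrA -invfM -expr2 sqr_sqrtr ?ltW// mulVf// gt_eqF//.
move=> /existsNP[T /not_implyP[FT /forallNP nsc]].
have [mu [e [eU e0 Te]]] := rayleigh_eigenvector (F_sym FT) (stU T FT) U0.
pose U1 := (U :&: lker (T - mu *: \1%VF))%VS.
have U1P x : (x \in U1) = (x \in U) && (T x == mu *: x).
  by rewrite memv_cap memv_ker add_lfunE opp_lfunE scale_lfunE id_lfunE subr_eq0.
have [|||e' [e'U1 e'1 e'F]] := IH U1.
- rewrite -ltnS; apply: leq_trans dU; rewrite ltn_neqAle dimvS ?capvSl// andbT.
  apply: contra_notN (nsc mu) => dE x xU.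
  have : (U1 == U)%VS by rewrite eqEdim capvSl (eqP dE) leqnn.
  by move/eqP=> UE; move: xU; rewrite -UE U1P => /andP[_ /eqP].
- move=> T' FT' x; rewrite !U1P => /andP[xU /eqP Tx].
  by rewrite stU//= F_comm// Tx linearZ.
- by apply/eqP => U10; move: e0; rewrite -memv0 -U10 U1P eU Te eqxx.
- by exists e'; split=> //; move: e'U1; rewrite U1P => /andP[].
Qed.

Let eigen_seq m (U : {vspace V}) : \dim U = m -> stable U ->
  exists e : nat -> V, [/\ forall i, (i < m)%N -> e i \in U,
    forall i j, (i < m)%N -> (j < m)%N -> Q (e i) (e j) = (i == j)%:R
    & forall T i, (i < m)%N -> F T -> exists mu, T (e i) = mu *: e i].
Proof.
elim: m U => [|m IH] U dU stU; first by exists (fun=> 0).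
have U0 : U != 0%VS by rewrite -dimv_eq0 dU.
have [e [eU e1 eF]] := common_eigenvector (leqnn _) stU U0.
pose l : V -> R^o := fun x => Q x e.
have lL : linear l by move=> k x y; rewrite /l QDl QZl.
pose ll : {linear V -> R^o} := HB.pack l (GRing.isLinear.Build R V R^o _ l lL).
pose U1 := (U :&: lker (linfun ll))%VS.
have U1P x : (x \in U1) = (x \in U) && (Q x e == 0) by rewrite memv_cap memv_ker lfunE.
have dU1 : \dim U1 = m.
  have := limg_ker_dim (linfun ll) U; rewrite dU -/U1.
  have : (\dim (linfun ll @: U) <= 1)%N.
    have := dimvS (subvf (linfun ll @: U)%VS); rewrite dimvf.
    by apply: leq_trans.
  have : (0 < \dim (linfun ll @: U))%N.
    rewrite lt0n dimv_eq0; apply/eqP => h; have := memv_img (linfun ll) eU.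
    by rewrite h memv0 lfunE /= /l e1 oner_eq0.
  by case: (\dim _) => [|[|//]] // _ _; rewrite addn1 => -[].
have [|f [fU fQ fF]] := IH U1 dU1.
  move=> T FT x; rewrite !U1P => /andP[xU /eqP xe]; rewrite stU//=.
  by have [mu eE] := eF T FT; rewrite F_sym// eE (formZr QZl QC) xe mulr0.
have fe i : (i < m)%N -> Q (f i) e = 0.
  by move=> /fU; rewrite U1P => /andP[_ /eqP].
exists (fun i => if i is i'.+1 then f i' else e); split.
- by case=> [//|i] im; have := fU i im; rewrite U1P => /andP[].
- case=> [|i] [|j] im jm //; first by rewrite QC fe.
  + by rewrite fe.
  + exact: fQ.
- by move=> T [|i] im FT; [exact: eF|exact: fF].
Qed.

(** For empty [F] this is the existence of an orthonormal basis, and it is used in that way too. *)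
Lemma common_eigenbasis : exists e : 'I_n -> V,
  (forall i j, Q (e i) (e j) = (i == j)%:R) /\
  (forall T i, F T -> exists mu, T (e i) = mu *: e i).
Proof.
have [||e [_ eQ eF]] := @eigen_seq n {:V}%VS.
- by rewrite dimvf /dim /= mul1n.
- by move=> T _ x _; exact: memvf.
by exists (fun i => e i); split=> [i j|T i]; [exact: eQ|exact: eF].
Qed.

Section OrthonormalBasis.
Variable e : 'I_n -> V.
Hypothesis e_orth : forall i j, Q (e i) (e j) = (i == j)%:R.
Let E : 'M[R]_n := \matrix_i e i.
Let H : 'M[R]_n := \matrix_(j, l) Q (delta_mx 0 j) (e l).

Let mulH (v : V) l : (v *m H) 0 l = Q v (e l).
Proof.
rewrite mxE {2}(row_sum_delta v) (form_suml QDl QZl).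
by apply: eq_bigr => j _; rewrite mxE.
Qed.

Let EH : E *m H = 1%:M.
Proof.
apply/matrixP => i l; have := mulH (e i) l; rewrite e_orth !mxE => <-.
by apply: eq_bigr => j _; rewrite !mxE.
Qed.

Lemma orthonormal_expand v : v = \sum_l Q v (e l) *: e l.
Proof.
rewrite -{1}[v]mulmx1 -(mulmx1C EH) mulmxA mulmx_sum_row.
by apply: eq_bigr => l _; rewrite mulH rowK.
Qed.

Lemma orthonormal_trace (f : V -> V) : linear f ->
  \tr (lin1_mx f) = \sum_i Q (f (e i)) (e i).
Proof.
move=> lf; pose fl : {linear V -> V} := HB.pack f (GRing.isLinear.Build R V V _ f lf).
rewrite -[lin1_mx f]mulmx1 -(mulmx1C EH) mulmxA mxtrace_mulC mulmxA /mxtrace.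
apply: eq_bigr => i _; rewrite -mulH -[f]/(fl : V -> V) -mul_rV_lin1 mxE [RHS]mxE.
apply: eq_bigr => j _; congr (_ * _); rewrite !mxE; apply: eq_bigr => k _.
by rewrite !mxE.
Qed.

End OrthonormalBasis.
End SpectralTheorem.

(** * Trace forms of brackets *)

Section TraceForm.
Variables (R : realType) (n : nat).
Local Notation V := 'rV[R]_n.

Lemma mul_lin1_mx (f : V -> V) v : linear f -> v *m lin1_mx f = f v.
Proof.
move=> lf; pose fl : {linear V -> V} := HB.pack f (GRing.isLinear.Build R V V _ f lf).
by rewrite -[f]/(fl : V -> V) mul_rV_lin1.
Qed.

Lemma lin1_mx_eq (f : V -> V) A : (forall v : V, v *m A = f v) -> lin1_mx f = A.
Proof. by move=> h; apply/matrixP => i j; rewrite mxE -h -rowE mxE. Qed.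

(** The Killing form when [b] is the Lie bracket; it is taken for the dual bracket as well. Matrices
    act from the right, so the product represents [b y] after [b x]. *)
Definition trace_form (b : V -> V -> V) x y : R := \tr (lin1_mx (b x) *m lin1_mx (b y)).

Variable b : V -> V -> V.
Hypothesis bDl : forall x y z, b (x + y) z = b x z + b y z.
Hypothesis bZl : forall k x z, b (k *: x) z = k *: b x z.
Hypothesis blin : forall x, linear (b x).

Lemma trace_formDl x y z : trace_form b (x + y) z = trace_form b x z + trace_form b y z.
Proof.
rewrite /trace_form -mxtraceD -mulmxDl; congr (\tr (_ *m _)).
by apply/matrixP => i j; rewrite !mxE bDl mxE.
Qed.

Lemma trace_formZl k x z : trace_form b (k *: x) z = k * trace_form b x z.
Proof.
rewrite /trace_form -mxtraceZ scalemxAl; congr (\tr (_ *m _)).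
by apply/matrixP => i j; rewrite !mxE bZl mxE.
Qed.

Lemma trace_formC x y : trace_form b x y = trace_form b y x.
Proof. exact: mxtrace_mulC. Qed.

Lemma trace_form_aut (f g : V -> V) : linear f -> linear g -> cancel g f ->
  (forall x y, f (b x y) = b (f x) (f y)) ->
  forall x y, trace_form b (f x) (f y) = trace_form b x y.
Proof.
move=> lf lg gK fb x y.
have E z : lin1_mx (b (f z)) = lin1_mx g *m lin1_mx (b z) *m lin1_mx f.
  by apply: lin1_mx_eq => v; rewrite !mulmxA !mul_lin1_mx// fb gK.
have fg : lin1_mx g *m lin1_mx f = 1%:M.
  by apply/row_matrixP => i; rewrite !rowE mulmxA !mul_lin1_mx// gK mulmx1.
rewrite /trace_form !E -!mulmxA mxtrace_mulC -!mulmxA.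
by rewrite (mulmx1C fg) mulmx1 [lin1_mx f *m (_ *m _)]mulmxA (mulmx1C fg) mul1mx.
Qed.

Lemma trace_form_comp x y : trace_form b x y = \tr (lin1_mx (b y \o b x)).
Proof.
rewrite /trace_form; congr (\tr _); apply/esym/lin1_mx_eq => v.
by rewrite mulmxA !mul_lin1_mx.
Qed.

Hypothesis bJ : forall x y z, b x (b y z) = b (b x y) z + b y (b x z).

Lemma trace_form_invariant z x y : trace_form b (b z x) y = - trace_form b x (b z y).
Proof.
have E u v : lin1_mx (b (b u v)) = lin1_mx (b v) *m lin1_mx (b u) - lin1_mx (b u) *m lin1_mx (b v).
  apply: lin1_mx_eq => w; rewrite mulmxBr !mulmxA !mul_lin1_mx//.
  by rewrite bJ addrK.
rewrite /trace_form !E; apply/eqP; rewrite -addr_eq0 -mxtraceD mulmxBl mulmxBr !mulmxA.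
by rewrite addrC addrA subrK raddfB /= mxtrace_mulC mulmxA subrr.
Qed.

End TraceForm.

(** * Orthogonal symmetric Lie algebras and the noncompact dual *)

Section SymmetricLieAlgebra.
Variables (R : realType) (n : nat).
Local Notation V := 'rV[R]_n.
Variables (br : {bilinear V -> V -> V}) (s : 'End(V)) (ip : V -> V -> R).
Hypotheses (br_lie : is_lie_bracket br) (br_semisimple : is_semisimple br).
Hypothesis s_invol : is_involutive_automorphism br s.
Hypothesis ipDl : forall x y z, ip (x + y) z = ip x z + ip y z.
Hypothesis ipZl : forall c x z, ip (c *: x) z = c * ip x z.
Hypothesis ipC : forall x y, ip x y = ip y x.
Hypothesis ip_pos : forall x, x != 0 -> 0 < ip x x.
Hypothesis ip_s : forall x y, ip (s x) (s y) = ip x y.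
Hypothesis ip_k : forall z x y, z \in kpart s -> ip (br z x) y + ip x (br z y) = 0.

Lemma brDl x y z : br (x + y) z = br x z + br y z. Proof. exact: linearDl. Qed.
Lemma brDr x y z : br z (x + y) = br z x + br z y. Proof. exact: linearDr. Qed.
Lemma brZl k x z : br (k *: x) z = k *: br x z. Proof. exact: linearZl. Qed.
Lemma brZr k x z : br z (k *: x) = k *: br z x. Proof. exact: linearZr. Qed.
Lemma brNl x z : br (- x) z = - br x z. Proof. exact: linearNl. Qed.
Lemma brNr x z : br z (- x) = - br z x. Proof. exact: linearNr. Qed.
Lemma br0l z : br 0 z = 0. Proof. exact: linear0l. Qed.
Lemma br0r z : br z 0 = 0. Proof. exact: linear0r. Qed.
Lemma br_linear x : linear (br x). Proof. by move=> k y z; rewrite brDr brZr. Qed.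

Lemma br_anti x y : br x y = - br y x.
Proof.
have [h _] := br_lie; have := h (x + y); rewrite brDl !brDr !h add0r addr0 => /eqP.
by rewrite addr_eq0 => /eqP.
Qed.

Lemma br_jacobi x y z : br x (br y z) = br (br x y) z + br y (br x z).
Proof.
have [_ h] := br_lie; have := h x y z.
rewrite [br y (br z x)](_ : _ = - br y (br x z)); last by rewrite (br_anti z x) brNr.
rewrite [br z _]br_anti => /eqP; rewrite subr_eq add0r subr_eq => /eqP ->.
by [].
Qed.

Lemma kpartP x : reflect (s x = x) (x \in kpart s). Proof. exact: fixedSpaceP. Qed.

Lemma ppartP x : reflect (s x = - x) (x \in ppart s).
Proof.
rewrite /ppart /passmx.leigenspace memv_ker add_lfunE opp_lfunE scale_lfunE id_lfunE.
by rewrite scaleN1r opprK addr_eq0; exact: eqP.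
Qed.

Let ss x : s (s x) = x. Proof. by case: s_invol. Qed.
Let s_br x y : s (br x y) = br (s x) (s y). Proof. by case: s_invol. Qed.

Let half_double (x : V) : 2^-1 *: (x + x) = x.
Proof. by rewrite scalerDr -scalerDl (_ : 2^-1 + 2^-1 = 1 :> R) ?scale1r//; lra. Qed.

Definition kproj (x : V) : V := 2^-1 *: (x + s x).
Definition pproj (x : V) : V := 2^-1 *: (x - s x).

Lemma kprojP x : kproj x \in kpart s.
Proof. by apply/kpartP; rewrite linearZ linearD /= ss addrC. Qed.
Lemma pprojP x : pproj x \in ppart s.
Proof. by apply/ppartP; rewrite linearZ linearB /= ss -scalerN opprB. Qed.

Lemma kproj_pproj x : x = kproj x + pproj x.
Proof. by rewrite -scalerDr addrACA subrr addr0 half_double. Qed.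

Lemma kproj_id x : x \in kpart s -> kproj x = x.
Proof. by move=> /kpartP h; rewrite /kproj h half_double. Qed.
Lemma kproj_p x : x \in ppart s -> kproj x = 0.
Proof. by move=> /ppartP h; rewrite /kproj h subrr scaler0. Qed.
Lemma pproj_k x : x \in kpart s -> pproj x = 0.
Proof. by move=> /kpartP h; rewrite /pproj h subrr scaler0. Qed.
Lemma pproj_id x : x \in ppart s -> pproj x = x.
Proof. by move=> h; rewrite [RHS]kproj_pproj kproj_p// add0r. Qed.
Lemma kprojL : linear kproj.
Proof. by move=> k x y; rewrite /kproj linearP; apply/rowP => i; rewrite !mxE; ring. Qed.
Lemma pprojL : linear pproj.
Proof.
by move=> k x y; rewrite /pproj linearP; apply/rowP => i; rewrite !mxE; ring.
Qed.

Lemma br_kk x y : x \in kpart s -> y \in kpart s -> br x y \in kpart s.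
Proof. by move=> /kpartP hx /kpartP hy; apply/kpartP; rewrite s_br hx hy. Qed.
Lemma br_kp x y : x \in kpart s -> y \in ppart s -> br x y \in ppart s.
Proof. by move=> /kpartP hx /ppartP hy; apply/ppartP; rewrite s_br hx hy brNr. Qed.
Lemma br_pk x y : x \in ppart s -> y \in kpart s -> br x y \in ppart s.
Proof. by move=> /ppartP hx /kpartP hy; apply/ppartP; rewrite s_br hx hy brNl. Qed.
Lemma br_pp x y : x \in ppart s -> y \in ppart s -> br x y \in kpart s.
Proof. by move=> /ppartP hx /ppartP hy; apply/kpartP; rewrite s_br hx hy brNl brNr opprK. Qed.

Let ip_eq0 x : ip x x = 0 -> x = 0.
Proof. by move=> h; apply/eqP; apply: contraT => /ip_pos; rewrite h ltxx. Qed.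

Let ipk z x y : z \in kpart s -> ip (br z x) y = - ip x (br z y).
Proof. by move=> zk; apply/eqP; rewrite -addr_eq0; apply/eqP/ip_k. Qed.

Lemma abelian_ideal_eq0 (U : {vspace V}) : is_ideal br U ->
  {in U &, forall x y, br x y = 0} -> U = 0%VS.
Proof.
move=> iU aU; apply: br_semisimple => //; exists 1%N => /=.
apply/eqP; rewrite -subv0; apply/span_subvP => z /allpairsP[[x y] [/= /vbasis_mem xU /vbasis_mem yU ->]].
by rewrite aU// memv0.
Qed.

Lemma center_eq0 x : (forall y, br x y = 0) -> x = 0.
Proof.
move=> h; apply/eqP; rewrite -memv0 -(@abelian_ideal_eq0 <[x]>%VS) ?memv_line//.
  by move=> w y /vlineP[k ->]; rewrite brZr br_anti h oppr0 scaler0 mem0v.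
by move=> u v /vlineP[k ->] _; rewrite brZl h scaler0.
Qed.

Local Notation B := (trace_form br).

Lemma killDl x y z : B (x + y) z = B x z + B y z.
Proof. exact: (trace_formDl brDl). Qed.
Lemma killZl k x z : B (k *: x) z = k * B x z.
Proof. exact: (trace_formZl brZl). Qed.
Lemma killC x y : B x y = B y x. Proof. exact: trace_formC. Qed.
Lemma kill_inv z x y : B (br z x) y = - B x (br z y).
Proof. exact: (trace_form_invariant br_linear br_jacobi). Qed.
Lemma kill_inv' x z y : B (br x z) y = B x (br z y).
Proof. by rewrite br_anti (formNl killZl) kill_inv opprK. Qed.
Lemma kill_s x y : B (s x) (s y) = B x y.
Proof.
have sL : linear s by move=> k u v; rewrite linearP.
by apply: (trace_form_aut br_linear sL sL) => //; exact: ss.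
Qed.

Lemma kill_kp x y : x \in kpart s -> y \in ppart s -> B x y = 0.
Proof.
move=> /kpartP hx /ppartP hy; have := kill_s x y; rewrite hx hy (formNr killZl killC).
by move=> h; lra.
Qed.

(** [ad x] is skew for [ip], so the trace of its square is minus the sum of the squared lengths of
    [br x (e l)]; if this is zero then [x] is central. *)
Lemma kill_neg x : x \in kpart s -> x != 0 -> B x x < 0.
Proof.
move=> xk x0; have F0 : forall T : 'End(V), set0 T -> forall x y, ip (T x) y = ip x (T y) by [].
have [e [eo _]] := common_eigenbasis ipDl ipZl ipC ip_pos F0 (fun _ _ h => False_ind _ h).
have lc : linear (br x \o br x) by move=> k u v; rewrite /= !br_linear.
rewrite (trace_form_comp br_linear) (orthonormal_trace ipDl ipZl eo lc).
rewrite -oppr_gt0 -sumrN; under eq_bigr => i _ do rewrite /= ipk// opprK.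
rewrite lt_def sumr_ge0 ?andbT; last first.
  move=> i _; have [->|/ip_pos/ltW//] := eqVneq (br x (e i)) 0.
  by rewrite (form0l ipZl).
apply: contraNneq x0 => /psumr_eq0P h; apply/eqP/center_eq0 => y.
rewrite (orthonormal_expand ipDl ipZl eo y) -[br x]/(br x : V -> V).
have -> : br x (\sum_l ip y (e l) *: e l) = \sum_l ip y (e l) *: br x (e l).
  by rewrite linear_sumr; apply: eq_bigr => l _; rewrite brZr.
rewrite big1// => l _; rewrite (_ : br x (e l) = 0) ?scaler0//.
apply: ip_eq0; apply: h => // i _.
have [->|/ip_pos/ltW//] := eqVneq (br x (e i)) 0.
by rewrite (form0l ipZl).
Qed.

Lemma kill_k_eq0 x : x \in kpart s -> B x x = 0 -> x = 0.
Proof. by move=> xk h; apply/eqP; apply: contraT => /(kill_neg xk); rewrite h ltxx. Qed.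

(** For [u] in the radical, [u + s u] is in the radical and in [k], hence 0 because the form is
    negative on [k]. So [s] is -1 on the radical; it both fixes and negates brackets of two radical
    elements, and the radical is an abelian ideal. *)
Lemma kill_nondeg x : (forall y, B x y = 0) -> x = 0.
Proof.
pose l (x : V) : V := \row_j B x (delta_mx 0 j).
have lL : linear l by move=> k u v; apply/rowP => j; rewrite !mxE killDl killZl.
pose ll : {linear V -> V} := HB.pack l (GRing.isLinear.Build R V V _ l lL).
pose U := lker (linfun ll).
have UP u : reflect (forall y, B u y = 0) (u \in U).
  rewrite memv_ker lfunE /=; apply: (iffP eqP) => [h y|h].
    rewrite (row_sum_delta y) (form_sumr killDl killZl killC) big1// => j _.
    by have := congr1 (fun v : V => v 0 j) h; rewrite !mxE => ->; rewrite mulr0.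
  by apply/rowP => j; rewrite !mxE h.
have sU u : u \in U -> s u = - u.
  move=> /UP hu; have su y : B (s u) y = 0 by rewrite -(ss y) kill_s hu.
  apply/eqP; rewrite -addr_eq0 addrC; apply/eqP/kill_k_eq0.
    by apply/kpartP; rewrite linearD /= ss addrC.
  by rewrite killDl hu su addr0.
suff U0 : U = 0%VS by move=> /UP; rewrite -/U U0 memv0 => /eqP.
have iU : is_ideal br U by move=> u v /UP hv; apply/UP => y; rewrite kill_inv hv oppr0.
apply: abelian_ideal_eq0 => // u v uU vU.
have := sU _ (iU u v vU); rewrite s_br !sU// brNl brNr opprK => h.
by apply/rowP => i; move: (congr1 (fun w : V => w 0 i) h); rewrite !mxE; lra.
Qed.

Lemma kill_uniq x x' : (forall y, B x y = B x' y) -> x = x'.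
Proof.
move=> h; apply/eqP; rewrite -subr_eq0; apply/eqP/kill_nondeg => y.
by rewrite (formBl killDl killZl) h subrr.
Qed.

Let Gip : 'M[R]_n := \matrix_(i, j) ip (delta_mx 0 i) (delta_mx 0 j).
Let GB : 'M[R]_n := \matrix_(i, j) B (delta_mx 0 i) (delta_mx 0 j).

Let gramE (F : V -> V -> R) (FDl : forall x y z, F (x + y) z = F x z + F y z)
    (FZl : forall c x z, F (c *: x) z = c * F x z) (FC : forall x y, F x y = F y x) x y :
  F x y = \sum_j (x *m (\matrix_(i, j) F (delta_mx 0 i) (delta_mx 0 j) : 'M[R]_n)) 0 j * y 0 j.
Proof.
rewrite {1}(row_sum_delta y) (form_sumr FDl FZl FC); apply: eq_bigr => j _.
rewrite mulrC mxE; congr (_ * _).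
by rewrite {1}(row_sum_delta x) (form_suml FDl FZl); apply: eq_bigr => i _; rewrite mxE.
Qed.

Let GB_unit : GB \in unitmx.
Proof.
rewrite -row_free_unit; apply: inj_row_free => v vG; apply: kill_nondeg => y.
by rewrite (gramE killDl killZl killC) -/GB vG big1// => j _; rewrite mxE mul0r.
Qed.

(** The operator that represents [ip] through the Killing form. On [p] its signs distinguish compact
    from noncompact factors. *)
Definition gram_op (x : V) : V := x *m (Gip *m invmx GB).
Local Notation S := gram_op.

Lemma gram_opP x y : B (S x) y = ip x y.
Proof.
rewrite (gramE killDl killZl killC) -/GB (gramE ipDl ipZl ipC) -/Gip /S mulmxA.
by rewrite -[_ *m invmx GB *m GB]mulmxA mulVmx// mulmx1.
Qed.

Lemma gram_op_eq0 x : S x = 0 -> x = 0.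
Proof. by move=> h; apply: ip_eq0; rewrite -gram_opP h (form0l killZl). Qed.

Lemma gram_op_br z x : z \in kpart s -> S (br z x) = br z (S x).
Proof. by move=> zk; apply: kill_uniq => y; rewrite gram_opP kill_inv gram_opP ipk. Qed.

Lemma gram_op_s x : S (s x) = s (S x).
Proof.
apply: kill_uniq => y; rewrite gram_opP -[y in RHS]ss kill_s gram_opP.
by rewrite -[in RHS]ip_s ss.
Qed.

Lemma gram_op_p x : x \in ppart s -> S x \in ppart s.
Proof. by move=> /ppartP h; apply/ppartP; rewrite -gram_op_s h /S mulNmx. Qed.

(** Both sides lie in [k], so testing against [k] is enough; there the Killing form turns [S] into
    [ip], for which [ad] of [k] is skew. *)
Lemma gram_op_swap x y : x \in ppart s -> y \in ppart s -> br (S x) y = br x (S y).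
Proof.
move=> xp yp; apply/eqP; rewrite -subr_eq0; apply/eqP/kill_nondeg => w.
have k1 : br (S x) y - br x (S y) \in kpart s.
  by apply: rpredB; apply: br_pp => //; exact: gram_op_p.
rewrite (kproj_pproj w) (formDr killDl killC) (kill_kp k1 (pprojP w)) addr0.
set z := kproj w; have zk := kprojP w.
rewrite (formBl killDl killZl) kill_inv' gram_opP kill_inv gram_opP.
rewrite (br_anti y z) (formNr ipZl ipC) -ipk// (br_anti x z) (formNr ipZl ipC) opprK.
by rewrite ipC subrr.
Qed.

(** Jacobi for [S x], [y], [w], with [S] moved across brackets, gives three relations between the
    cyclic permutations of both sides. Together with the Jacobi identity under [S] they form a
    linear system that forces equality. *)
Lemma gram_op_triple x y w : x \in ppart s -> y \in ppart s -> w \in ppart s ->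
  br (br (S x) y) w = S (br (br x y) w).
Proof.
pose T x y w := br (br (S x) y) w; pose r x y w := S (br (br x y) w).
have SN u : S (- u) = - S u by rewrite /S mulNmx.
have SD u v : S (u + v) = S u + S v by rewrite /S mulmxDl.
have rel x' y' w' : x' \in ppart s -> y' \in ppart s -> w' \in ppart s ->
    T x' y' w' + r y' w' x' + T w' x' y' = 0.
  move=> xp yp wp; rewrite /T /r gram_op_br; last exact: br_pp.
  have := br_jacobi (S x') y' w'; rewrite (gram_op_swap wp xp) => h.
  rewrite [br (br y' w') _]br_anti h [br y' _]br_anti (br_anti w' (S x')) brNl.
  by rewrite opprD opprK addrA subrr add0r addrN.
have cyc x' y' w' : r x' y' w' + r y' w' x' + r w' x' y' = 0.
  have [_ h] := br_lie; rewrite /r -!SD (_ : _ + _ + _ = 0) /S ?mul0mx//.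
  have := h x' y' w'; rewrite (br_anti x' (br y' w')) (br_anti y' (br w' x')) (br_anti w' (br x' y')).
  move=> e; apply/rowP => i; move: (congr1 (fun v : V => v 0 i) e); rewrite !mxE; lra.
move=> xp yp wp; rewrite -/(T x y w) -/(r x y w).
have := rel _ _ _ xp yp wp; have := rel _ _ _ yp wp xp; have := rel _ _ _ wp xp yp.
have := cyc x y w.
move: (T x y w) (T y w x) (T w x y) (r x y w) (r y w x) (r w x y) => t1 t2 t3 r1 r2 r3 h0 h1 h2 h3.
apply/rowP => i; have e (u : V) : u = 0 -> u 0 i = 0 by move=> ->; rewrite mxE.
by move: (e _ h0) (e _ h1) (e _ h2) (e _ h3); rewrite !mxE; lra.
Qed.

(** Original and dual bracket have the same commuting pairs in [p], so [a] can be studied in the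
    dual. Definiteness of the Killing form on [k] reduces each direction to the triple identity. *)
Lemma br_S_eq0 x y : x \in ppart s -> y \in ppart s -> br (S x) y = 0 <-> br x y = 0.
Proof.
move=> xp yp; have Sxp := gram_op_p xp; split=> h.
  apply: kill_k_eq0; first exact: br_pp.
  rewrite kill_inv'; set w := br x y; have wk : w \in kpart s by exact: br_pp.
  have -> : br y w = 0; last by rewrite killC (form0l killZl).
  have := gram_op_triple xp yp yp; rewrite h br0l => /esym/gram_op_eq0.
  by rewrite br_anti => /eqP; rewrite oppr_eq0 => /eqP.
apply: kill_k_eq0; first exact: br_pp.
rewrite kill_inv'; set w := br (S x) y.
have -> : br y w = 0; last by rewrite killC (form0l killZl).
rewrite br_anti gram_op_triple// h br0l /S mul0mx oppr0//.
Qed.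

(* The bracket of the noncompact dual: [k] keeps its bracket, and the bracket
   of [p] with itself is rescaled so that [ad] of elements of [p] becomes
   symmetric for [dual_form]. *)
Definition dual_bracket : V -> V -> V := locked (fun u v =>
  br (kproj u) v + br (pproj u) (kproj v) + br (S (pproj u)) (pproj v)).
Local Notation db := dual_bracket.

Lemma dual_bracketE u v :
  db u v = br (kproj u) v + br (pproj u) (kproj v) + br (S (pproj u)) (pproj v).
Proof. by rewrite /dual_bracket -lock. Qed.

(** On [k] minus the Killing form is taken, not [ip]: combined with [S] in the bracket of [p], this
    makes [ad h] symmetric for [h] in [p]. *)
Definition dual_form (u v : V) : R := - B (kproj u) (kproj v) + ip (pproj u) (pproj v).
Local Notation Q := dual_form.

Let kD x y : kproj (x + y) = kproj x + kproj y.
Proof. by have := kprojL 1 x y; rewrite !scale1r. Qed.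
Let pD x y : pproj (x + y) = pproj x + pproj y.
Proof. by have := pprojL 1 x y; rewrite !scale1r. Qed.
Let k0 : kproj 0 = 0. Proof. by rewrite kproj_id// mem0v. Qed.
Let p0 : pproj 0 = 0. Proof. by rewrite pproj_id// mem0v. Qed.
Let kZ c x : kproj (c *: x) = c *: kproj x.
Proof. by have := kprojL c x 0; rewrite k0 !addr0. Qed.
Let pZ c x : pproj (c *: x) = c *: pproj x.
Proof. by have := pprojL c x 0; rewrite p0 !addr0. Qed.
Let SD x y : S (x + y) = S x + S y. Proof. by rewrite /S mulmxDl. Qed.
Let SZ c x : S (c *: x) = c *: S x. Proof. by rewrite /S scalemxAl. Qed.

Lemma dbDl x y z : db (x + y) z = db x z + db y z.
Proof. by rewrite !dual_bracketE kD pD SD !brDl; apply/rowP => i; rewrite !mxE; ring. Qed.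
Lemma dbDr x y z : db z (x + y) = db z x + db z y.
Proof. by rewrite !dual_bracketE kD pD !brDr; apply/rowP => i; rewrite !mxE; ring. Qed.
Lemma dbZl c x z : db (c *: x) z = c *: db x z.
Proof. by rewrite !dual_bracketE kZ pZ SZ !brZl -!scalerDr. Qed.
Lemma dbZr c x z : db z (c *: x) = c *: db z x.
Proof. by rewrite !dual_bracketE kZ pZ !brZr -!scalerDr. Qed.
Lemma db_linear x : linear (db x). Proof. by move=> k y z; rewrite dbDr dbZr. Qed.

Lemma db_k z v : z \in kpart s -> db z v = br z v.
Proof. by move=> zk; rewrite !dual_bracketE kproj_id// pproj_k// br0l /S mul0mx br0l !addr0. Qed.
Lemma db_pk x z : x \in ppart s -> z \in kpart s -> db x z = br x z.
Proof. by move=> xp zk; rewrite !dual_bracketE kproj_p// pproj_id// (pproj_k zk) kproj_id// br0l br0r add0r addr0. Qed.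
Lemma db_pp x y : x \in ppart s -> y \in ppart s -> db x y = br (S x) y.
Proof. by move=> xp yp; rewrite !dual_bracketE kproj_p// !pproj_id// (kproj_p yp) br0l br0r !add0r. Qed.

Lemma db_anti x y : db x y = - db y x.
Proof.
have e u v : br (kproj u) v = br (kproj u) (kproj v) + br (kproj u) (pproj v).
  by rewrite -brDr -kproj_pproj.
rewrite !dual_bracketE (e x y) (e y x).
rewrite (br_anti (kproj x) (kproj y)) (br_anti (kproj x) (pproj y)) (br_anti (pproj x) (kproj y)).
rewrite (gram_op_swap (pprojP x) (pprojP y)) (br_anti (pproj x) (S _)).
by apply/rowP => i; rewrite !mxE; ring.
Qed.

(** Splitting the arguments along [k] and [p]: as soon as one lies in [k], the identity follows from
    that of [br], since [S] commutes with [ad] of [k] and moves across brackets of [p]. For three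
    arguments in [p] the triple identity makes it the image under [S] of the original one. *)
Lemma db_jacobi x y z : db x (db y z) = db (db x y) z + db y (db x z).
Proof.
have jk z' x' y' : z' \in kpart s -> db z' (db x' y') = db (db z' x') y' + db x' (db z' y').
  move=> zk; rewrite !(db_k _ zk).
  suff : br z' (db (kproj x' + pproj x') y') = db (br z' (kproj x' + pproj x')) y' +
      db (kproj x' + pproj x') (br z' y') by rewrite -kproj_pproj.
  rewrite dbDl !brDr !dbDl !(db_k _ (kprojP x')) (db_k _ (br_kk zk (kprojP x'))) br_jacobi.
  have xp := pprojP x'; have zxp := br_kp zk xp.
  suff h w : br z' (db (pproj x') w) = db (br z' (pproj x')) w + db (pproj x') (br z' w).
    by rewrite h; apply/rowP => i; rewrite !mxE; ring.
  suff : br z' (db (pproj x') (kproj w + pproj w)) = db (br z' (pproj x')) (kproj w + pproj w) +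
      db (pproj x') (br z' (kproj w + pproj w)) by rewrite -kproj_pproj.
  rewrite !dbDr !brDr !dbDr.
  have wk := kprojP w; have wp := pprojP w.
  rewrite (db_pk xp wk) (db_pp xp wp) (db_pk zxp wk) (db_pp zxp wp) (db_pk xp (br_kk zk wk)) (db_pp xp (br_kp zk wp)).
  rewrite (br_jacobi z' (pproj x')) (br_jacobi z' (S _)) gram_op_br//.
  by apply/rowP => i; rewrite !mxE; ring.
have jpk x' z' y' : z' \in kpart s -> db x' (db z' y') = db (db x' z') y' + db z' (db x' y').
  move=> zk; rewrite (jk z' x' y' zk) (db_anti x' z') -scaleN1r dbZl scaleN1r.
  by rewrite addrA addNr add0r.
have jpp x' y' z' : x' \in ppart s -> y' \in ppart s ->
    db x' (db y' z') = db (db x' y') z' + db y' (db x' z').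
  move=> xp yp.
  suff : db x' (db y' (kproj z' + pproj z')) = db (db x' y') (kproj z' + pproj z') +
      db y' (db x' (kproj z' + pproj z')) by rewrite -kproj_pproj.
  rewrite !dbDr.
  have zk := kprojP z'; have zp := pprojP z'; have xyk := br_pp (gram_op_p xp) yp.
  rewrite (db_pk yp zk) (db_pp yp zp) (db_pk xp zk) (db_pp xp zp) (db_pp xp yp).
  rewrite (db_k (kproj z') xyk) (db_k (pproj z') xyk).
  rewrite (db_pp xp (br_pk yp zk)) (db_pp yp (br_pk xp zk)).
  rewrite (db_pk xp (br_pp (gram_op_p yp) zp)) (db_pk yp (br_pp (gram_op_p xp) zp)).
  rewrite (br_jacobi (S x')) (gram_op_swap yp (br_pk xp zk)) -[S (br x' _)]opprK.
  have -> : - S (br x' (kproj z')) = - br (S x') (kproj z').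
    by congr (- _); rewrite (br_anti x') (br_anti (S x')) -gram_op_br// /S mulNmx.
  rewrite opprK.
  suff : br x' (br (S y') (pproj z')) = br (br (S x') y') (pproj z') + br y' (br (S x') (pproj z')).
    by move=> ->; apply/rowP => i; rewrite !mxE; ring.
  set w := pproj z' in zp *.
  rewrite (br_anti x' (br (S y') w)) (br_anti y' (br (S x') w)).
  rewrite (gram_op_triple yp zp xp) (gram_op_triple xp yp zp) (gram_op_triple xp zp yp).
  have j := br_jacobi x' y' w; rewrite (br_anti x' (br y' w)) (br_anti y' (br x' w)) in j.
  have SN u : S (- u) = - S u by rewrite /S mulNmx.
  by rewrite -!SN -SD j.
have jp x' y' z' : x' \in ppart s -> db x' (db y' z') = db (db x' y') z' + db y' (db x' z').
  move=> xp; pose J v := db x' (db v z') - (db (db x' v) z' + db v (db x' z')).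
  have JD u v : J (u + v) = J u + J v.
    by rewrite /J !(dbDl, dbDr); apply/rowP => i; rewrite !mxE; ring.
  apply/eqP; rewrite -subr_eq0 -/(J y') [y' in J y'](kproj_pproj y') JD /J (jpk _ _ _ (kprojP y')).
  by rewrite (jpp _ _ _ xp (pprojP y')) !subrr addr0.
pose J v := db v (db y z) - (db (db v y) z + db y (db v z)).
have JD u v : J (u + v) = J u + J v.
  by rewrite /J !(dbDl, dbDr); apply/rowP => i; rewrite !mxE; ring.
apply/eqP; rewrite -subr_eq0 -/(J x) [x in J x](kproj_pproj x) JD /J (jk _ _ _ (kprojP x)).
by rewrite (jp _ _ _ (pprojP x)) !subrr addr0.
Qed.

Lemma dual_formDl x y z : Q (x + y) z = Q x z + Q y z.
Proof. by rewrite /Q kD pD killDl ipDl; ring. Qed.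
Lemma dual_formZl c x z : Q (c *: x) z = c * Q x z.
Proof. by rewrite /Q kZ pZ killZl ipZl; ring. Qed.
Lemma dual_formC x y : Q x y = Q y x. Proof. by rewrite /Q killC ipC. Qed.
Lemma dual_form_pos x : x != 0 -> 0 < Q x x.
Proof.
move=> x0; rewrite /Q.
have p1 : 0 <= ip (pproj x) (pproj x).
  by have [->|/ip_pos/ltW//] := eqVneq (pproj x) 0; rewrite (form0l ipZl).
have [h|/(kill_neg (kprojP x))] := eqVneq (kproj x) 0; last by lra.
rewrite h (form0l killZl) oppr0 add0r ip_pos//; apply: contraNN x0 => /eqP h2.
by rewrite (kproj_pproj x) h h2 addr0.
Qed.

Lemma db_sym h u v : h \in ppart s -> Q (db h u) v = Q u (db h v).
Proof.
move=> hp; have half w w' : Q (db h w) w' = ip (br h (kproj w')) (pproj w) + ip (br h (kproj w)) (pproj w').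
  rewrite (_ : db h w = db h (kproj w + pproj w)); last by rewrite -kproj_pproj.
  rewrite dbDr dual_formDl (db_pk hp (kprojP w)) (db_pp hp (pprojP w)).
  rewrite addrC {1 2}/Q.
  rewrite (kproj_p (br_pk hp (kprojP w))) (pproj_id (br_pk hp (kprojP w))) (form0l killZl) oppr0 add0r.
  have bk := br_pp (gram_op_p hp) (pprojP w).
  rewrite (kproj_id bk) (pproj_k bk) (form0l ipZl) addr0; congr (_ + _).
  rewrite kill_inv' gram_opP (br_anti (pproj w)) (formNr ipZl ipC) opprK.
  by rewrite (br_anti h) (formNl ipZl) ipk ?kprojP// opprK.
by rewrite half [RHS]dual_formC half addrC [in RHS]addrC [LHS]addrC.
Qed.

(** Translates the first-order condition of the maximization over [K] into the dual bracket. *)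
Lemma db_kform h w z : h \in ppart s -> w \in ppart s -> z \in kpart s ->
  Q (db h w) z = - ip (br z h) w.
Proof.
move=> hp wp zk; rewrite (db_pp hp wp) /Q; have bk := br_pp (gram_op_p hp) wp.
rewrite (kproj_id bk) (pproj_k bk) (form0l ipZl) addr0 (kproj_id zk) kill_inv' gram_opP.
by rewrite (br_anti w) (formNr ipZl ipC) opprK ipk// opprK.
Qed.

Definition symmetric_automorphism (f : V -> V) : Prop :=
  [/\ linear f, forall x y, f (br x y) = br (f x) (f y), forall x, f (s x) = s (f x)
    & forall x y, ip (f x) (f y) = ip x y].

Section Automorphism.
Variables f g : V -> V.
Hypotheses (fA : symmetric_automorphism f) (gA : symmetric_automorphism g).
Hypotheses (fK : cancel f g) (gK : cancel g f).

Let fL : linear f. Proof. by case: fA. Qed.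
Let gL : linear g. Proof. by case: gA. Qed.
Let fbr x y : f (br x y) = br (f x) (f y). Proof. by case: fA. Qed.
Let fs x : f (s x) = s (f x). Proof. by case: fA. Qed.
Let fip x y : ip (f x) (f y) = ip x y. Proof. by case: fA. Qed.
Let fD x y : f (x + y) = f x + f y. Proof. by have := fL 1 x y; rewrite !scale1r. Qed.
Let f0 : f 0 = 0. Proof. by have := fL (-1) 0 0; rewrite !scaleN1r !addNr. Qed.
Let fZ k x : f (k *: x) = k *: f x. Proof. by have := fL k x 0; rewrite f0 !addr0. Qed.
Let fN x : f (- x) = - f x. Proof. by rewrite -scaleN1r fZ scaleN1r. Qed.

Lemma aut_p x : x \in ppart s -> f x \in ppart s.
Proof. by move=> /ppartP h; apply/ppartP; rewrite -fs h fN. Qed.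

Let f_kproj x : kproj (f x) = f (kproj x). Proof. by rewrite /kproj fZ fD fs. Qed.
Let f_pproj x : pproj (f x) = f (pproj x). Proof. by rewrite /pproj fZ fD fN fs. Qed.
Let f_kill x y : B (f x) (f y) = B x y.
Proof. exact: (trace_form_aut br_linear fL gL gK fbr). Qed.
Let f_S x : S (f x) = f (S x).
Proof. by apply: kill_uniq => y; rewrite gram_opP -[y]gK f_kill fip gram_opP. Qed.

Lemma aut_dual_bracket x y : f (db x y) = db (f x) (f y).
Proof. by rewrite !dual_bracketE !fD !fbr !f_kproj !f_pproj f_S. Qed.

Lemma aut_dual_form x y : Q (f x) (f y) = Q x y.
Proof. by rewrite /Q !f_kproj !f_pproj f_kill fip. Qed.

Lemma aut_root_form x y : trace_form db (f x) (f y) = trace_form db x y.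
Proof. exact: (trace_form_aut db_linear fL gL gK aut_dual_bracket). Qed.

End Automorphism.

Lemma root_formDl x y z : trace_form db (x + y) z = trace_form db x z + trace_form db y z.
Proof. exact: (trace_formDl dbDl). Qed.
Lemma root_formZl k x z : trace_form db (k *: x) z = k * trace_form db x z.
Proof. exact: (trace_formZl dbZl). Qed.

(** * Roots and chambers of a maximal abelian subspace *)

Section Roots.
Variable a : {vspace V}.
Hypothesis a_max : is_maximal_abelian_in br (ppart s) a.

Let ap h : h \in a -> h \in ppart s. Proof. by case: a_max => /subvP + _ _; apply. Qed.
Let a_br h h' : h \in a -> h' \in a -> br h h' = 0. Proof. by case: a_max => _ + _; apply. Qed.

Lemma db_abelian h h' : h \in a -> h' \in a -> db h h' = 0.
Proof. by move=> ha ha'; rewrite (db_pp (ap ha) (ap ha')); apply/(br_S_eq0 (ap ha) (ap ha'))/a_br. Qed.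

Lemma centralizer_in_a x : x \in ppart s -> (forall h, h \in a -> br h x = 0) -> x \in a.
Proof.
move=> xp hx; have [aP _ amax] := a_max.
suff <- : (a + <[x]>)%VS = a by apply: subvP (addvSr _ _) _ (memv_line x).
apply: amax; first by rewrite addvSl subv_add aP -memvE.
have xx : br x x = 0 by case: br_lie.
move=> _ _ /memv_addP[u ua [_ /vlineP[k ->] ->]] /memv_addP[v va [_ /vlineP[l ->] ->]].
rewrite brDl !brDr (a_br ua va) !brZr !brZl hx// xx (br_anti x v) hx//.
by rewrite oppr0 !scaler0 !addr0.
Qed.

(** In the dual the operators [ad h] for [h] in [a] are symmetric and commute by Jacobi. The basis
    is the root decomposition, with roots repeated by multiplicity and the zero root included. *)
Lemma root_basis : exists e : 'I_n -> V, (forall i j, Q (e i) (e j) = (i == j)%:R) /\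
  forall h i, h \in a -> db h (e i) = Q (db h (e i)) (e i) *: e i.
Proof.
pose F : set 'End(V) := [set T | exists2 h, h \in a & forall x, T x = db h x].
have FE h : h \in a -> exists2 T, F T & forall x, T x = db h x.
  move=> ha; pose dh : {linear V -> V} := HB.pack (db h) (GRing.isLinear.Build R V V _ (db h) (db_linear h)).
  by exists (linfun dh); [exists h => // x; rewrite lfunE|move=> x; rewrite lfunE].
have [||e [eo eF]] := @common_eigenbasis _ _ Q dual_formDl dual_formZl dual_formC dual_form_pos F.
- by move=> T [h ha hT] x y; rewrite !hT db_sym//; exact: ap.
- move=> T T' [h ha hT] [h' ha' hT'] x; rewrite !(hT, hT') db_jacobi (db_abelian ha ha').
  by rewrite -{1}[0](scale0r (0 : V)) dbZl scale0r add0r.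
exists e; split=> // h i ha; have [T FT hT] := FE h ha.
have [mu eE] := eF T i FT; rewrite -hT eE dual_formZl eo eqxx mulr1.
by [].
Qed.

Variable e : 'I_n -> V.
Hypothesis e_orth : forall i j, Q (e i) (e j) = (i == j)%:R.
Definition root (i : 'I_n) (h : V) : R := Q (db h (e i)) (e i).
Hypothesis e_root : forall h i, h \in a -> db h (e i) = root i h *: e i.

Let expand v : v = \sum_l Q v (e l) *: e l.
Proof. exact: (orthonormal_expand dual_formDl dual_formZl). Qed.

Lemma rootD i h h' : root i (h + h') = root i h + root i h'.
Proof. by rewrite /root dbDl dual_formDl. Qed.
Lemma rootZ i k h : root i (k *: h) = k * root i h.
Proof. by rewrite /root dbZl dual_formZl. Qed.

Lemma dual_form_parseval x y : Q x y = \sum_l Q x (e l) * Q y (e l).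
Proof.
rewrite {1}(expand y) (form_sumr dual_formDl dual_formZl dual_formC).
by apply: eq_bigr => l _; rewrite mulrC.
Qed.

(** The matrix of [ad (e j)] in the dual, acting on columns of coordinates, unlike [lin1_mx]. *)
Definition structure_matrix (j : 'I_n) : 'M[R]_n := \matrix_(l, i) Q (db (e j) (e i)) (e l).
Local Notation X := structure_matrix.

Lemma structure_matrix_root h j l i : h \in a -> X j l i != 0 -> root l h = root i h + root j h.
Proof.
move=> ha; rewrite mxE => nz; apply: (mulIf nz).
rewrite -[LHS](formZr dual_formZl dual_formC) -(@e_root h l ha) -(db_sym _ _ (ap ha)).
rewrite db_jacobi (@e_root h j ha) (@e_root h i ha) dbZl dbZr dual_formDl !dual_formZl.
by rewrite addrC -mulrDl.
Qed.

Lemma structure_matrix_closed j k : X j *m X k - X k *m X j = \sum_l X j l k *: X l.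
Proof.
have P j' k' p q : (X j' *m X k') p q = Q (db (e j') (db (e k') (e q))) (e p).
  rewrite mxE [db (e k') _ in RHS]expand.
  have -> : db (e j') (\sum_l Q (db (e k') (e q)) (e l) *: e l) =
      \sum_l Q (db (e k') (e q)) (e l) *: db (e j') (e l).
    elim/big_ind2: _ => [|u u' v v' <- <-|l _]; rewrite ?dbDr ?dbZr//.
    by rewrite -{1}[0](scale0r (0 : V)) dbZr scale0r.
  rewrite (form_suml dual_formDl dual_formZl); apply: eq_bigr => l _.
  by rewrite !mxE mulrC.
apply/matrixP => p q; rewrite mxE [in X in _ + X]mxE !P db_jacobi dual_formDl addrK.
rewrite summxE [db (e j) (e k)]expand.
have -> : db (\sum_l Q (db (e j) (e k)) (e l) *: e l) (e q) =
    \sum_l Q (db (e j) (e k)) (e l) *: db (e l) (e q).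
  elim/big_ind2: _ => [|u u' v v' <- <-|l _]; rewrite ?dbDl ?dbZl//.
  by rewrite -{1}[0](scale0r (0 : V)) dbZl scale0r.
rewrite (form_suml dual_formDl dual_formZl); apply: eq_bigr => l _.
by rewrite !mxE.
Qed.

Lemma root_formE h v : h \in a -> trace_form db h v = \sum_i root i h * root i v.
Proof.
move=> ha; rewrite (trace_form_comp db_linear).
have lc : linear (db v \o db h) by move=> k y z; rewrite /= !db_linear.
rewrite (orthonormal_trace dual_formDl dual_formZl e_orth lc).
by apply: eq_bigr => i _; rewrite /= e_root// dbZr dual_formZl.
Qed.

(** If all roots vanish at [h], the dual bracket with [h] is zero; this passes to [br], and the
    center is trivial. *)
Lemma root_eq0 h : h \in a -> (forall i, root i h = 0) -> h = 0.
Proof.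
move=> ha h0; have dh v : db h v = 0.
  rewrite (expand v); elim/big_ind: _ => [|u v' hu hv|l _].
  - by rewrite -{1}[0](scale0r (0 : V)) dbZr scale0r.
  - by rewrite dbDr hu hv addr0.
  - by rewrite dbZr e_root// h0 scale0r scaler0.
apply: center_eq0 => y; rewrite (kproj_pproj y) brDr.
rewrite -(db_pk (ap ha) (kprojP y)) dh add0r.
apply/(br_S_eq0 (ap ha) (pprojP y)); rewrite -(db_pp (ap ha) (pprojP y)); exact: dh.
Qed.

Lemma root_form_pos h : h \in a -> h != 0 -> 0 < trace_form db h h.
Proof.
move=> ha h0; rewrite root_formE// lt_def sumr_ge0 ?andbT => [|i _]; last by rewrite -expr2 sqr_ge0.
apply: contraNneq h0 => /psumr_eq0P h0; apply/eqP/root_eq0 => // i.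
by apply/eqP; rewrite -sqrf_eq0 expr2; apply/eqP/h0 => // j _; rewrite -expr2 sqr_ge0.
Qed.

(** Basis vectors that commute with [a] have the zero root, so vanishing at [r] is compared with
    vanishing on [a]. *)
Definition regular (r : V) := r \in a /\
  forall i, root i r = 0 -> forall h, h \in a -> root i h = 0.

Lemma near_regular z r : z \in a -> regular r -> \forall t \near 0^'+, regular (z + t *: r).
Proof.
move=> za [ra rr].
have h : \forall t \near (0 : R)^'+, forall i, root i z + t * root i r = 0 -> root i r = 0.
  apply: filter_forall => i; have [->|r0] := eqVneq (root i r) 0.
    by near=> t.
  have [z0|z0] := eqVneq (root i z) 0.
    near=> t; rewrite z0 add0r => /eqP; rewrite mulf_eq0 => /orP[/eqP t0|/eqP//].
    suff : 0 < t by rewrite t0 ltxx.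
    by near: t; exact: nbhs_right_gt.
  have q0 : 0 < `|root i z| / `|root i r| by rewrite divr_gt0 ?normr_gt0.
  near=> t.
  have tlt : t < `|root i z| / `|root i r| by near: t; exact: nbhs_right_lt.
  have t0 : 0 < t by near: t; exact: nbhs_right_gt.
  move=> /eqP; rewrite addr_eq0 => /eqP E; exfalso; move: tlt.
  by rewrite E normrN normrM mulfK ?normr_eq0// gtr0_norm// ltxx.
near=> t; split; first by apply: memvD => //; exact: memvZ.
move=> i; rewrite rootD rootZ => E h' ha'; apply: rr => //.
by move: i E; near: t.
Unshelve. all: by end_near. Qed.

(** Take [r] with the largest number of nonzero roots: if a root vanished at [r] but not at [h], a
    small step in the direction [h] would gain one more. *)
Lemma ex_regular : exists r, regular r.
Proof.
pose N r := #|[pred i | root i r != 0]|.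
have ex : exists m, `[< exists2 r, r \in a & N r = m >].
  by exists (N 0); apply/asboolP; exists 0; rewrite ?mem0v.
have bd m : `[< exists2 r, r \in a & N r = m >] -> (m <= n)%N.
  by move=> /asboolP[r _ <-]; rewrite -[X in (_ <= X)%N](card_ord n); exact: max_card.
case: (ex_maxnP ex bd) => m /asboolP[r ra rm] mmax; exists r; split=> // i ri h ha.
apply/eqP; apply: contraT => hi.
have hn : \forall t \near (0 : R)^'+, forall j, root j r != 0 -> root j r + t * root j h != 0.
  apply: filter_forall => j; have [rj|rj] := eqVneq (root j r) 0; first by near=> t.
  have [hj|hj] := eqVneq (root j h) 0; first by near=> t; rewrite hj mulr0 addr0.
  have q0 : 0 < `|root j r| / `|root j h| by rewrite divr_gt0 ?normr_gt0.
  near=> t.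
  have tlt : t < `|root j r| / `|root j h| by near: t; exact: nbhs_right_lt.
  have t0 : 0 < t by near: t; exact: nbhs_right_gt.
  move=> _; apply/eqP => /eqP; rewrite addr_eq0 => /eqP E; move: tlt.
  by rewrite E normrN normrM mulfK ?normr_eq0// gtr0_norm// ltxx.
have [t [tp tn]] : exists t : R, 0 < t /\ forall j, root j r != 0 -> root j r + t * root j h != 0.
  near (0 : R)^'+ => t; exists t; split; first by near: t; exact: nbhs_right_gt.
  by near: t.
have : (N (r + t *: h)%R <= m)%N.
  by apply: mmax; apply/asboolP; exists (r + t *: h) => //; apply: memvD => //; exact: memvZ.
rewrite leqNgt -rm; case/negP; apply: proper_card; apply/properP; split.
  by apply/fintype.subsetP => j; rewrite !inE rootD rootZ; exact: tn.
by exists i; rewrite !inE ?ri ?eqxx// rootD rootZ ri add0r mulf_neq0// gt_eqF.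
Unshelve. all: by end_near. Qed.

(** In the root basis, [ad r] kills only components whose root vanishes on [a]. So [x] commutes with
    [a], and maximality applies. *)
Lemma regular_centralizer r x : regular r -> x \in ppart s -> db r x = 0 -> x \in a.
Proof.
move=> [ra rr] xp rx; apply: centralizer_in_a => // h ha.
apply/(br_S_eq0 (ap ha) xp); rewrite -(db_pp (ap ha) xp).
have dbE h' : h' \in a -> db h' x = \sum_l (Q x (e l) * root l h') *: e l.
  move=> ha'; rewrite {1}(expand x).
  elim/big_ind2: _ => [|u u' v v' <- <-|l _]; rewrite ?dbDr ?dbZr ?e_root ?scalerA//.
  by rewrite -{1}[0](scale0r (0 : V)) dbZr scale0r.
rewrite dbE// big1// => l _; suff -> : Q x (e l) * root l h = 0 by rewrite scale0r.
have : Q (db r x) (e l) = Q x (e l) * root l r.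
  rewrite dbE// (form_suml dual_formDl dual_formZl) (bigD1 l)//= e_orth eqxx mulr1 big1 ?addr0//.
  by move=> k kl; rewrite e_orth (negbTE kl) mulr0.
rewrite rx (form0l dual_formZl) => /esym/eqP; rewrite mulf_eq0 => /orP[/eqP ->|/eqP /rr ->//].
  by rewrite mul0r.
by rewrite mulr0.
Qed.

(** Write [e i] as [xi + x] along [k] and [p]. Then [br h xi] is [root i h] times [x], so the
    hypothesis at [xi] is the product of the root values times the squared length of [x]. If
    [x = 0], the root vanishes at [r]. *)
Lemma second_order_chamber r z : r \in a -> z \in a ->
  (forall xi, xi \in kpart s -> 0 <= ip (br xi z) (br xi r)) ->
  forall i, 0 <= root i r * root i z.
Proof.
move=> ra za pos i; set x := pproj (e i); set xi := kproj (e i).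
have xik : xi \in kpart s := kprojP _; have xp : x \in ppart s := pprojP _.
have rt h : h \in a -> br h xi = root i h *: x /\ root i h *: xi = br (S h) x.
  move=> ha; have E : root i h *: xi + root i h *: x = br h xi + br (S h) x.
    by rewrite -scalerDr -kproj_pproj -e_root// {1}(kproj_pproj (e i)) dbDr (db_pk (ap ha) xik) (db_pp (ap ha) xp).
  have k1 : root i h *: xi \in kpart s by exact: memvZ.
  have p1 : root i h *: x \in ppart s by exact: memvZ.
  have p2 := br_pk (ap ha) xik; have k2 := br_pp (gram_op_p (ap ha)) xp.
  split.
    by have := congr1 pproj E; rewrite !pD (pproj_k k1) (pproj_k k2) (pproj_id p1) (pproj_id p2) add0r addr0.
  by have := congr1 kproj E; rewrite !kD (kproj_p p1) (kproj_p p2) (kproj_id k1) (kproj_id k2) add0r addr0.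
have [x0|/ip_pos x0] := eqVneq x 0.
  have [_] := rt r ra; rewrite x0 br0r => /eqP; rewrite scaler_eq0 => /orP[/eqP ->|/eqP xi0].
    by rewrite mul0r.
  have := e_orth i i; rewrite (kproj_pproj (e i)) -/x -/xi x0 xi0 addr0 (form0l dual_formZl) eqxx.
  by move/eqP; rewrite eq_sym oner_eq0.
have := pos _ xik; rewrite (br_anti xi z) (br_anti xi r) (formNl ipZl) (formNr ipZl ipC) opprK.
rewrite (rt z za).1 (rt r ra).1 ipZl (formZr ipZl ipC) mulrA pmulr_lge0//.
by rewrite mulrC.
Qed.

(** Comparing signs with those at [r] replaces a choice of positive roots. *)
Definition chamber r : set V := [set z | z \in a /\ forall i, 0 <= root i r * root i z].

Lemma chamber_maximal r z b f g : regular r -> chamber r z -> chamber r b ->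
  symmetric_automorphism f -> symmetric_automorphism g -> cancel f g -> cancel g f ->
  preserves_stable X (\matrix_(l, i) Q (g (e i)) (e l)) ->
  trace_form db z (f b) <= trace_form db z b.
Proof.
move=> [ra rr] [za zr] [ba bR] fA gA fK gK st.
set M := \matrix_(l, i) Q (g (e i)) (e l) in st.
rewrite !root_formE//.
have E i : root i (f b) = \sum_l root l b * M l i ^+ 2.
  rewrite /root -[e i]gK -(aut_dual_bracket fA gA gK) (aut_dual_form fA gA gK).
  rewrite dual_form_parseval; apply: eq_bigr => l _.
  rewrite -/(root l b) (db_sym _ _ (ap ba)) (@e_root b l ba) (formZr dual_formZl dual_formC).
  by rewrite mxE -mulrA -expr2.
under eq_bigr => i _ do rewrite E.
apply: (@kostant_inequality _ _ X (root^~ z) (root^~ b) [set j | root j r < 0]) => //.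
- by move=> j l i; exact: structure_matrix_root.
- by move=> j l i /(structure_matrix_root ba) ->; rewrite addrK.
- exact: structure_matrix_closed.
- by move=> j /= rj; have := bR j; rewrite nmulr_rge0.
- move=> j /= /negP; rewrite -leNgt le_eqVlt => /orP[/eqP rj|rj]; first by rewrite (rr j).
  by have := zr j; rewrite pmulr_rge0.
- apply/matrixP => i j; rewrite !mxE -e_orth -(aut_dual_form gA fA fK) dual_form_parseval.
  by apply: eq_bigr => l _; rewrite !mxE.
Qed.

End Roots.
End SymmetricLieAlgebra.

(** * Derivatives along curves *)

Section CurveCalculus.
Variables (R : realType) (n : nat).
Local Notation V := 'rV[R]_n.

Lemma is_derive_coord (u : R -> V) (t : R) (u' : V) k :
  is_derive t 1 u u' -> is_derive t 1 (fun t => u t 0 k) (u' 0 k).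
Proof.
move=> [ud <-]; have {}ud : differentiable u t by apply/derivable1_diffP.
have [d1 d1E] := diff_coord (1 : R) k ud.
by split; [exact: diff_derivable|rewrite deriveE// d1E deriveE].
Qed.

Lemma is_derive_functional (l : V -> R) (u : R -> V) (t : R) (u' : V) :
  linear (l : V -> R^o) -> is_derive t 1 u u' -> is_derive t 1 (fun t => l (u t)) (l u').
Proof.
move=> ll du; pose L : {linear V -> R^o} := HB.pack l (GRing.isLinear.Build R V R^o _ l ll).
have E v : l v = \sum_i l (delta_mx 0 i) * v 0 i.
  rewrite {1}(row_sum_delta v) -[l]/(L : V -> R^o) linear_sum; apply: eq_bigr => i _.
  by rewrite linearZ mulrC.
rewrite E (_ : (fun t => l (u t)) = (fun t => \sum_i l (delta_mx 0 i) * u t 0 i)); last first.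
  by apply/funext => v; rewrite E.
by apply: is_derive_bigsum => i; exact: (is_deriveZ (l (delta_mx 0 i)) (is_derive_coord i du)).
Qed.

Lemma is_derive_bilinear_form (F : V -> V -> R) (u v : R -> V) (t : R) (u' v' : V) :
  (forall y, linear (F^~ y : V -> R^o)) -> (forall x, linear (F x : V -> R^o)) ->
  is_derive t 1 u u' -> is_derive t 1 v v' ->
  is_derive t 1 (fun t => F (u t) (v t)) (F u' (v t) + F (u t) v').
Proof.
move=> Fl Fr du dv.
have E x y : F x y = \sum_i x 0 i * F (delta_mx 0 i) y.
  pose L : {linear V -> R^o} := HB.pack (F^~ y) (GRing.isLinear.Build R V R^o _ (F^~ y) (Fl y)).
  have -> : F x y = L x by []; rewrite {1}(row_sum_delta x) linear_sum.
  by apply: eq_bigr => i _; rewrite linearZ.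
rewrite (E u') (E (u t) v') -big_split/=.
rewrite (_ : (fun t => F (u t) (v t)) = (fun t => \sum_i u t 0 i * F (delta_mx 0 i) (v t))); last first.
  by apply/funext => w; rewrite E.
apply: is_derive_bigsum => i.
have h := is_deriveM (is_derive_coord i du) (is_derive_functional (Fr (delta_mx 0 i)) dv).
apply: is_derive_eq; rewrite addrC; congr (_ + _); exact: mulrC.
Qed.

Lemma linear_flow_zero (y : R -> V) (A : V -> V) : linear A ->
  (forall (t : R) k, is_derive t 1 (fun t => y t 0 k) (A (y t) 0 k)) -> y 0 = 0 ->
  forall t : R, 0 <= t -> y t = 0.
Proof.
move=> lA dy y0 t t0; apply/rowP => k; rewrite [RHS]mxE.
pose L : {linear V -> V} := HB.pack A (GRing.isLinear.Build R V V _ A lA).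
apply: (@linear_ode_zero R 'I_n (fun k t => y t 0 k) (fun k j => A (delta_mx 0 j) 0 k)) => //.
  move=> i u; have -> : \sum_j A (delta_mx 0 j) 0 i * y u 0 j = A (y u) 0 i; last exact: dy.
  rewrite {2}(row_sum_delta (y u)) -[A]/(L : V -> V) linear_sum summxE.
  by apply: eq_bigr => j _; rewrite linearZ !mxE mulrC.
by move=> i; rewrite y0 mxE.
Qed.

(** A positive second derivative at 0 would make [f'] positive just to the right of 0, where [f]
    would then exceed its maximum. *)
Lemma max_derivatives (f f' : R -> R) (f'' : R) :
  (forall t : R, is_derive t 1 f (f' t)) -> is_derive (0 : R) 1 f' f'' ->
  (forall t, f t <= f 0) -> f' 0 = 0 /\ f'' <= 0.
Proof.
move=> df d2 fmax.
have f'0 : f' 0 = 0.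
  have m : (0 : R) \in `](-1), 1[ by rewrite in_itv/= ltrN10 ltr01.
  have [_ h] := @derive1_at_max R f (-1) 1 0 (le_trans (lerN10 R) ler01) (fun t _ => ex_derive (is_derive := df t))
    m (fun t _ => fmax t).
  by have [_ <-] := df 0.
split=> //; rewrite leNgt; apply/negP => f0.
have [d2d d2E] := d2.
have /cvgrPdist_lt/(_ _ f0) lim : (fun h : R => h^-1 *: ((f' \o shift 0) (h *: 1) - f' 0)) @ 0^' --> f''.
  by rewrite -d2E; exact: d2d.
have /nbhs_ballP[d /= d0 dP] : \forall h \near (0 : R), h != 0 -> `|f'' - h^-1 *: ((f' \o shift 0) (h *: 1) - f' 0)| < f''.
  exact: lim.
have pos h : 0 < h -> h < d -> 0 < f' h.
  move=> h0 hd; have := dP h; rewrite -ball_normE /ball_ /= sub0r normrN gtr0_norm// gt_eqF//.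
  move=> /(_ hd isT); rewrite f'0 subr0 addr0 [h *: 1]mulr1.
  rewrite ltr_norml => /andP[_]; rewrite ltrBlDr ltrDl => h1.
  by move: h1; rewrite [_ *: _]/(_ * _) pmulr_rgt0// invr_gt0.
have d20 : 0 < d / 2 by rewrite divr_gt0.
have [|x] := @MVT R f f' 0 (d / 2) d20.
  by apply: derivable_within_continuous => t _; have [] := df t.
rewrite in_itv/= => /andP[x0 xd] E.
have xd' : x < d by apply: lt_trans xd _; rewrite ltr_pdivrMr// ltr_pMr// ltr1n.
have := pos _ x0 xd'; have := fmax (d / 2); rewrite -subr_le0 E subr0 => h1 h2.
by have := lt_le_trans (mulr_gt0 h2 d20) h1; rewrite ltxx.
Qed.

Lemma linear_lincomb (f : V -> V) (I : finType) (l : I -> R) (u : I -> V) : linear f ->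
  f (\sum_i l i *: u i) = \sum_i l i *: f (u i).
Proof.
move=> lf; pose F : {linear V -> V} := HB.pack f (GRing.isLinear.Build R V V _ f lf).
by rewrite -[f]/(F : V -> V) linear_sum; apply: eq_bigr => i _; rewrite linearZ.
Qed.

(** Dimension count: an injective linear map of [a] into itself is onto, so the inverse preserves
    [a] as well. *)
Lemma linear_stable_image (f g : V -> V) (a : {vspace V}) : linear f -> linear g ->
  cancel f g -> cancel g f -> (forall h, h \in a -> f h \in a) ->
  f @` [set` a] = [set` a] /\ forall h, h \in a -> g h \in a.
Proof.
move=> lf lg fK gK fa.
pose F : {linear V -> V} := HB.pack f (GRing.isLinear.Build R V V _ f lf).
have FaE : (linfun F @: a = a)%VS.
  apply/eqP; rewrite eqEdim; apply/andP; split.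
    by apply/subvP => _ /memv_imgP[h ha ->]; rewrite lfunE; exact: fa.
  suff k0 : (a :&: lker (linfun F) = 0)%VS by rewrite (limg_dim_eq k0).
  apply/eqP; rewrite -subv0; apply/subvP => h; rewrite memv_cap memv_ker lfunE memv0 => /andP[_ /eqP h0].
  rewrite -(fK h) -[f h]/(F h) h0; apply/eqP; have := lg (-1) 0 0.
  by rewrite !scaleN1r !addNr.
have ga h : h \in a -> g h \in a.
  by rewrite -{1}FaE => /memv_imgP[h' h'a ->]; rewrite lfunE /= fK.
split=> //; apply/seteqP; split=> [_ [h ha <-]|h ha]; first exact: fa.
by exists (g h); [exact: ga|rewrite gK].
Qed.

End CurveCalculus.

(** * The compact group, its adjoint action and its Weyl group *)

Section CompactAnalyticSubgroup.
Variables (R : realType) (n : nat).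
Local Notation V := 'rV[R]_n.
Variables (br : {bilinear V -> V -> V}) (s : 'End(V)) (ip : V -> V -> R).
Hypotheses (br_lie : is_lie_bracket br) (br_semisimple : is_semisimple br).
Hypothesis s_invol : is_involutive_automorphism br s.
Hypothesis ipDl : forall x y z, ip (x + y) z = ip x z + ip y z.
Hypothesis ipZl : forall c x z, ip (c *: x) z = c * ip x z.
Hypothesis ipC : forall x y, ip x y = ip y x.
Hypothesis ip_pos : forall x, x != 0 -> 0 < ip x x.
Hypothesis ip_s : forall x y, ip (s x) (s y) = ip x y.
Hypothesis ip_k : forall z x y, z \in kpart s -> ip (br z x) y + ip x (br z y) = 0.
Variables (G : topGroupType) (atlas : set (chart R n G)) (c : chart R n G).
Hypotheses (G_lie : is_lie_group atlas) (c_atlas : atlas c) (c_one : cdom c 1%g).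
Hypothesis G_br : lie_algebra_is c br.

Local Notation K := (analytic_subgroup c (kpart s)).
Local Notation ops := (one_parameter_subgroup c).
Local Notation aut := (symmetric_automorphism br s ip).

Let ipl y : linear (ip^~ y : V -> R^o). Proof. by move=> k u v; rewrite ipDl ipZl. Qed.
Let ipr y : linear (ip y : V -> R^o).
Proof. by move=> k u v; rewrite (formDr ipDl ipC) (formZr ipZl ipC). Qed.

Lemma ops_one gam x : ops gam x -> gam 0 = 1%g.
Proof. by move=> [h _ _]; apply: (@mulgI _ (gam 0)); rewrite -h addr0 mulg1. Qed.

Lemma ops_scale gam x (k : R) : ops gam x -> ops (fun t => gam (k * t)) (k *: x).
Proof.
move=> [gD gc gd]; split; first by move=> t u; rewrite mulrDr gD.
  move=> t; apply: (@continuous_comp _ _ _ (fun t => k * t) gam); last exact: gc.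
  by apply: cvgM; [exact: cvg_cst|exact: cvg_id].
have d1 : is_derive (0 : R) 1 (fun t : R => k * t) k.
  have := is_deriveZ k (is_derive_id (0 : R) (1 : R)).
  by rewrite [X in is_derive _ _ _ X]/GRing.scale /= mulr1.
have gd' : differentiable (fun t => c (gam t)) (k * 0).
  by rewrite mulr0; apply/derivable1_diffP; case: gd.
have := is_derive_diff_comp gd' d1; rewrite mulr0.
rewrite -[k in 'd _ _ k]mulr1 -[k * 1]/(k *: (1 : R)) linearZ /=.
rewrite -deriveE; last by rewrite -(mulr0 k).
by have [_ ->] := gd.
Qed.

Lemma ops_analytic gam x (t : R) : x \in kpart s -> ops gam x -> K (gam t).
Proof.
move=> xk gx; apply: sub_gen_smallest; exists (fun u => gam (t * u)), (t *: x).
by split; [exact: memvZ|exact: ops_scale|rewrite mulr1].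
Qed.

Lemma Ad_ops_derive gam x y (t : R) : ops gam x ->
  is_derive t 1 (fun t => Ad c (gam t) y) (br x (Ad c (gam t) y)).
Proof. exact: (is_derive_Ad G_lie c_atlas c_one G_br). Qed.

Let Ad1 x : Ad c 1%g x = x. Proof. exact: (Ad_one G_lie c_atlas c_one). Qed.
Let AdM g h x : Ad c (g * h)%g x = Ad c g (Ad c h x). Proof. exact: (Ad_mul G_lie c_atlas c_one). Qed.
Let AdK g : cancel (Ad c g) (Ad c g^-1%g). Proof. exact: (AdV G_lie c_atlas c_one). Qed.
Let AdVK' g : cancel (Ad c g^-1%g) (Ad c g). Proof. exact: (AdVK G_lie c_atlas c_one). Qed.

(** The defect of each identity along [gam] is 0 at time 0 and solves a linear equation:
    [y' = br x y] for the bracket, by Jacobi, and for [s], by [s x = x]; [y' = 0] for [ip], by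
    skewness. *)
Lemma ops_automorphism gam x : x \in kpart s -> ops gam x -> aut (Ad c (gam 1)).
Proof.
move=> xk gx; have g0 := ops_one gx; have sx : s x = x by apply/kpartP.
have lb z : linear (br z) by move=> k u v; rewrite brDr brZr.
have d u (t : R) := Ad_ops_derive u t gx.
split; first exact: Ad_linear.
- move=> u v; apply/esym/eqP; rewrite -subr_eq0; apply/eqP.
  apply: (@linear_flow_zero _ _ (fun t => br (Ad c (gam t) u) (Ad c (gam t) v) - Ad c (gam t) (br u v)) (br x)) => //.
    move=> t k.
    have bl y : linear ((fun p => br p y 0 k) : V -> R^o) by move=> l p q; rewrite brDl brZl !mxE.
    have br' y : linear ((fun q => br y q 0 k) : V -> R^o) by move=> l p q; rewrite brDr brZr !mxE.
    have b1 := is_derive_bilinear_form (F := fun p q => br p q 0 k) bl br' (d u t) (d v t).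
    have h := is_deriveB b1 (is_derive_coord k (d (br u v) t)).
    set D := (X in is_derive _ _ _ X) in h.
    have -> : br x (br (Ad c (gam t) u) (Ad c (gam t) v) - Ad c (gam t) (br u v)) 0 k = D.
      by rewrite brDr brNr (br_jacobi br_lie x (Ad c (gam t) u)) /D !mxE.
    move: h; rewrite (_ : (_ - _) = (fun t => (br (Ad c (gam t) u) (Ad c (gam t) v) - Ad c (gam t) (br u v)) 0 k))//.
    by apply/funext => w; rewrite !mxE.
  by rewrite g0 !Ad1 subrr.
- move=> u; apply/esym/eqP; rewrite -subr_eq0; apply/eqP.
  apply: (@linear_flow_zero _ _ (fun t => s (Ad c (gam t) u) - Ad c (gam t) (s u)) (br x)) => //.
    move=> t k.
    have sl : linear (fun v : V => s v 0 k : R^o) by move=> l p q; rewrite linearP !mxE.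
    have := is_deriveB (is_derive_functional sl (d u t)) (is_derive_coord k (d (s u) t)).
    rewrite (_ : (_ - _) = (fun t => (s (Ad c (gam t) u) - Ad c (gam t) (s u)) 0 k)); last first.
      by apply/funext => w; rewrite !mxE.
    have [_ sb] := s_invol.
    by rewrite sb sx brDr brNr !mxE.
  by rewrite g0 !Ad1 subrr.
- move=> u v; apply/eqP; rewrite -subr_eq0; apply/eqP.
  apply: (@linear_ode_zero R unit (fun _ t => ip (Ad c (gam t) u) (Ad c (gam t) v) - ip u v) (fun _ _ => 0) _ _ tt) => //.
    move=> _ t; rewrite big1 => [|w _]; last by rewrite mul0r.
    have h := is_deriveB (is_derive_bilinear_form ipl ipr (d u t) (d v t)) (is_derive_cst (ip u v) t 1).
    by rewrite (ip_k _ _ xk) subr0 in h; exact: h.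
  by move=> _; rewrite g0 !Ad1 subrr.
Qed.

Lemma automorphism_inv g : aut (Ad c g) -> aut (Ad c g^-1%g).
Proof.
move=> [_ fb fs fi]; have inj := can_inj (AdK g).
split; first exact: Ad_linear.
- by move=> u v; apply: inj; rewrite fb !AdVK'.
- by move=> u; apply: inj; rewrite fs !AdVK'.
- by move=> u v; rewrite -fi !AdVK'.
Qed.

(** Carrying the inverse along makes the set closed under inversion; the inverse of a generator is
    the generator for [- x]. *)
Lemma analytic_subgroup_ind (P : G -> Prop) : P 1%g ->
  (forall g h, P g -> P h -> P (g * h)%g) ->
  (forall gam x, x \in kpart s -> ops gam x -> P (gam 1)) ->
  forall g, K g -> P g /\ P g^-1%g.
Proof.
move=> P1 PM PG g; apply: (@smallest_sub _ _ _ [set g | P g /\ P g^-1%g]).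
  split; first by rewrite /= invg1.
    by move=> g1 h1 [/= a1 a2] [b1 b2]; split; [exact: PM|rewrite invgM; exact: PM].
  by move=> g1 [/= a1 a2]; split=> //; rewrite invgK.
move=> _ [gam [x [xk gx ->]]]; split; first exact: PG gx.
have -> : ((gam 1%R)^-1)%g = gam (-1 * 1).
  have [gD _ _] := gx; apply: (mulgI (gam 1)); rewrite mulgV -gD mulr1 subrr.
  by rewrite (ops_one gx).
by apply: (PG (fun u => gam (-1 * u)) (-1 *: x)); [exact: memvZ|exact: ops_scale].
Qed.

Lemma analytic_subgroup_group : is_subgroup K.
Proof.
split.
- by move=> S [[]].
- by move=> g h Kg Kh S hS; have [[_ SM _] _] := hS; apply: SM; [exact: Kg|exact: Kh].
- by move=> g Kg S hS; have [[_ _ SV] _] := hS; apply: SV; exact: Kg.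
Qed.

Lemma analytic_automorphism g : K g -> aut (Ad c g).
Proof.
move=> Kg; suff [h1 h2 h3] : [/\ aut (Ad c 1%g), forall g h, aut (Ad c g) -> aut (Ad c h) -> aut (Ad c (g * h)%g)
    & forall gam x, x \in kpart s -> ops gam x -> aut (Ad c (gam 1))].
  exact: (analytic_subgroup_ind (P := fun g => aut (Ad c g)) h1 h2 h3 Kg).1.
split.
- by split; [exact: Ad_linear|move=> u v; rewrite !Ad1|move=> u; rewrite !Ad1|move=> u v; rewrite !Ad1].
- move=> g1 h1 [_ b1 s1 i1] [_ b2 s2 i2]; split; first exact: Ad_linear.
  + by move=> u v; rewrite !AdM b2 b1.
  + by move=> u; rewrite !AdM s2 s1.
  + by move=> u v; rewrite !AdM i1 i2.
- by move=> gam x; exact: ops_automorphism.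
Qed.

Local Notation db := (dual_bracket br s ip).
Local Notation Q := (dual_form br s ip).
Let QDl x y z : Q (x + y) z = Q x z + Q y z. Proof. exact: dual_formDl. Qed.
Let QZl k x z : Q (k *: x) z = k * Q x z. Proof. exact: dual_formZl. Qed.
Let QC x y : Q x y = Q y x. Proof. exact: dual_formC. Qed.
Let dD x y z : db (x + y) z = db x z + db y z. Proof. exact: dbDl. Qed.
Let dZ k x z : db (k *: x) z = k *: db x z. Proof. exact: dbZl. Qed.

Section Orthonormal.
Variable e : 'I_n -> V.
Hypothesis e_orth : forall i j, Q (e i) (e j) = (i == j)%:R.
Local Notation M g := (\matrix_(l, i) Q (Ad c g (e i)) (e l)).
Local Notation X := (structure_matrix br s ip e).

Let Ql y : linear (Q^~ y : V -> R^o). Proof. by move=> k u v; rewrite QDl QZl. Qed.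

Let expandQ v : v = \sum_l Q v (e l) *: e l.
Proof. exact: (orthonormal_expand QDl QZl e_orth). Qed.

Let ME g l i : (M g) l i = Q (Ad c g (e i)) (e l). Proof. exact: mxE. Qed.

(** Along [gam] the matrix solves [M' = (sum_j x_j X_j) M] with [x_j] the coordinates of [x],
    because the dual bracket agrees with [br] when the first argument is in [k]. *)
Lemma analytic_preserves_stable g : K g -> preserves_stable X (M g).
Proof.
move=> Kg; suff [h1 h2 h3] : [/\ preserves_stable X (M 1%g),
      forall g h, preserves_stable X (M g) -> preserves_stable X (M h) -> preserves_stable X (M (g * h)%g)
    & forall gam x, x \in kpart s -> ops gam x -> preserves_stable X (M (gam 1))].
  exact: (analytic_subgroup_ind (P := fun g => preserves_stable X (M g)) h1 h2 h3 Kg).1.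
split.
- rewrite (_ : M 1%g = 1%:M); first exact: preserves_stable1.
  by apply/matrixP => l i; rewrite !mxE Ad1 e_orth eq_sym.
- move=> g1 h1 p1 p2; rewrite (_ : M (g1 * h1)%g = M g1 *m M h1); first exact: preserves_stableM.
  apply/matrixP => l i; rewrite !mxE AdM [Ad c h1 (e i)]expandQ.
  have -> : Ad c g1 (\sum_k Q (Ad c h1 (e i)) (e k) *: e k) =
      \sum_k Q (Ad c h1 (e i)) (e k) *: Ad c g1 (e k).
    by apply: linear_lincomb; exact: Ad_linear.
  rewrite (form_suml QDl QZl); apply: eq_bigr => k _.
  exact: (etrans (mulrC _ _) (esym (congr2 *%R (ME g1 l k) (ME h1 k i)))).
- move=> gam x xk gx; apply: (@preserves_stable_flow _ _ X (fun t => M (gam t)) (fun j => Q x (e j))).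
    exact: ler01.
    by apply/matrixP => l i; rewrite !mxE (ops_one gx) Ad1 e_orth eq_sym.
  move=> t l i; have h := is_derive_functional (Ql (e l)) (Ad_ops_derive (e i) t gx).
  rewrite (_ : (fun u => (M (gam u)) l i) = (fun u => Q (Ad c (gam u) (e i)) (e l))); last first.
    by apply/funext => u; rewrite mxE.
  suff -> : ((\sum_j Q x (e j) *: X j) *m M (gam t)) l i = Q (br x (Ad c (gam t) (e i))) (e l) by [].
  rewrite mxE [Ad c (gam t) (e i) in RHS]expandQ.
  have -> : br x (\sum_k Q (Ad c (gam t) (e i)) (e k) *: e k) =
      \sum_k Q (Ad c (gam t) (e i)) (e k) *: br x (e k).
    by rewrite linear_sumr; apply: eq_bigr => k _; rewrite brZr.
  rewrite (form_suml QDl QZl); apply: eq_bigr => k _; rewrite [M _ k i]mxE mulrC; congr (_ * _).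
  have <- : db x (e k) = br x (e k) by exact: db_k.
  rewrite summxE [x in RHS]expandQ.
  have -> : db (\sum_j Q x (e j) *: e j) (e k) = \sum_j Q x (e j) *: db (e j) (e k).
    elim/big_ind2: _ => [|u u' v v' <- <-|j _]; rewrite ?dD ?dZ//.
    by rewrite -{1}[0](scale0r (0 : V)) dZ scale0r.
  by rewrite (form_suml QDl QZl); apply: eq_bigr => j _; rewrite !mxE.
Qed.

End Orthonormal.

Lemma Ad_continuous1 y : continuous (fun g => Ad c g y).
Proof. exact: (Ad_continuous G_lie c_atlas c_one). Qed.

Lemma analytic_dual_bracket g u v : K g -> Ad c g (db u v) = db (Ad c g u) (Ad c g v).
Proof.
move=> Kg; have fA := analytic_automorphism Kg; have gA := automorphism_inv fA.
have fK := AdK g; have gK := AdVK' g.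
exact: (aut_dual_bracket br_lie br_semisimple s_invol ipDl ipZl ipC ip_pos ip_k fA gA gK).
Qed.

Lemma analytic_root_form g u v : K g ->
  trace_form db (Ad c g u) (Ad c g v) = trace_form db u v.
Proof.
move=> Kg; have fA := analytic_automorphism Kg; have gA := automorphism_inv fA.
have fK := AdK g; have gK := AdVK' g.
exact: (aut_root_form br_lie br_semisimple s_invol ipDl ipZl ipC ip_pos ip_k fA gA gK).
Qed.

Lemma analytic_p g x : K g -> x \in ppart s -> Ad c g x \in ppart s.
Proof. by move=> /analytic_automorphism fA; eapply aut_p; eassumption. Qed.

Section WeylGroup.
Variable a : {vspace V}.
Hypothesis a_max : is_maximal_abelian_in br (ppart s) a.
Hypothesis K_compact : compact K.
Local Notation N := (normalizer_in c K a).

Let ap h : h \in a -> h \in ppart s. Proof. by case: a_max => /subvP + _ _; apply. Qed.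

Lemma normalizerI g : K g -> (forall h, h \in a -> Ad c g h \in a) -> N g.
Proof.
move=> Kg ga; split=> //.
by have [] := linear_stable_image (Ad_linear c g) (Ad_linear c g^-1%g) (AdK g) (AdVK' g) ga.
Qed.

Lemma normalizer_a g h : N g -> h \in a -> Ad c g h \in a.
Proof. by move=> [_ E] ha; have : [set` a] (Ad c g h) by rewrite -E; exists h. Qed.

Lemma normalizerV g : N g -> N g^-1%g.
Proof.
move=> Ng; have [_ _ KV] := analytic_subgroup_group.
apply: normalizerI; first by apply: KV; case: Ng.
have ga h := normalizer_a (h := h) Ng.
by have [] := linear_stable_image (Ad_linear c g) (Ad_linear c g^-1%g) (AdK g) (AdVK' g) ga.
Qed.

Lemma normalizerM g h : N g -> N h -> N (g * h)%g.
Proof.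
move=> Ng Nh; have [_ KM _] := analytic_subgroup_group.
apply: normalizerI; first by apply: KM; [case: Ng|case: Nh].
by move=> x xa; rewrite AdM; exact: (normalizer_a Ng (normalizer_a Nh xa)).
Qed.

Lemma normalizer1 : N 1%g.
Proof.
have [K1 _ _] := analytic_subgroup_group.
by apply: normalizerI => // h; rewrite Ad1.
Qed.

Lemma normalizer_compact : compact N.
Proof.
have -> : N = K `&` \bigcap_(h in [set` a]) (fun g => Ad c g h) @^-1` [set x | x \in a].
  apply/seteqP; split=> g.
    by move=> Ng; split; [case: Ng|move=> h ha; exact: normalizer_a].
  by move=> [Kg ga]; apply: normalizerI => // h ha; exact: ga.
apply: compact_closedI => //; apply: closed_bigI => h _.
by apply: closed_comp => [g _|]; [exact: Ad_continuous1|exact: vspace_closed].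
Qed.

Variable e : 'I_n -> V.
Hypothesis e_orth : forall i j, Q (e i) (e j) = (i == j)%:R.
Hypothesis e_root : forall h i, h \in a -> db h (e i) = root br s ip e i h *: e i.
Local Notation regular := (regular br s ip a e).
Local Notation chamber := (chamber br s ip a e).

Lemma analytic_chamber r z : regular r -> z \in ppart s -> exists2 g, K g & chamber r (Ad c g z).
Proof.
move=> rr zp; have [ra _] := rr; have [K1 KM _] := analytic_subgroup_group.
have cont : {within K, continuous (fun g => ip (Ad c g z) r)}.
  apply: continuous_subspaceT => g.
  apply: (@continuous_comp _ _ _ (fun g => Ad c g z) (ip^~ r)); first exact: Ad_continuous1.
  exact: (rV_lin_continuous (E := R^o) (ipl r)).
have [|g] := compact_EVT_max _ K_compact cont; first by exists 1%g.
rewrite inE => Kg gmax; exists g => //; set z' := Ad c g z.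
have z'p : z' \in ppart s by exact: analytic_p.
(* Along [gam] the second derivative is [ip (br xi (br xi z')) r], which skewness turns into minus
   [ip (br xi z') (br xi r)]. *)
have crit xi : xi \in kpart s -> ip (br xi z') r = 0 /\ 0 <= ip (br xi z') (br xi r).
  move=> xk; have [gam gx] := ex_one_parameter G_lie c_atlas c_one xi.
  have g0 := ops_one gx.
  have l2 : linear ((fun v => ip (br xi v) r) : V -> R^o).
    by move=> k u v; rewrite brDr brZr ipDl ipZl.
  have d1 (t : R) := is_derive_functional (ipl r) (Ad_ops_derive z' t gx).
  have d2 := is_derive_functional l2 (Ad_ops_derive z' 0 gx).
  have [|h1 h2] := max_derivatives d1 d2.
    move=> t; rewrite g0 Ad1 /z' -AdM; apply: gmax; rewrite inE.
    by apply: KM => //; exact: ops_analytic xk gx.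
  rewrite g0 Ad1 in h1; rewrite g0 Ad1 in h2; split=> //.
  have : ip (br xi (br xi z')) r + ip (br xi z') (br xi r) = 0 := ip_k _ _ xk.
  by move: h2; lra.
(* The first-order condition in the direction [db z' r], itself in [k], says that the length of this
   vector is zero. *)
have dz : db z' r = 0.
  have zrk : db z' r \in kpart s.
    have -> : db z' r = br (gram_op br ip z') r by eapply db_pp; try eassumption; exact: ap.
    eapply br_pp; try eassumption; last exact: ap.
    by eapply gram_op_p; eassumption.
  apply/eqP; apply: contraT => nz.
  have : 0 < Q (db z' r) (db z' r) by eapply dual_form_pos; eassumption.
  have -> : Q (db z' r) (db z' r) = - ip (br (db z' r) z') r.
    by eapply db_kform; try eassumption; exact: ap.
  by rewrite (crit _ zrk).1 oppr0 ltxx.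
have z'a : z' \in a.
  have rz : db r z' = 0.
    have -> : db r z' = - db z' r by eapply db_anti; eassumption.
    by rewrite dz oppr0.
  exact: (regular_centralizer br_lie br_semisimple s_invol ipDl ipZl ipC ip_pos ip_s ip_k a_max e_orth e_root rr z'p rz).
split=> // i; have pos xi : xi \in kpart s -> 0 <= ip (br xi z') (br xi r) by move=> /crit[].
by eapply second_order_chamber; eassumption.
Qed.

(** For [h] in [a], [h] commutes with [Ad c g z], hence the inverse image of [h] commutes with the
    regular [z] and lies in [a]. *)
Lemma regular_normalizer g z : regular z -> K g -> Ad c g z \in a -> N g.
Proof.
move=> rz Kg gza; have [za _] := rz; have [_ _ KV] := analytic_subgroup_group.
have ga h : h \in a -> Ad c g^-1%g h \in a.
  move=> ha; have xp : Ad c g^-1%g h \in ppart s by apply: analytic_p; [exact: KV|exact: ap].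
  have zx : db z (Ad c g^-1%g h) = 0.
    apply: (can_inj (AdK g)); rewrite analytic_dual_bracket// AdVK'.
    have -> : db (Ad c g z) h = 0 by eapply db_abelian; eassumption.
    by have := Ad_linear c g (-1) 0 0; rewrite !scaleN1r !addNr.
  exact: (regular_centralizer br_lie br_semisimple s_invol ipDl ipZl ipC ip_pos ip_s ip_k a_max e_orth e_root rz xp zx).
have [_ h] := linear_stable_image (Ad_linear c g^-1%g) (Ad_linear c g) (AdVK' g) (AdK g) ga.
by apply: normalizerI => // x; exact: h.
Qed.

(** Maximization yields an element of [K], which normalizes [a] when the point is regular. A general
    [z] is the limit of regular points [z + t r] with [t > 0], and compactness of [N] gives a limit
    of their elements. *)
Lemma weyl_chamber r z : regular r -> z \in a -> exists2 g, N g & chamber r (Ad c g z).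
Proof.
move=> rr za.
have ex (t : R) : exists g, regular (z + t *: r) -> N g /\ chamber r (Ad c g (z + t *: r)).
  have [rt|nrt] := pselect (regular (z + t *: r)); last by exists 1%g.
  have [g Kg gc] := analytic_chamber rr (ap rt.1); exists g => _; split=> //.
  by apply: (regular_normalizer rt Kg); case: gc.
have [gf gfP] := choice ex.
have nr : \forall t \near (0 : R)^'+, regular (z + t *: r).
  by eapply near_regular; eassumption.
have [U [UU sU]] := ultraFilterLemma (at_right_proper_filter (0 : R)).
have nN : \forall t \near U, N (gf t) /\ chamber r (Ad c (gf t) (z + t *: r)).
  by apply: sU; apply: filterS nr => t /gfP.
have nK : \forall t \near U, N (gf t) by apply: filterS nN => t [].
have [k Nk gk] := ultra_compact_cvg UU normalizer_compact nK.
have Ac y : (fun t => Ad c (gf t) y) @ U --> Ad c k y.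
  exact: (cvg_comp _ _ gk (Ad_continuous1 (x := k))).
have t0 : (fun t : R => t) @ U --> (0 : R).
  move=> P P0; apply: sU; exact: (cvg_at_right_filter (f := fun t : R => t) (cvg_id (F := nbhs (0 : R))) P0).
exists k => //; have ca : (Ad c k z) \in a by exact: normalizer_a.
split=> // i.
have yc : (fun t => Ad c (gf t) (z + t *: r)) @ U --> Ad c k z.
  have -> : (fun t => Ad c (gf t) (z + t *: r)) = (fun t => Ad c (gf t) z + t *: Ad c (gf t) r).
    by apply/funext => t; rewrite addrC Ad_linear addrC.
  rewrite -[X in _ --> X]addr0 -(scale0r (Ad c k r)).
  by apply: cvgD; [exact: Ac|apply: cvgZ; [exact: t0|exact: Ac]].
pose l v : R := root br s ip e i r * root br s ip e i v.
have lL : linear (l : V -> R^o).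
  move=> q u v; rewrite /l.
  have -> : root br s ip e i (q *: u + v) = q * root br s ip e i u + root br s ip e i v.
    by rewrite /root dD dZ QDl QZl.
  by rewrite -[q *: _]/(q * _); ring.
have lc := rV_lin_continuous (E := R^o) lL.
have lcv := cvg_comp _ _ yc (lc (Ad c k z)).
have nl : \forall t \near U, [set x : R | 0 <= x] (l (Ad c (gf t) (z + t *: r))).
  by apply: filterS nN => t [_ [_ h]]; exact: h.
have hl := @closed_cvg _ _ U _ _ [set x : R | 0 <= x] (@closed_ge R 0) nl _ lcv.
exact: hl.
Qed.

Lemma weyl_chamber_max r z b g : regular r -> chamber r z -> chamber r b -> N g ->
  trace_form db z (Ad c g b) <= trace_form db z b.
Proof.
move=> rr zc bc [Kg _]; have fA := analytic_automorphism Kg; have gA := automorphism_inv fA.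
have fK := AdK g; have gK := AdVK' g; have [_ _ KV] := analytic_subgroup_group.
have st := analytic_preserves_stable e_orth (KV _ Kg).
exact: (chamber_maximal br_lie br_semisimple s_invol ipDl ipZl ipC ip_pos ip_s ip_k a_max e_orth e_root rr zc bc fA gA fK gK st).
Qed.

End WeylGroup.
End CompactAnalyticSubgroup.

(** * Orthogonal projection onto a subspace *)

Section OrthProjection.
Variables (R : realType) (n : nat).
Local Notation V := 'rV[R]_n.
Variable ip : V -> V -> R.
Hypothesis ipDl : forall x y z, ip (x + y) z = ip x z + ip y z.
Hypothesis ipZl : forall c x z, ip (c *: x) z = c * ip x z.
Hypothesis ipC : forall x y, ip x y = ip y x.
Hypothesis ip_pos : forall x, x != 0 -> 0 < ip x x.
Variable a : {vspace V}.
Local Notation proj := (orth_proj ip a).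

(** [W], the common kernel of the pairings with a basis of [a], meets [a] in 0 and has codimension
    at most the dimension of [a]. *)
Lemma orth_proj_ex x : exists y, y \in a /\ {in a, forall z, ip (x - y) z = 0}.
Proof.
pose l (x : V) : 'rV[R]_(\dim a) := \row_i ip x (vbasis a)`_i.
have lL : linear l by move=> k u v; apply/rowP => j; rewrite !mxE ipDl ipZl.
pose ll : {linear V -> 'rV[R]_(\dim a)} := HB.pack l (GRing.isLinear.Build R V 'rV[R]_(\dim a) _ l lL).
pose W := lker (linfun ll).
have WP u : u \in W -> forall z, z \in a -> ip u z = 0.
  rewrite memv_ker lfunE /= => /eqP h z za; rewrite (coord_vbasis za).
  rewrite (form_sumr ipDl ipZl ipC) big1// => i _.
  by have := congr1 (fun v : 'rV[R]_(\dim a) => v 0 i) h; rewrite !mxE => ->; rewrite mulr0.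
have aW : (a :&: W)%VS = 0%VS.
  apply/eqP; rewrite -subv0; apply/subvP => u; rewrite memv_cap => /andP[ua uW].
  by rewrite memv0; apply: contraT => /ip_pos; rewrite (WP _ uW _ ua) ltxx.
have full : (a + W == {:V})%VS.
  rewrite eqEdim subvf dimv_disjoint_sum//=.
  have := limg_ker_dim (linfun ll) {:V}%VS; rewrite capfv -/W => <-; rewrite addnC leq_add2r.
  by have := dimvS (subvf (linfun ll @: {:V})%VS); rewrite dimvf /dim /= mul1n.
have : x \in (a + W)%VS by rewrite (eqP full) memvf.
case/memv_addP => y ya [w wW ->]; exists y; split=> // z za.
have -> : y + w - y = w by rewrite addrC addKr.
exact: WP.
Qed.

Lemma orth_projP x : proj x \in a /\ {in a, forall z, ip (x - proj x) z = 0}.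
Proof.
exact: (@getPex _ [set y | y \in a /\ {in a, forall z, ip (x - y) z = 0}] (orth_proj_ex x)).
Qed.

Lemma orth_proj_uniq x y : y \in a -> {in a, forall z, ip (x - y) z = 0} -> proj x = y.
Proof.
move=> ya yP; have [pa pP] := orth_projP x.
apply/eqP; rewrite -subr_eq0; apply: contraT => /ip_pos.
have da : proj x - y \in a by exact: memvB.
have -> : ip (proj x - y) (proj x - y) = ip (x - y) (proj x - y) - ip (x - proj x) (proj x - y).
  rewrite -(formBl ipDl ipZl); congr ip; by apply/rowP => i; rewrite !mxE; ring.
by rewrite yP// pP// subrr ltxx.
Qed.

Lemma orth_proj_linear : linear proj.
Proof.
move=> k x y; have [xa xP] := orth_projP x; have [ya yP] := orth_projP y.
apply: orth_proj_uniq; first by apply: memvD => //; exact: memvZ.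
move=> z za; have -> : k *: x + y - (k *: proj x + proj y) = k *: (x - proj x) + (y - proj y).
  by apply/rowP => i; rewrite !mxE; ring.
by rewrite ipDl ipZl xP// yP// mulr0 addr0.
Qed.

Lemma orth_proj_equivariant (f g : V -> V) x : linear f -> cancel g f ->
  (forall u v, ip (f u) (f v) = ip u v) -> (forall h, h \in a -> f h \in a) ->
  (forall h, h \in a -> g h \in a) -> proj (f x) = f (proj x).
Proof.
move=> lf gK fi fa ga; have [xa xP] := orth_projP x.
apply: orth_proj_uniq; first exact: fa.
move=> z za; rewrite -[z]gK.
have -> : f x - f (proj x) = f (x - proj x).
  have h := lf (-1) (proj x) x; rewrite !scaleN1r in h.
  by rewrite addrC -h; congr (f _); exact: addrC.
by rewrite fi xP//; exact: ga.
Qed.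

End OrthProjection.

(** * Norm bounds *)

Section LinearBound.
Variables (R : realType) (n : nat).
Local Notation V := 'rV[R]_n.

Lemma linear_bounded_norm (f : V -> V) : linear f -> exists2 C : R, 0 <= C & forall x, `|f x| <= C * `|x|.
Proof.
move=> lf; exists (\sum_i `|f (delta_mx 0 i)|); first by apply: sumr_ge0.
move=> x; rewrite {1}(row_sum_delta x) (linear_lincomb _ _ lf).
apply: le_trans (ler_norm_sum _ _ _) _; rewrite mulr_suml; apply: ler_sum => i _.
by rewrite normrZ mulrC ler_wpM2l//; exact: rV_coord_le_norm.
Qed.

(** One constant for all isometries, hence uniform over [K]. *)
Lemma isometry_bounded_norm (ip : V -> V -> R) :
  (forall x y z, ip (x + y) z = ip x z + ip y z) -> (forall c x z, ip (c *: x) z = c * ip x z) ->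
  (forall x y, ip x y = ip y x) -> (forall x, x != 0 -> 0 < ip x x) ->
  exists2 C : R, 0 <= C & forall f : V -> V, (forall x y, ip (f x) (f y) = ip x y) ->
    forall x, `|f x| <= C * `|x|.
Proof.
move=> ipDl ipZl ipC ip_pos.
have [c c0 cP] := form_coercive ipDl ipZl ipC (a := {:V}%VS) (fun x _ => @ip_pos x).
have [C C0 CP] := form_bounded ipDl ipZl ipC.
exists (Num.sqrt (C / c)); first exact: sqrtr_ge0.
move=> f fi x; rewrite -(ler_sqr (_ : `|f x| \in Num.nneg)) ?nnegrE ?mulr_ge0 ?sqrtr_ge0//.
rewrite exprMn sqr_sqrtr; last exact: (divr_ge0 (ltW C0) (ltW c0)).
rewrite -(ler_pM2l c0) [leRHS]mulrA [c * (C / c)]mulrC mulfVK ?gt_eqF//.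
apply: le_trans (cP (f x) (memvf _)) _; rewrite fi; exact: CP.
Qed.

End LinearBound.

(** * The group data as an instance of the reduced control system *)

Theorem theorem5p3 (R : realType) (n : nat)
    (br : {bilinear 'rV[R]_n -> 'rV[R]_n -> 'rV[R]_n})
    (s : 'End('rV[R]_n)) (ip : {dot 'rV[R]_n for idfun})
    (G : topGroupType) (atlas : set (chart R n G)) (c : chart R n G)
    (K : set G) (a : {vspace 'rV[R]_n}) (X : 'rV[R]_n -> 'rV[R]_n)
    (br_lie : is_lie_bracket br)
    (br_semisimple : is_semisimple br)
    (s_invol : is_involutive_automorphism br s)
    (br_orthogonal : compactly_embedded br (kpart s))
    (ip_invariant : is_invariant_dot ip br s)
    (G_lie : is_lie_group atlas)
    (c_atlas : atlas c) (c_one : cdom c 1%g)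
    (G_br : lie_algebra_is c br)
    (K_def : K = analytic_subgroup c (kpart s))
    (K_compact : compact K)
    (a_max : is_maximal_abelian_in br (ppart s) a)
    (X_field : {in ppart s, forall x, X x \in ppart s})
    (X_affine : is_affine_vector_field (ppart s) X)
    (x : R -> 'rV[R]_n)
    (x_sol : relaxed_solution a (derv c K a ip X) x)
    (b0 : 'rV[R]_n) (b0_a : b0 \in a)
    (x0_b0 : majorized c K a (x 0) b0) :
  exists y : R -> 'rV[R]_n,
    [/\ relaxed_solution a (derv c K a ip X) y,
        y 0 = b0
      & forall t : R, 0 <= t -> majorized c K a (x t) (y t)].
Proof.
have ipDl (u v z : 'rV[R]_n) : ip (u + v) z = ip u z + ip v z by exact: linearDl.
have ipZl (k : R) (u z : 'rV[R]_n) : ip (k *: u) z = k * ip u z.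
  by first [exact: linearZl_LR|exact: linearZl].
have ipC (u v : 'rV[R]_n) : ip u v = ip v u by rewrite hermC expr0 mul1r.
have ip_pos (u : 'rV[R]_n) : u != 0 -> 0 < ip u u by exact: neq0_dnorm_gt0.
have [ip_s ip_k] := ip_invariant.
subst K; set K := analytic_subgroup c (kpart s).
set N := normalizer_in c K a.
pose F (u v : 'rV[R]_n) : R := ip u v.
have FDl (u v z : 'rV[R]_n) : F (u + v) z = F u z + F v z by exact: ipDl.
have FZl (k : R) (u z : 'rV[R]_n) : F (k *: u) z = k * F u z by exact: ipZl.
have FC (u v : 'rV[R]_n) : F u v = F v u by exact: ipC.
have F_pos (u : 'rV[R]_n) : u != 0 -> 0 < F u u by exact: ip_pos.
have F_s (u v : 'rV[R]_n) : F (s u) (s v) = F u v by exact: ip_s.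
have F_k (z u v : 'rV[R]_n) : z \in kpart s -> F (br z u) v + F u (br z v) = 0 by exact: ip_k.
have lieK : is_subgroup K by exact: analytic_subgroup_group.
have K1 : K 1%g by case: lieK.
have KM g h : K g -> K h -> K (g * h)%g by case: lieK => _ + _; apply.
have KV g : K g -> K g^-1%g by case: lieK => _ _; apply.
have fA g : K g -> symmetric_automorphism br s F (Ad c g).
  by move=> Kg; eapply analytic_automorphism; eassumption.
have [e [eo er]] : exists e : 'I_n -> 'rV[R]_n,
    (forall i j, dual_form br s F (e i) (e j) = (i == j)%:R) /\
    forall h i, h \in a -> dual_bracket br s F h (e i) = root br s F e i h *: e i.
  by eapply root_basis; eassumption.
have [r rr] : exists r, regular br s F a e r by eapply ex_regular; eassumption.
have Nc : compact N by eapply normalizer_compact; eassumption.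
have NK g : N g -> K g by case.
have Na g h : N g -> h \in a -> Ad c g h \in a.
  by move=> [_ E] ha; have : [set` a] (Ad c g h) by rewrite -E; exists h.
have NV g : N g -> N g^-1%g by move=> Ng; eapply normalizerV; eassumption.
have NM g h : N g -> N h -> N (g * h)%g by move=> Ng Nh; exact: (normalizerM G_lie c_atlas c_one Ng Nh).
have N1 : N 1%g by eapply normalizer1; eassumption.
(* The chamber inequality is available for this form rather than for [ip]; it is Weyl invariant
   because [K] acts by automorphisms of the dual bracket. *)
pose B := trace_form (dual_bracket br s F).
have Dex b : b \in a -> exists2 g, N g & chamber br s F a e r (Ad c g b).
  by move=> ba; eapply weyl_chamber; eassumption.
have Dmax z b g : z \in a -> b \in a -> chamber br s F a e r z -> chamber br s F a e r b -> N g ->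
    B z (Ad c g b) <= B z b.
  by move=> _ _ zc bc Ng; eapply weyl_chamber_max; eassumption.
have Bpos u : u \in a -> u != 0 -> 0 < B u u.
  by move=> ua u0; eapply root_form_pos; eassumption.
have Binv g u v : N g -> u \in a -> v \in a -> B (Ad c g u) (Ad c g v) = B u v.
  by move=> /NK Kg _ _; eapply analytic_root_form; eassumption.
have BDl u v z : B (u + v) z = B u z + B v z by exact: root_formDl.
have BZl k u z : B (k *: u) z = k * B u z by exact: root_formZl.
have BC u v : B u v = B v u by exact: trace_formC.
have AdM g h u : Ad c (g * h)%g u = Ad c g (Ad c h u) := Ad_mul G_lie c_atlas c_one g h u.
have Ad1 u : Ad c 1%g u = u := Ad_one G_lie c_atlas c_one u.
have AdK g u : Ad c g^-1%g (Ad c g u) = u := AdV G_lie c_atlas c_one g u.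
have AdKV g u : Ad c g (Ad c g^-1%g u) = u := AdVK G_lie c_atlas c_one g u.
have AdC u : continuous (fun g => Ad c g u) by exact: (Ad_continuous G_lie c_atlas c_one).
have AdL g := Ad_linear c g.
have ap h : h \in a -> h \in ppart s by case: a_max => /subvP + _ _; apply.
have Kp g u : K g -> u \in ppart s -> Ad c g u \in ppart s.
  move=> Kg /ppartP uN; have [_ _ sA _] := fA g Kg; apply/ppartP.
  by rewrite -sA uN /Ad linearN.
pose proj := orth_proj F a.
have projL : linear proj by exact: orth_proj_linear.
have proja u : proj u \in a by have [] := orth_projP FDl FZl FC F_pos a u.
have [Lx [c0 XE]] := X_affine.
have LxL : linear Lx by move=> k u v; rewrite linearP.
pose f := induced_field c a F X.
have fE k b : K k -> b \in a -> f k b = proj (Ad c k^-1%g (Lx (Ad c k b) + c0)).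
  by move=> Kk ba; rewrite /f /induced_field XE//; apply: Kp => //; exact: ap.
have [Pn Pn0 PnP] := linear_bounded_norm projL.
have [Cn Cn0 CnP] := linear_bounded_norm LxL.
have [In In0 InP] := isometry_bounded_norm FDl FZl FC F_pos.
have InK k u : K k -> `|Ad c k u| <= In * `|u|.
  by move=> Kk; apply: InP => u' v'; case: (fA k Kk).
have linB (h : 'rV[R]_n -> 'rV[R]_n) u v : linear h -> h u - h v = h (u - v).
  by move=> lh; have := lh (-1) v u; rewrite !scaleN1r [- v + _]addrC => ->; rewrite addrC.
(* The factors bound, in order, the projection, the adjoint action of the inverse, the linear part
   of [X] and the adjoint action. *)
have fL k b b' : K k -> b \in a -> b' \in a -> `|f k b - f k b'| <= Pn * (In * (Cn * In)) * `|b - b'|.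
  move=> Kk ba ba'; rewrite !fE// (linB _ _ _ projL) (linB _ _ _ (AdL _)) opprD addrACA subrr addr0.
  rewrite (linB _ _ _ LxL) (linB _ _ _ (AdL _)) -!mulrA.
  apply: le_trans (PnP _) _; rewrite ler_wpM2l//.
  apply: le_trans (InK _ _ (KV _ Kk)) _; rewrite ler_wpM2l//.
  by apply: le_trans (CnP _) _; rewrite ler_wpM2l//; exact: InK.
have L0 : 0 <= Pn * (In * (Cn * In)) by rewrite !mulr_ge0.
(* Joint continuity from continuity at fixed vectors, by expansion of the moving vector in the
   standard basis. *)
have AdJ (v : G -> 'rV[R]_n) (w : G -> G) g : {for g, continuous v} -> {for g, continuous w} ->
    {for g, continuous (fun h => Ad c (w h) (v h))}.
  move=> vc wc.
  have E h : Ad c (w h) (v h) = \sum_i v h 0 i *: Ad c (w h) (delta_mx 0 i).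
    by rewrite {1}(row_sum_delta (v h)) (linear_lincomb _ _ (AdL _)).
  rewrite (_ : (fun h => Ad c (w h) (v h)) = (fun h => \sum_i v h 0 i *: Ad c (w h) (delta_mx 0 i))); last first.
    by apply/funext => h; rewrite E.
  apply: (@cvg_sumr _ (nbhs g) (nbhs_filter g)) => i; apply: cvgZ.
    exact: (cvg_comp _ _ vc (coord_continuous (x := _))).
  apply: (@cvg_comp _ _ _ w (fun h => Ad c h (delta_mx 0 i)) (nbhs g) (nbhs (w g)) _ wc).
  exact: (AdC (delta_mx 0 i) (w g)).
have dcomp b : b \in a -> compact [set f k b | k in K].
  move=> ba; have -> : [set f k b | k in K] = (fun k => proj (Ad c k^-1%g (Lx (Ad c k b) + c0))) @` K.
    by apply/seteqP; split=> _ [k Kk <-]; exists k => //; rewrite fE.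
  apply: continuous_compact => //; apply: continuous_subspaceT => g.
  apply: (@continuous_comp _ _ _ (fun k => Ad c k^-1%g (Lx (Ad c k b) + c0)) proj); last first.
    exact: rV_lin_continuous.
  apply: AdJ; last by case: G_lie => _ [_ ic _ _]; exact: ic.
  apply: (cvgD (F := nbhs g)); last exact: cvg_cst.
  apply: (@cvg_comp _ _ _ (fun h => Ad c h b) Lx (nbhs g) (nbhs (Ad c g b)) _ (AdC b g)).
  exact: (rV_lin_continuous LxL).
have orbc b : b \in a -> compact [set Ad c g b | g in N].
  by move=> _; apply: continuous_compact => //; apply: continuous_subspaceT; exact: AdC.
(* Weights of sum 1 reproduce the constant term [c0]; every other map in the composition is
   linear. *)
have faff k (I : finType) (l : I -> R) (u : I -> 'rV[R]_n) : K k -> (forall i, u i \in a) ->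
    \sum_i l i = 1 -> f k (\sum_i l i *: u i) = \sum_i l i *: f k (u i).
  move=> Kk ua l1; rewrite fE//; last by apply: memv_suml => i _; exact: memvZ.
  have E : Lx (Ad c k (\sum_i l i *: u i)) + c0 = \sum_i l i *: (Lx (Ad c k (u i)) + c0).
    rewrite (linear_lincomb l u (AdL k)) (linear_lincomb l (fun i => Ad c k (u i)) LxL).
    under [RHS]eq_bigr => i _ do rewrite scalerDr.
    by rewrite big_split/= -scaler_suml l1 scale1r.
  rewrite E (linear_lincomb l (fun i => Lx (Ad c k (u i)) + c0) (AdL k^-1%g)).
  rewrite (linear_lincomb l (fun i => Ad c k^-1%g (Lx (Ad c k (u i)) + c0)) projL).
  by apply: eq_bigr => i _; rewrite (fE k (u i) Kk (ua i)).
(* The witness is [k * g]: the projection commutes with [Ad c g], an isometry that preserves [a]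
   together with its inverse. *)
have fw g k : N g -> K k -> exists2 k', K k' & forall b, b \in a -> f k (Ad c g b) = Ad c g (f k' b).
  move=> Ng Kk; have Kg := NK _ Ng; exists (k * g)%g; first exact: KM.
  move=> b ba; rewrite (fE k (Ad c g b) Kk (Na g b Ng ba)) (fE (k * g)%g b (KM _ _ Kk Kg) ba).
  have eqv y : proj (Ad c g y) = Ad c g (proj y).
    apply: (@orth_proj_equivariant _ _ F FDl FZl FC F_pos a (Ad c g) (Ad c g^-1%g) y (AdL g) (AdKV g)).
    - by case: (fA g Kg).
    - by move=> h; exact: Na.
    - by move=> h; apply: Na; exact: NV.
  have e1 : Ad c (k * g)^-1%g (Lx (Ad c (k * g)%g b) + c0) =
      Ad c g^-1%g (Ad c k^-1%g (Lx (Ad c k (Ad c g b)) + c0)).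
    by rewrite invgM (AdM g^-1%g k^-1%g) (AdM k g b).
  by rewrite e1 -(eqv (Ad c g^-1%g (Ad c k^-1%g (Lx (Ad c k (Ad c g b)) + c0)))) (AdKV g).
have Kex : exists k, K k by exists 1%g.
have fa k b : K k -> b \in a -> f k b \in a by move=> _ _; exact: proja.
have w1 : exists2 g, N g & forall b, b \in a -> Ad c g b = b by exists 1%g.
have wM g h : N g -> N h -> exists2 m, N m & forall b, b \in a -> Ad c m b = Ad c g (Ad c h b).
  by move=> Ng Nh; exists (g * h)%g; [exact: NM|move=> b _; rewrite AdM].
have wV g : N g -> exists2 m, N m & forall b, b \in a -> Ad c m (Ad c g b) = b.
  by move=> Ng; exists g^-1%g; [exact: NV|move=> b _; rewrite AdK].
have main := @majorizing_solution R n G a K N f (Ad c) B (chamber br s F a e r).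
clear Pn0 Cn0 In0.
have := main Kex fa _ L0 fL dcomp faff AdL Na w1 wM wV orbc fw BDl BZl BC Bpos Binv Dex Dmax x b0 x_sol b0_a x0_b0.
exact.
Qed.
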